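(* Let $N\in\mathbb{N}$, let $0<\alpha<\beta_1<\beta_2<\dots<\beta_N$ be real numbers, let $c_1\in\mathbb{R}$, and let $\phi:X\to\mathbb{R}$ be the potential constructed in the context from $\alpha$, $\beta_1,\dots,\beta_N$ and $c_1$. Let $\mu_{N+1}$ be the measure of maximal entropy of the subshift $X_{N+1}$. Then for every $\beta>\beta_N$, $\mu_{N+1}$ is the unique equilibrium state of $\beta\phi$.
   Context: $X=\{0,1\}^{\mathbb{Z}}$ is the two-sided full shift on two symbols with shift map $T(x)_n=x_{n+1}$ and metric $d(x,y)=2^{-\inf\{|n|:\,x_n\ne y_n\}}$ for $x\neq y$, $d(x,x)=0$; $\mathrm{dist}(x,E)=\inf_{y\in E}d(x,y)$. All logarithms (including those in entropy) are to base 2. For $n\in\mathbb{N}=\{1,2,\dots\}$, $X_n\subset X$ is the subshift generated by $W_n=\{0^{2^n-1}1,\;1^{2^n-1}0\}$ (two words of length $2^n$), i.e. the closure of the set of all bi-infinite sequences obtained by freely concatenating words of $W_n$ (with any position of the origin). It has a unique measure of maximal entropy, and its topological entropy is $2^{-n}$. Construction of $\phi$: for $n=1,\dots,N$ put $c_{n+1}=c_1+\sum_{j=1}^{n}\frac{1}{2^{j+1}\beta_j}$. For $j\in\mathbb{N}$ put $\delta_j=\frac{10+3\log j}{\alpha j}$ and $\delta_\infty=0$. For $n=1,\dots,N+1$ define $\phi_n(x)=c_n-\delta_j$ if $\mathrm{dist}(x,X_n)=2^{-j}$ (where $j=\infty$ if $x\in X_n$; the case $j=0$ does not occur). Then $\phi(x)=\max\{\phi_n(x):1\le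 n\le N+1\}$, which is continuous. An equilibrium state of a continuous $\psi:X\to\mathbb{R}$ is a $T$-invariant Borel probability measure $\mu$ maximizing $h_\mu(T)+\int_X\psi\,d\mu$ among all $T$-invariant Borel probability measures. *)

(* Defs.v *)
From HB Require Import structures.
From mathcomp Require Import all_boot all_order all_algebra.
From mathcomp Require Import all_classical all_reals all_analysis.

Set Implicit Arguments.
Unset Strict Implicit.
Unset Printing Implicit Defensive.

Import Order.TTheory GRing.Theory Num.Theory.
Import numFieldNormedType.Exports.

Local Open Scope classical_set_scope.
Local Open Scope ring_scope.

(* [ln x = 0] for [x <= 0], hence [x * log2 x = 0] at [x = 0]. *)
Definition log2 {R : realType} (x : R) : R := ln x / ln 2.

(* [false] and [true] stand for the symbols 0 and 1. The parameter [R] only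
   fixes the field in which the metric takes its values. *)
Definition full_shift (R : realType) : Type := int -> bool.

HB.instance Definition _ (R : realType) := Choice.on (full_shift R).
HB.instance Definition _ (R : realType) := Pointed.on (full_shift R).

Definition shift_map {R : realType} (x : full_shift R) : full_shift R :=
  fun n => x (n + 1).

Definition shift_dist {R : realType} (x y : full_shift R) : R :=
  if x == y then 0
  else 2 `^ (- inf [set (`|n|%:~R : R) | n in [set n : int | x n != y n]]).

Section shift_dist_lemmas.
Context {R : realType}.
Implicit Types x y z : full_shift R.

Lemma shift_distxx x : shift_dist x x = 0.
Proof. by rewrite /shift_dist eqxx. Qed.

Lemma shift_dist_sym x y : shift_dist x y = shift_dist y x.
Proof.
rewrite /shift_dist eq_sym; case: ifP => // _; congr (_ `^ (- inf _)).
by apply/seteqP; split => _ [n /= xyn <-]; exists n => //=; rewrite eq_sym.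
Qed.

Lemma shift_dist_pos x y : shift_dist x y = 0 -> x = y.
Proof.
rewrite /shift_dist; case: eqP => // _ /eqP.
by rewrite powR_eq0 (@pnatr_eq0 R).
Qed.

Lemma shift_dist_attained x y : x <> y ->
  exists2 i : int, x i != y i & shift_dist x y = 2 ^- `|i|%N.
Proof.
move=> xy.
have [i0 xyi0] : exists i : int, x i != y i.
  have [//|h] := pselect (exists i : int, x i != y i).
  exfalso; apply: xy; apply/funext => i; apply/eqP.
  by have [//|xyi] := boolP (x i == y i); case: h; exists i.
have ex : exists k, `[< exists2 i : int, `|i|%N = k & x i != y i >].
  by exists `|i0|%N; apply/asboolP; exists i0.
case: (ex_minnP ex) => k /asboolP[i ik xyi] kmin; exists i => //.
rewrite /shift_dist; case: eqP => // _.
have -> : inf [set (`|n|%:~R : R) | n in [set n : int | x n != y n]]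
          = `|i|%N%:R.
  apply/eqP; rewrite eq_le; apply/andP; split.
    apply: ge_inf; last by exists i => //; rewrite abszE.
    by exists 0 => _ [n _ <-]; rewrite ler0z.
  apply: lb_le_inf; first by exists (`|i|%:~R); exists i.
  move=> _ [n /= xyn <-]; rewrite -abszE ler_nat ik; apply: kmin.
  by apply/asboolP; exists n.
by rewrite powRN powR_mulrn.
Qed.

Lemma le_shift_dist x y (i : int) : x i != y i -> 2 ^- `|i|%N <= shift_dist x y.
Proof.
move=> xyi; rewrite /shift_dist; case: eqP => [xy|_].
  by move: xyi; rewrite xy eqxx.
rewrite -powR_mulrn// -powRN ler_powR ?ler1n// lerN2.
apply: ge_inf; last by exists i => //; rewrite abszE.
by exists 0 => _ [n _ <-]; rewrite ler0z.
Qed.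

Lemma shift_dist_ge0 x y : 0 <= shift_dist x y.
Proof. by rewrite /shift_dist; case: ifP => // _; exact: powR_ge0. Qed.

Lemma shift_dist_triangle y x z :
  shift_dist x z <= shift_dist x y + shift_dist y z.
Proof.
have [->|/eqP xz] := eqVneq x z.
  by rewrite shift_distxx addr_ge0// shift_dist_ge0.
have [i xzi ->] := shift_dist_attained xz.
have [xyi|] := boolP (x i != y i).
  by rewrite -[leLHS]addr0 lerD ?le_shift_dist ?shift_dist_ge0.
move=> /negPn/eqP xyi; rewrite xyi in xzi.
by rewrite -[leLHS]add0r lerD ?le_shift_dist ?shift_dist_ge0.
Qed.

End shift_dist_lemmas.

HB.instance Definition _ (R : realType) := @isMetric.Build R (full_shift R)
  shift_dist shift_distxx shift_dist_pos shift_dist_sym shift_dist_triangle.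

(* The Borel sigma-algebra of the metric topology. *)
HB.instance Definition _ (R : realType) :=
  Measurable.copy (full_shift R) (g_sigma_algebraType (@open (full_shift R))).

Definition dist_set {R : realType} {M : metricType R} (x : M) (E : set M) : R :=
  inf [set mdist x y | y in E].

Section entropy.
Context {d : measure_display} {X : measurableType d} {R : realType}.
Variable T : X -> X.

Definition invariant_measure (mu : probability X R) : Prop :=
  forall A, measurable A -> mu (T @^-1` A) = mu A.

(* A finite measurable partition is encoded by a labelling [p : X -> 'I_k] of
   its cells. The cells of the join of [T^-i p] over [i < n] are indexed by
   the words of length [n] over the labels; empty cells contribute 0. *)
Definition join_cell k (p : X -> 'I_k) n (w : n.-tuple 'I_k) : set X :=
  [set x | forall i : 'I_n, p (iter i T x) = tnth w i].

Definition join_entropy (mu : probability X R) k (p : X -> 'I_k) (n : nat) : R :=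
  - \sum_(w : n.-tuple 'I_k)
      fine (mu (join_cell p w)) * log2 (fine (mu (join_cell p w))).

Definition partition_entropy (mu : probability X R) k (p : X -> 'I_k) : R :=
  limn (fun n => join_entropy mu p n / n%:R).

Definition entropy (mu : probability X R) : \bar R :=
  ereal_sup [set h | exists k (p : X -> 'I_k),
    (forall i, measurable (p @^-1` [set i])) /\
    h = (partition_entropy mu p)%:E].

Definition measure_of_maximal_entropy (Y : set X) (mu : probability X R) : Prop :=
  [/\ invariant_measure mu, mu Y = 1%E &
      forall nu : probability X R, invariant_measure nu -> nu Y = 1%E ->
        (entropy nu <= entropy mu)%E].

Definition equilibrium_state (psi : X -> R) (mu : probability X R) : Prop :=
  invariant_measure mu /\
  forall nu : probability X R, invariant_measure nu ->
    (entropy nu + \int[nu]_x (psi x)%:E <= entropy mu + \int[mu]_x (psi x)%:E)%E.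

(* Measures are compared on measurable sets only: a [probability] is a
   function on all sets, unconstrained outside the sigma-algebra. *)
Definition unique_equilibrium_state (psi : X -> R) (mu : probability X R) : Prop :=
  equilibrium_state psi mu /\
  forall nu : probability X R, equilibrium_state psi nu ->
    forall A, measurable A -> nu A = mu A.

End entropy.

(* [x] is the concatenation of the words [w k], [k : int], where [w k] starts
   at coordinate [c k]; nothing forces a word to start at the origin. *)
Definition free_concatenation {R : realType} (W : seq (seq bool)) :
    set (full_shift R) :=
  [set x | exists (w : int -> seq bool) (c : int -> int), forall k : int,
    [/\ w k \in W, c (k + 1) = c k + (size (w k))%:Z &
        forall i : nat, (i < size (w k))%N -> x (c k + i%:Z) = nth false (w k) i]].

Definition generated_subshift {R : realType} (W : seq (seq bool)) :
    set (full_shift R) := closure (free_concatenation W).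

Definition W_ (n : nat) : seq (seq bool) :=
  [:: rcons (nseq (2 ^ n - 1) false) true; rcons (nseq (2 ^ n - 1) true) false].

Definition X_ {R : realType} (n : nat) : set (full_shift R) :=
  generated_subshift (W_ n).

Section potential.
Context {R : realType}.
Variables (N : nat) (alpha : R) (beta : nat -> R) (c1 : R).

(* Only [beta 1, ..., beta N] are used. *)
Definition c_ (n : nat) : R :=
  c1 + \sum_(1 <= j < n) (2 ^+ j.+1 * beta j)^-1.

Definition delta_ (j : nat) : R := (10 + 3 * log2 j%:R) / (alpha * j%:R).

(* For [x] outside the closed set [X_ n], [dist_set x (X_ n)] is [2 ^- j] for
   exactly one [j], which [get] returns. *)
Definition phi_ (n : nat) (x : full_shift R) : R :=
  c_ n - (if x \in X_ n then 0
          else delta_ (get [set j : nat | dist_set x (X_ n) = 2 ^- j])).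

Definition phi (x : full_shift R) : R :=
  \big[Num.max/phi_ 1 x]_(1 <= n < N.+2) phi_ n x.

End potential.

(* Main.v *)
Require Import Defs.
From HB Require Import structures.
From mathcomp Require Import all_boot all_order all_algebra.
From mathcomp Require Import all_classical all_reals all_analysis.
From mathcomp Require Import measurable_realfun.
From mathcomp Require Import ring lra zify.

Set Implicit Arguments.
Unset Strict Implicit.
Unset Printing Implicit Defensive.

Import Order.TTheory GRing.Theory Num.Theory.
Import numFieldNormedType.Exports.

Local Open Scope classical_set_scope.
Local Open Scope ring_scope.

(** Write [h = 2^-(N+1)] and [gap = c_(N+1) - phi]. The function [gap] is
    nonnegative and vanishes exactly on [X_ N.+1] ([gap_eq0]). Everything rests
    on the inequality, for invariant [nu],

      entropy nu <= beta N * \int gap d nu + h        ([gap_variational])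

    and on two facts about [X_ N.+1]: some invariant measure on it has entropy
    at least [h] ([block_measure_entropy]), and at most one does
    ([max_entropy_unique]). For [b > beta N] they give

      entropy nu + b * \int phi d nu <=
        h + b * c_(N+1) - (b - beta N) * \int gap d nu,

    whose right-hand side is at most [h + b * c_(N+1)], a value that the measure
    of maximal entropy attains. An equilibrium state therefore has
    [\int gap = 0], so that it lives on [X_ N.+1], and it has entropy at least
    [h], so that it is the measure of maximal entropy.

    The inequality. The constants [c_ n] are such that every point [x] has a
    level [n], one at which the maximum [phi x] is attained, with

      beta N * gap x + h >= 2^-n + e_j,   e_j = (10 + 3 log j) / j,

    where [j] is the largest radius such that the window of [x] on
    [[-(j-1), j-1]] occurs in a concatenation of words of [W_ n]; on [X_ n] the
    radius is infinite and [e_j] is replaced by [0] ([gap_level]). It suffices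
    to exhibit weights of total mass at most one on the words of length [m],
    such that minus the logarithm of the weight of [x_0 ... x_(m-1)] is at most
    the Birkhoff sum of the left-hand side, up to [O(log m)]: the Gibbs
    inequality, and the approximation of partitions by cylinders, turn such a
    code into a bound on the entropy ([join_entropy_le]). The code cuts the
    window into pieces, each of which occurs in a concatenation of one level
    [n]; a piece of length [l] costs [l / 2^n + 6 + 3 log l]
    ([piece_weight_stretch]). The pieces are chosen greedily, as the ones that
    reach farthest to the right ([greedy_code]). Then all the radii met in a
    piece are at most its length [l], and the [l] terms [e_j >= e_l] pay for
    [10 + 3 log l]. The points of level at most [n] also pay [2^-n] each. The
    points of a level [n' > n] do not, but words common to the two levels have
    length at most [2 * 2^n + 1] ([in_lang_overlap]), so that these points have
    such a small radius that their [e_j] alone is large enough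
    ([radius_cost_short]).

    Uniqueness. For blocks of length [L >= 4] a point is cut into blocks in at
    most one way ([starts_block_sync]). Coding [l] blocks at a time by their law
    bounds the entropy by the entropy of this law divided by [l * L]
    ([block_entropy_le]). Entropy [1 / L] forces the law to be uniform on [2^l]
    words ([max_entropy_uniform]), and the laws of the blocks determine the
    measure ([eq_measure_block_law]).

    Existence. Concatenate blocks with independent fair bits, in a uniformly
    distributed phase; the fair bits are the binary digits of a uniform number
    ([block_measure_exists]). *)

(** * Binary words and renewal codes *)
Fixpoint words (m : nat) : seq (seq bool) :=
  if m is m'.+1 then map (cons false) (words m') ++ map (cons true) (words m')
  else [:: [::]].

Lemma mem_words m (w : seq bool) : (w \in words m) = (size w == m).
Proof.
elim: m w => [|m IH] [|b w] //=.
  by rewrite mem_cat; apply/negbTE/negP => /orP[] /mapP[].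
rewrite mem_cat eqSS -IH; apply/orP/idP => [[]/mapP[v vm [_ ->]] //|wm].
by case: b; [right|left]; apply/mapP; exists w.
Qed.

Lemma words_uniq m : uniq (words m).
Proof.
elim: m => //= m IH; rewrite cat_uniq !map_inj_uniq ?IH ?andbT//=; try by move=> ? ? [].
by apply/hasPn => _ /mapP[v _ ->]; apply/negP => /mapP[].
Qed.

Lemma size_words m : size (words m) = (2 ^ m)%N.
Proof. by elim: m => //= m IH; rewrite size_cat !size_map IH addnn expnS mul2n. Qed.

Lemma sum_words_cat (R : nmodType) a b (f : seq bool -> R) :
  \sum_(w <- words (a + b)) f w =
  \sum_(u <- words a) \sum_(v <- words b) f (u ++ v).
Proof.
elim: a f => [|a IH] f /=; first by rewrite big_seq1.
by rewrite !big_cat /= !big_map !IH.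
Qed.

Lemma sum_words_delta (R : pzSemiRingType) m (w : seq bool) : size w = m ->
  \sum_(u <- words m) (u == w)%:R = 1 :> R.
Proof.
move=> sw; rewrite (bigD1_seq w) ?words_uniq ?mem_words ?sw ?eqxx//=.
by rewrite big1 ?addr0// => u /negbTE ->.
Qed.

Section renewal.
Variables (R : realType) (kappa : seq bool -> R).
Hypothesis kappa_ge0 : forall u, 0 <= kappa u.
Hypothesis kappa_mass : forall M,
  \sum_(1 <= l < M.+1) \sum_(u <- words l) kappa u <= 1.

(** The probability that a renewal process with pieces of law [kappa] produces
    [w] as a sequence of complete pieces. The fuel makes the recursion
    structural; [renewal__fuel] shows that [size w] is enough. *)
Fixpoint renewal_ (fuel : nat) (w : seq bool) : R :=
  (w == [::])%:R +
  if fuel is f.+1 then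
    \sum_(1 <= l < (size w).+1) kappa (take l w) * renewal_ f (drop l w)
  else 0.

Definition renewal w := renewal_ (size w) w.

Lemma renewal__ge0 f w : 0 <= renewal_ f w.
Proof.
elim: f w => [|f IH] w /=; rewrite addr_ge0//.
by apply: sumr_ge0 => l _; rewrite mulr_ge0.
Qed.

Lemma renewal__nil f : renewal_ f [::] = 1.
Proof. by case: f => [|f] /=; rewrite ?big_nil addr0. Qed.

(** Summing over the length and the value of the first piece leaves at most one
    for the rest, by induction, and at most one for the first piece. *)
Lemma renewal__mass f m : \sum_(w <- words m) renewal_ f w <= 1.
Proof.
elim: f m => [|f IH] [|m].
- by rewrite big_seq1 /= addr0.
- rewrite big_seq big1 ?ler01// => w; rewrite mem_words /= => /eqP sw.
  by case: w sw => //= ? ? _; rewrite addr0.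
- by rewrite big_seq1 renewal__nil.
apply: le_trans (kappa_mass m.+1).
have -> : \sum_(w <- words m.+1) renewal_ f.+1 w =
  \sum_(1 <= l < m.+2) \sum_(w <- words m.+1)
      kappa (take l w) * renewal_ f (drop l w).
  rewrite [RHS]exchange_big big_seq [RHS]big_seq; apply: eq_bigr => w.
  by rewrite mem_words => /eqP sw; case: w sw => //= b w ->; rewrite add0r.
rewrite !big_nat; apply: ler_sum => l /andP[l0 lm].
have -> : m.+1 = (l + (m.+1 - l))%N by rewrite subnKC.
rewrite sum_words_cat big_seq [leRHS]big_seq; apply: ler_sum => u.
rewrite mem_words => /eqP su.
under eq_bigr => v _ do rewrite take_size_cat// drop_size_cat//.
by rewrite -mulr_sumr ler_piMr.
Qed.

Lemma renewal__fuel f w : (size w <= f)%N -> renewal_ f w = renewal w.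
Proof.
rewrite /renewal => H; move: {-1}(size w) (leqnn (size w)) => g.
elim: f g w H => [|f IH] [|g] [|b w] //=; rewrite ?renewal__nil ?big_nil//= => wf wg.
congr (_ + _); apply: eq_big_nat => l /andP[l0 lw]; congr (_ * _).
by apply: IH; rewrite size_drop /=; lia.
Qed.

Lemma renewal_nil : renewal [::] = 1. Proof. exact: renewal__nil. Qed.

Lemma renewal_mass m : \sum_(w <- words m) renewal w <= 1.
Proof.
apply: le_trans (renewal__mass m m); rewrite big_seq [leRHS]big_seq.
by apply: ler_sum => w; rewrite mem_words => /eqP sw; rewrite -(@renewal__fuel m) ?sw.
Qed.

(** Cutting [u] off first is one of the ways to cut [u ++ v]. Iterated, this
    bounds the code length of a word by the cost of any way of cutting it. *)
Lemma renewal_cat u v : (0 < size u)%N ->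
  kappa u * renewal v <= renewal (u ++ v).
Proof.
move=> u0; rewrite -(@renewal__fuel (size (u ++ v)).-1 v); last first.
  by rewrite size_cat; lia.
rewrite /renewal; have sz : size (u ++ v) = ((size (u ++ v)).-1).+1 by rewrite size_cat; lia.
rewrite {2}sz /= (bigD1_seq (size u)) ?iota_uniq//=; last first.
  by rewrite mem_index_iota size_cat u0 ltnS leq_addr.
rewrite take_size_cat// drop_size_cat// addrCA lerDl addr_ge0//.
by apply: sumr_ge0 => l _; rewrite mulr_ge0// renewal__ge0.
Qed.

End renewal.

(** * Base-2 logarithm and the cost of a radius *)
Section log2_lemmas.
Variable R : realType.
Implicit Types x y : R.

Lemma ln2_gt0 : 0 < ln 2 :> R. Proof. by rewrite ln_gt0// ltr1n. Qed.

Lemma log2_1 : log2 (1 : R) = 0. Proof. by rewrite /log2 ln1 mul0r. Qed.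

Lemma log2M x y : 0 < x -> 0 < y -> log2 (x * y) = log2 x + log2 y.
Proof. by move=> x0 y0; rewrite /log2 lnM ?posrE// mulrDl. Qed.

Lemma log2V x : 0 < x -> log2 x^-1 = - log2 x.
Proof. by move=> x0; rewrite /log2 lnV ?posrE// mulNr. Qed.

Lemma log2X n x : 0 < x -> log2 (x ^+ n) = n%:R * log2 x.
Proof. by move=> x0; rewrite /log2 lnXn// -[ln x *+ n]mulr_natl mulrA. Qed.

Lemma log2_powR x : log2 (2 `^ x) = x.
Proof. by rewrite /log2 ln_powR mulfK// gt_eqF// ln2_gt0. Qed.

Lemma log2_2X n : log2 (2 ^+ n : R) = n%:R.
Proof. by rewrite -powR_mulrn// log2_powR. Qed.

Lemma le_log2 x y : 0 < x -> x <= y -> log2 x <= log2 y.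
Proof.
move=> x0 xy; rewrite ler_pM2r ?invr_gt0 ?ln2_gt0// ler_ln ?posrE//.
exact: lt_le_trans xy.
Qed.

Lemma log2_ge0 x : 1 <= x -> 0 <= log2 x.
Proof. by move=> x1; rewrite -log2_1 le_log2. Qed.

Lemma log2_le0 x : x <= 1 -> log2 x <= 0.
Proof. by move=> x1; rewrite pmulr_lle0 ?invr_gt0 ?ln2_gt0// ln_le0. Qed.

Lemma log2N_ge0 x : x <= 1 -> 0 <= - log2 x.
Proof. by move=> x1; rewrite oppr_ge0 log2_le0. Qed.

Lemma ln2_ge : 1 / 2 <= ln 2 :> R.
Proof.
have := @le_ln1Dx R (- (1 / 2)) ltac:(lra).
have -> : 1 - 1 / 2 = 2^-1 :> R by lra.
by rewrite lnV ?posrE//; lra.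
Qed.

Lemma log2_le x : -1 < x -> log2 (1 + x) <= x / ln 2.
Proof. by move=> x1; rewrite ler_pM2r ?invr_gt0 ?ln2_gt0// le_ln1Dx. Qed.

End log2_lemmas.

(** This is [alpha * delta_ alpha j]. *)
Definition radius_cost (R : realType) (j : nat) : R :=
  (10 + 3 * log2 j%:R) / j%:R.

Section radius_cost.
Variable R : realType.
Local Notation e := (@radius_cost R).

Lemma log2_nat_ge0 (j : nat) : 0 <= log2 (j%:R : R).
Proof.
case: j => [|j]; last by rewrite log2_ge0// ler1n.
by rewrite /log2 ln0// mul0r.
Qed.

Lemma radius_cost_ge0 j : 0 <= e j.
Proof. by rewrite divr_ge0// addr_ge0// mulr_ge0// log2_nat_ge0. Qed.

Lemma radius_cost_gt0 j : (0 < j)%N -> 0 < e j.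
Proof.
move=> j0; rewrite divr_gt0 ?ltr0n//.
by have := log2_nat_ge0 j; lra.
Qed.

(** [log (j + 1) - log j <= 1 / (j ln 2) <= 2 / j], so that the numerator
    grows by less than the fraction [10 / j] that the denominator removes. *)
Lemma radius_costS j : (0 < j)%N -> e j.+1 <= e j.
Proof.
move=> j0; have jR : 0 < j%:R :> R by rewrite ltr0n.
rewrite /radius_cost ler_pdivrMr ?ltr0n// mulrAC ler_pdivlMr//.
have -> : j.+1%:R = j%:R * (1 + j%:R^-1) :> R.
  by rewrite mulrDr mulr1 divff ?gt_eqF// -natr1.
rewrite log2M//.
set l := log2 j%:R; have l0 : 0 <= l by exact: log2_nat_ge0.
have : log2 (1 + (j%:R : R)^-1) <= 2 / j%:R.
  have ji : 0 < (j%:R : R)^-1 by rewrite invr_gt0.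
  apply: le_trans (log2_le _) _; first by lra.
  rewrite mulrC ler_pM2r// -[leRHS]invrK lef_pV2 ?posrE ?ln2_gt0//.
  by have := @ln2_ge R; lra.
set u := log2 (1 + _); rewrite ler_pdivlMr// => hu.
have -> : j%:R * (1 + (j%:R : R)^-1) = j%:R + 1.
  by rewrite mulrDr mulr1 divff ?gt_eqF.
nra.
Qed.

Lemma radius_cost_le i j : (0 < i)%N -> (i <= j)%N -> e j <= e i.
Proof.
move=> i0; elim: j => [|j IH]; first by rewrite leqn0 => /eqP->.
rewrite leq_eqVlt => /predU1P[->//|ij].
by apply: le_trans (IH _) => //; apply: radius_costS; lia.
Qed.

Lemma radius_costM j : (0 < j)%N -> j%:R * e j = 10 + 3 * log2 j%:R.
Proof. by move=> j0; rewrite mulrC divfK// pnatr_eq0; lia. Qed.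

(** With [L = 2^n], a centre of radius at most [2 L + 1] pays both the entropy
    [1 / L] of one symbol and the radius cost of a piece of length [4 L] or
    more. This is where the sizes of the constants 10 and 3 matter: with
    [log (2 L + 1) >= n + 1], it reduces to
    [(20 + 3 n) (2 + 1 / L) <= 4 (13 + 3 n)]. *)
Lemma radius_cost_short n : (0 < n)%N ->
  (2 ^+ n)^-1 + e (4 * 2 ^ n)%N <= e ((2 * 2 ^ n).+1).
Proof.
move=> n0; rewrite /radius_cost.
set L := (2 ^+ n : R); have L2 : 2 <= L.
  by rewrite /L -[leLHS]expr1 ler_weXn2l// ler1n.
have LE : ((2 ^ n)%N%:R : R) = L by rewrite natrX.
have -> : ((4 * 2 ^ n)%N%:R : R) = 4 * L by rewrite natrM LE.
have -> : ((2 * 2 ^ n).+1%:R : R) = 2 * L + 1 by rewrite -natr1 natrM LE.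
have -> : log2 (4 * L) = n%:R + 2.
  have -> : 4 * L = 2 ^+ (n.+2) by rewrite !exprS /L; ring.
  by rewrite log2_2X -addn2 natrD.
have h : n%:R + 1 <= log2 (2 * L + 1).
  have -> : n%:R + 1 = log2 (2 ^+ n.+1) :> R by rewrite log2_2X -natr1.
  by rewrite le_log2 ?exprn_gt0// exprS -/L; lra.
have nR : 0 <= n%:R :> R by [].
apply: (@le_trans _ _ ((13 + 3 * n%:R) / (2 * L + 1))); last first.
  by rewrite ler_pM2r ?invr_gt0; lra.
rewrite ler_pdivlMr; last by lra.
have -> : (L^-1 + (10 + 3 * (n%:R + 2)) / (4 * L)) * (2 * L + 1) =
  ((20 + 3 * n%:R) / 4) * (2 + L^-1) by field; lra.
have : L^-1 <= 2^-1 by rewrite lef_pV2 ?posrE; lra.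
have : 0 < L^-1 by rewrite invr_gt0; lra.
nra.
Qed.

End radius_cost.

(** * Words of concatenations of blocks *)
Definition stretch (x : nat -> bool) (s l : nat) : seq bool :=
  mkseq (fun i => x (s + i)%N) l.

(** The symbol at position [i] of the concatenation, from position [0] on, of
    the words made of [L - 1] symbols [y k] followed by the opposite symbol. *)
Definition block_symbol (L : nat) (y : nat -> bool) (i : nat) : bool :=
  y (i %/ L)%N (+) (i %% L == L.-1)%N.

Definition block_word (L a : nat) (y : seq bool) (l : nat) : seq bool :=
  mkseq (fun i => block_symbol L (nth false y) (i + a)) l.

(** The part of [x] on [[s, t)] is a word of the language of [X_ n]; [a] is the
    phase of the blocks with respect to the coordinate [0]. *)
Definition in_lang (n : nat) (x : nat -> bool) (s t : nat) : Prop :=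
  exists2 a : nat, (a < 2 ^ n)%N & exists y : nat -> bool,
    forall i, (s <= i < t)%N -> x i = block_symbol (2 ^ n) y (i + a).

Lemma in_lang_sub n x s t s' t' : (s <= s')%N -> (t' <= t)%N ->
  in_lang n x s t -> in_lang n x s' t'.
Proof.
move=> ss tt [a aL [y xy]]; exists a => //; exists y => i /andP[i1 i2].
by apply: xy; lia.
Qed.

Lemma divn_modn_shift L q r : (r < L)%N ->
  ((q * L + r) %/ L = q /\ (q * L + r) %% L = r)%N.
Proof.
move=> rL; have L0 : (0 < L)%N by lia.
by rewrite divnMDl// divn_small// addn0 modnMDl modn_small.
Qed.

(** Besides the complete blocks there is at most one partial block at each end,
    whence [l %/ 2 ^ n + 2] bits. *)
Lemma stretch_block_word n x s l : in_lang n x s (s + l)%N -> (2 ^ n <= l)%N ->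
  exists2 a, (a < 2 ^ n)%N &
  exists2 y, y \in words (l %/ 2 ^ n + 2) & stretch x s l = block_word (2 ^ n) a y l.
Proof.
move=> [a aL [y xy]] Ll; set L := (2 ^ n)%N in aL xy Ll *.
have L0 : (0 < L)%N by rewrite expn_gt0.
exists ((s + a) %% L)%N; first by rewrite ltn_mod.
exists (mkseq (fun k => y ((s + a) %/ L + k)%N) (l %/ L + 2)).
  by rewrite mem_words size_mkseq.
apply/eq_in_map => i; rewrite mem_iota add0n => /andP[_ il].
rewrite xy; last by lia.
have E : (s + i + a = (s + a) %/ L * L + (i + (s + a) %% L))%N.
  by have := divn_eq (s + a) L; lia.
rewrite /block_symbol E divnMDl// modnMDl nth_mkseq//.
have : (i + (s + a) %% L < (l %/ L + 2) * L)%N.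
  by have := divn_eq l L; have := ltn_pmod l L0; have := ltn_pmod (s + a) L0; lia.
by rewrite -ltn_divLR.
Qed.

(** A stretch shorter than a block meets at most one block boundary, so it
    also occurs among the concatenations of blocks of length [l + 1]: the level
    [n] of a short stretch need not be recorded. *)
Lemma stretch_block_word_short n x s l : in_lang n x s (s + l)%N ->
  (0 < l < 2 ^ n)%N ->
  exists2 a, (a < l.+1)%N &
  exists2 y, y \in words (l %/ l.+1 + 2) & stretch x s l = block_word l.+1 a y l.
Proof.
move=> [a aL [y xy]] /andP[l0 lL]; set L := (2 ^ n)%N in aL xy lL *.
have L0 : (0 < L)%N by rewrite expn_gt0.
set q := ((s + a) %/ L)%N; set r := ((s + a) %% L)%N.
have rL : (r < L)%N by rewrite ltn_mod.
pose t := minn (L - r) l.+1.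
have t0 : (0 < t)%N by rewrite /t; lia.
have tl : (t <= l.+1)%N by rewrite /t; lia.
exists (l.+1 - t)%N; first by lia.
exists [:: y q; y q.+1]; first by rewrite mem_words divn_small.
apply/eq_in_map => i; rewrite mem_iota add0n => /andP[_ il].
rewrite xy; last by lia.
have E : (s + i + a = q * L + (i + r))%N by have := divn_eq (s + a) L; rewrite -/q -/r; lia.
rewrite /block_symbol E.
have [it|ti] := ltnP i t.
- have [-> ->] := @divn_modn_shift L q (i + r)%N ltac:(move: it; rewrite /t; lia).
  rewrite divn_small; last by lia.
  rewrite modn_small; last by lia.
  by congr (_ (+) _); apply/eqP/eqP; move: it; rewrite /t; lia.
- have tE : t = (L - r)%N by move: ti; rewrite /t; lia.
  have -> : (q * L + (i + r) = q.+1 * L + (i - t))%N by rewrite tE; lia.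
  have [-> ->] := @divn_modn_shift L q.+1 (i - t)%N ltac:(lia).
  have -> : (i + (l.+1 - t) = 1 * l.+1 + (i - t))%N by lia.
  have [-> ->] := @divn_modn_shift l.+1 1%N (i - t)%N ltac:(lia).
  by rewrite /=; congr (_ (+) _); apply/eqP/eqP; lia.
Qed.

(** In a concatenation of blocks of length [L], among [L + 1] consecutive
    symbols two neighbours differ, while a window of length [2 L + 2] in a
    concatenation of blocks of length at least [2 L] contains [L + 1] equal
    consecutive symbols. *)
Lemma in_lang_overlap n n' x s t : (0 < n < n')%N ->
  in_lang n x s t -> in_lang n' x s t -> (t - s <= (2 * 2 ^ n).+1)%N.
Proof.
move=> /andP[n0 nn'] [a aL [y xy]] [a' aL' [y' xy']].
set L := (2 ^ n)%N in aL xy *; set L' := (2 ^ n')%N in aL' xy'.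
have L2 : (2 <= L)%N by rewrite /L -[leqLHS]expn1 leq_exp2l.
have LL' : (2 * L <= L')%N by rewrite /L /L' -expnS leq_exp2l.
rewrite leqNgt; apply/negP => st.
have diff k : (s <= k)%N -> (k + L < t)%N ->
    exists2 j, (k <= j < k + L)%N & x j != x j.+1.
  move=> sk kt.
  pose q := ((k + a) %/ L)%N; pose r := ((k + a) %% L)%N.
  have rL : (r < L)%N by rewrite ltn_mod; lia.
  have E : (k + a = q * L + r)%N by exact: divn_eq.
  pose j := if r == L.-1 then (k + L.-1)%N else (k + (L.-2 - r))%N.
  pose p := if r == L.-1 then q.+1 else q.
  have [Ej kj] : (j + a = p * L + L.-2)%N /\ (k <= j < k + L)%N.
    by rewrite /j /p; case: eqP => [rE|rE]; split; lia.
  exists j => //; rewrite !xy; try lia.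
  have -> : (j.+1 + a = p * L + L.-1)%N by lia.
  rewrite /block_symbol Ej.
  have [-> ->] := @divn_modn_shift L p L.-2 ltac:(lia).
  have [-> ->] := @divn_modn_shift L p L.-1 ltac:(lia).
  rewrite eqxx (_ : (L.-2 == L.-1) = false); last by apply/eqP; lia.
  by case: (y p).
pose q := ((s + a') %/ L')%N; pose r := ((s + a') %% L')%N.
have rL : (r < L')%N by rewrite ltn_mod; lia.
have E : (s + a' = q * L' + r)%N by exact: divn_eq.
have const k p : (s <= k)%N -> (k + L < t)%N -> (p * L' <= k + a')%N ->
    (k + L + a' < p * L' + L'.-1)%N -> False.
  move=> sk kt pk kp; have [j /andP[kj jk]] := diff _ sk kt.
  rewrite !xy'; try lia; rewrite /block_symbol.
  have [u [Eu u1]] : exists u, (j + a' = p * L' + u)%N /\ (u.+1 < L'.-1)%N.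
    by exists (j + a' - p * L')%N; split; lia.
  have -> : (j.+1 + a' = p * L' + u.+1)%N by lia.
  rewrite Eu.
  have [-> ->] := @divn_modn_shift L' p u ltac:(lia).
  have [-> ->] := @divn_modn_shift L' p u.+1 ltac:(lia).
  have -> : (u == L'.-1) = false by apply/eqP; lia.
  have -> : (u.+1 == L'.-1) = false by apply/eqP; lia.
  by rewrite eqxx.
have [h|h] := ltnP (r + L) L'.-1.
- by apply: (const s q); lia.
- by apply: (const (s + (L' - r))%N q.+1); lia.
Qed.

(** * Weights of pieces *)
Section piece_weight.
Variable R : realType.

Definition block_weight (L l : nat) (u : seq bool) : R :=
  \sum_(0 <= a < L) \sum_(y <- words (l %/ L + 2))
    (u == block_word L a y l)%:R * 2 ^- (l %/ L).

(** A piece of length [l] is described by its level, its phase and its bits. The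
    summand for the length [l.+1] takes care of the pieces shorter than a block,
    whose level is unbounded ([stretch_block_word_short]). The factor
    [1 / (64 l^3)] normalizes the [O(l)] descriptions of level and phase and
    leaves a summable [O(l^-2)]. *)
Definition piece_weight (u : seq bool) : R :=
  (64 * (size u)%:R ^+ 3)^-1 *
  (\sum_(0 <= n < (trunc_log 2 (size u)).+1) block_weight (2 ^ n) (size u) u
   + block_weight (size u).+1 (size u) u).

Lemma block_weight_ge0 L l u : 0 <= block_weight L l u.
Proof. by do 2!(apply: sumr_ge0 => ? _); rewrite mulr_ge0. Qed.

Lemma piece_weight_ge0 u : 0 <= piece_weight u.
Proof.
rewrite mulr_ge0 ?invr_ge0 ?addr_ge0 ?block_weight_ge0//.
by apply: sumr_ge0 => n _; exact: block_weight_ge0.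
Qed.

Lemma block_weight_mass L l :
  \sum_(u <- words l) block_weight L l u = 4 * L%:R.
Proof.
rewrite exchange_big /=.
under eq_bigr => a _.
  rewrite exchange_big /=.
  under eq_bigr => y _ do rewrite -mulr_suml sum_words_delta ?size_mkseq// mul1r.
  rewrite big_const_seq count_predT size_words iter_addr_0.
  have -> : (2 ^- (l %/ L) *+ 2 ^ (l %/ L + 2) = 4 :> R).
    rewrite -[LHS]mulr_natl natrX exprD.
    have : 2 ^+ (l %/ L) != 0 :> R by rewrite expf_neq0// pnatr_eq0.
    by set p := 2 ^+ (l %/ L) => p0; field.
  over.
by rewrite big_const_nat iter_addr_0 subn0 [RHS]mulr_natr.
Qed.

(** The [2 ^ (l %/ L + 2)] words [y] contribute 4 for each of the [L] phases, and
    the powers [L = 2^n <= l] sum to less than [2 l]. *)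
Lemma piece_weight_mass_length l : (0 < l)%N ->
  \sum_(u <- words l) piece_weight u <= (4 * l%:R ^+ 2)^-1.
Proof.
move=> l0; have lR : 1 <= l%:R :> R by rewrite ler1n.
rewrite big_seq (eq_bigr (fun u => (64 * l%:R ^+ 3)^-1 *
  (\sum_(0 <= n < (trunc_log 2 l).+1) block_weight (2 ^ n) l u
   + block_weight l.+1 l u))); last first.
  by move=> u; rewrite mem_words /piece_weight => /eqP ->.
rewrite -big_seq -mulr_sumr big_split /= block_weight_mass exchange_big /=.
under eq_bigr => n _ do rewrite block_weight_mass.
rewrite -mulr_sumr -natr_sum.
have pow k : (\sum_(0 <= n < k) 2 ^ n).+1 = (2 ^ k)%N.
  elim: k => [|k IH]; first by rewrite big_nil.
  by rewrite big_nat_recr//= -addSn IH expnS; lia.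
have h : ((\sum_(0 <= n < (trunc_log 2 l).+1) 2 ^ n)%N%:R : R) <= 2 * l%:R.
  rewrite -natrM ler_nat; have := pow (trunc_log 2 l).+1; rewrite expnS.
  by have := trunc_logP (isT : (1 < 2)%N) l0; lia.
rewrite ler_pdivrMl; last by rewrite mulr_gt0// exprn_gt0//; lra.
have -> : 64 * l%:R ^+ 3 * (4 * l%:R ^+ 2)^-1 = 16 * l%:R :> R by field; lra.
rewrite -[l.+1%:R]natr1; move: h.
by set S := (\sum_(_ <= _ < _) _)%N%:R; lra.
Qed.

(** [1 / l^2] is compared with the telescoping [1 / (l (l + 1))]. *)
Lemma piece_weight_mass M :
  \sum_(1 <= l < M.+1) \sum_(u <- words l) piece_weight u <= 1.
Proof.
suff : \sum_(1 <= l < M.+1) \sum_(u <- words l) piece_weight u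
       <= 2^-1 * (1 - M.+1%:R^-1).
  move=> h; apply: le_trans h _.
  have : 0 <= M.+1%:R^-1 :> R by rewrite invr_ge0.
  by set v := _^-1; lra.
elim: M => [|M IH]; first by rewrite big_nil invr1 subrr mulr0.
rewrite big_nat_recr//; apply: le_trans (lerD IH (piece_weight_mass_length (ltn0Sn M))) _.
rewrite -[M.+2%:R]natr1; set l : R := M.+1%:R.
have l1 : 1 <= l by rewrite ler1n.
have -> : 2^-1 * (1 - (l + 1)^-1) = 2^-1 * (1 - l^-1) + (2 * (l * (l + 1)))^-1.
  by field; lra.
by rewrite lerD2l lef_pV2 ?posrE; nra.
Qed.

Lemma block_weight_ge L a y l : (a < L)%N -> y \in words (l %/ L + 2) ->
  2 ^- (l %/ L) <= block_weight L l (block_word L a y l).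
Proof.
move=> aL yw; rewrite /block_weight (bigD1_seq a) ?iota_uniq ?mem_index_iota//=.
rewrite (bigD1_seq y) ?words_uniq//= eqxx mul1r -addrA lerDl addr_ge0//.
  by apply: sumr_ge0 => ? _; rewrite mulr_ge0.
by do 2!(apply: sumr_ge0 => ? _); rewrite mulr_ge0.
Qed.

(** The factor [2 ^- (l %/ 2 ^ n)] gives the entropy of the piece, and the
    normalization by [64 l^3] gives the logarithmic overhead. *)
Lemma piece_weight_stretch n x s l : (0 < n)%N -> (0 < l)%N ->
  in_lang n x s (s + l)%N ->
  0 < piece_weight (stretch x s l) /\
  - log2 (piece_weight (stretch x s l)) <=
    l%:R / 2 ^+ n + (6 + 3 * log2 l%:R).
Proof.
move=> n0 l0 xl; have lR : 1 <= l%:R :> R by rewrite ler1n.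
have c0 : 0 < (64 * l%:R ^+ 3)^-1 :> R.
  by rewrite invr_gt0 mulr_gt0// exprn_gt0//; lra.
have [k kl kw] : exists2 k : nat, k%:R <= l%:R / 2 ^+ n :> R &
    (64 * l%:R ^+ 3)^-1 * 2 ^- k <= piece_weight (stretch x s l).
  have sz : size (stretch x s l) = l by rewrite size_mkseq.
  have [Ll|lL] := leqP (2 ^ n) l.
  - have [a aL [y yw ->]] := stretch_block_word xl Ll.
    exists (l %/ 2 ^ n)%N.
      rewrite ler_pdivlMr ?exprn_gt0// -natrX -natrM ler_nat.
      exact: leq_trunc_div.
    rewrite /piece_weight size_mkseq ler_wpM2l ?(ltW c0)//.
    apply: le_trans (block_weight_ge aL yw) _.
    rewrite (bigD1_seq n) ?iota_uniq ?mem_index_iota//=; last first.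
      by rewrite ltnS trunc_log_max.
    rewrite -addrA lerDl addr_ge0 ?block_weight_ge0//.
    by apply: sumr_ge0 => ? _; rewrite block_weight_ge0.
  - have [|a aL [y yw ->]] := stretch_block_word_short xl; first by rewrite l0.
    exists 0%N; first by rewrite divr_ge0// exprn_ge0.
    rewrite /piece_weight size_mkseq ler_wpM2l ?(ltW c0)//.
    have := block_weight_ge aL yw; rewrite divn_small// => h; apply: le_trans h _.
    by rewrite lerDr sumr_ge0// => ? _; rewrite block_weight_ge0.
have k0 : 0 < (64 * l%:R ^+ 3)^-1 * 2 ^- k :> R by rewrite mulr_gt0// invr_gt0 exprn_gt0.
split; first exact: lt_le_trans kw.
apply: (@le_trans _ _ (- log2 ((64 * l%:R ^+ 3)^-1 * 2 ^- k))).
  by rewrite lerN2 le_log2.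
have l3 : 0 < l%:R ^+ 3 :> R by rewrite exprn_gt0//; lra.
have E : log2 (2 ^- k) = - k%:R :> R by rewrite log2V ?log2_2X// exprn_gt0.
have c1 : 0 < 64 * l%:R ^+ 3 :> R by rewrite mulr_gt0 ?ltr0n.
have p1 : 0 < 2 ^- k :> R by rewrite invr_gt0 exprn_gt0.
rewrite log2M// E log2V//.
rewrite log2M ?ltr0n// log2X; last by lra.
have -> : log2 64 = 6 :> R.
  have -> : 64 = 2 ^+ 6 :> R by rewrite !exprS expr0; lra.
  by rewrite log2_2X.
by lra.
Qed.

End piece_weight.

(** * The greedy cover *)
Section greedy.
Variables (R : realType) (x : nat -> bool) (m : nat).
Variables (G : nat -> R) (lev rad : nat -> nat).
Local Notation e := (@radius_cost R).
Hypothesis lev_gt0 : forall i, (i < m)%N -> (0 < lev i)%N.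
Hypothesis rad_gt0 : forall i, (i < m)%N -> (0 < rad i)%N.
Hypothesis lev_lang : forall i, (i < m)%N ->
  in_lang (lev i) x (i.+1 - rad i) (i + rad i).
Hypothesis G_ge : forall i, (i < m)%N ->
  (2 ^+ lev i)^-1 + (if (rad i <= m)%N then e (rad i) else 0) <= G i.

Lemma G_ge_level i : (i < m)%N -> (2 ^+ lev i)^-1 <= G i.
Proof.
move=> im; apply: le_trans (G_ge im); rewrite lerDl.
by case: ifP => // _; exact: radius_cost_ge0.
Qed.

Lemma G_ge_radius i k : (i < m)%N -> (rad i <= k)%N -> (k <= m)%N -> e k <= G i.
Proof.
move=> im ik km; apply: le_trans (G_ge im).
have rm : (rad i <= m)%N by lia.
rewrite rm -[leLHS]add0r lerD ?invr_ge0 ?exprn_ge0//.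
by rewrite radius_cost_le// rad_gt0.
Qed.

Lemma G_ge_both i k : (i < m)%N -> (rad i <= k)%N -> (k <= m)%N ->
  (2 ^+ lev i)^-1 + e k <= G i.
Proof.
move=> im ik km; apply: le_trans (G_ge im).
have rm : (rad i <= m)%N by lia.
by rewrite rm lerD2l radius_cost_le// rad_gt0.
Qed.

Lemma G_ge0 i : (i < m)%N -> 0 <= G i.
Proof. by move=> /G_ge_level; apply: le_trans; rewrite invr_ge0 exprn_ge0. Qed.

Lemma invr_exp2_le a b : (a <= b)%N -> (2 ^+ b)^-1 <= (2 ^+ a)^-1 :> R.
Proof. by move=> ab; rewrite lef_pV2 ?posrE ?exprn_gt0// ler_weXn2l// ler1n. Qed.

Lemma sum_ge_const (a b : nat) (c : R) : (b <= m)%N ->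
  (forall i, (a <= i < b)%N -> c <= G i) ->
  (b - a)%:R * c <= \sum_(a <= i < b) G i.
Proof.
move=> bm h; rewrite mulr_natl -sumr_const_nat !big_nat.
by apply: ler_sum.
Qed.

(** The last hypothesis expresses the greedy choice: an interval that covers [s]
    does not reach beyond [t]. It makes every radius in the piece at most the
    length [l] of the piece, so that the radius costs pay for [10 + 3 log l]. For
    [l <= 4 * 2^n] the entropy of the piece is at most 4 and is paid as well.
    For longer pieces, a centre of level at most [n] pays for its entropy; a
    centre of larger level has half of its interval inside the piece, and the
    overlap of the two levels bounds its radius by [2 * 2^n + 1]. *)
Lemma piece_budget s t n : (0 < n)%N -> (s < t <= m)%N -> in_lang n x s t ->
  (forall i, (s <= i < t)%N -> (s < i.+1 - rad i)%N || (i + rad i <= t)%N) ->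
  (t - s)%:R / 2 ^+ n + (6 + 3 * log2 (t - s)%:R) <= \sum_(s <= i < t) G i.
Proof.
move=> n0 /andP[st tm] nst hr; set l := (t - s)%N.
have l0 : (0 < l)%N by rewrite /l; lia.
have lm : (l <= m)%N by rewrite /l; lia.
have rl i : (s <= i < t)%N -> (rad i <= l)%N by move=> /[dup] /hr; rewrite /l; lia.
have L0 : 0 < 2 ^+ n :> R by rewrite exprn_gt0.
have lR : 0 <= l%:R :> R by [].
have [short|long] := leqP l (4 * 2 ^ n).
- apply: le_trans (sum_ge_const (c := e l) tm _); last first.
    by move=> i ist; apply: G_ge_radius; [lia|exact: rl|].
  rewrite -/l radius_costM//.
  suff : l%:R / 2 ^+ n <= 4 :> R by lra.
  by rewrite ler_pdivrMr// -natrX -natrM ler_nat.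
- apply: le_trans (sum_ge_const (c := (2 ^+ n)^-1 + e l) tm _); last first.
    move=> i ist; have im : (i < m)%N by lia.
    have [li|nl] := leqP (lev i) n.
      apply: le_trans (G_ge_both im (rl _ ist) lm).
      by rewrite lerD2r invr_exp2_le.
    have rs : (rad i <= (2 * 2 ^ n).+1)%N.
      have [h|h] := orP (hr _ ist).
      + have -> : rad i = (i.+1 - (i.+1 - rad i))%N by lia.
        apply: (@in_lang_overlap n (lev i) x); first by rewrite n0.
          by apply: in_lang_sub nst; lia.
        by apply: in_lang_sub (lev_lang im); have := rad_gt0 im; lia.
      + have -> : rad i = (i + rad i - i)%N by lia.
        apply: (@in_lang_overlap n (lev i) x); first by rewrite n0.
          by apply: in_lang_sub nst; lia.
        by apply: in_lang_sub (lev_lang im); have := rad_gt0 im; lia.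
    apply: le_trans (G_ge_radius im rs _); last first.
      have : (0 < 2 ^ n)%N by rewrite expn_gt0.
      by lia.
    apply: le_trans (radius_cost_short R n0); rewrite lerD2l radius_cost_le//.
      by rewrite muln_gt0 expn_gt0.
    exact: ltnW.
  rewrite -/l mulrDr radius_costM//; lra.
Qed.

(** The last piece is truncated by the end of the window, so that its radii
    are not controlled; it only pays for its entropy, up to a constant. *)
Lemma last_piece_budget s n : (0 < n)%N -> (s < m)%N -> in_lang n x s m ->
  (m - s)%:R / 2 ^+ n <= \sum_(s <= i < m) G i + 3.
Proof.
move=> n0 sm nsm; set l := (m - s)%N.
have L0 : 0 < 2 ^+ n :> R by rewrite exprn_gt0.
have L2 : 2 <= 2 ^+ n :> R by rewrite -[leLHS]expr1 ler_weXn2l// ler1n.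
have LE : ((2 ^ n)%N%:R : R) = 2 ^+ n by rewrite natrX.
have [short|long] := leqP l (2 * 2 ^ n).+1.
- apply: (@le_trans _ _ 3); last first.
    by rewrite lerDr big_nat sumr_ge0// => i /andP[_ im]; exact: G_ge0.
  rewrite ler_pdivrMr//; apply: (@le_trans _ _ (2 * 2 ^+ n + 1)); last by lra.
  by rewrite -LE -natrM natr1 ler_nat.
- rewrite -[leLHS]addr0 lerD//; apply: sum_ge_const => // i /andP[si im].
  have [li|nl] := leqP (lev i) n.
    by apply: le_trans (G_ge_level im); exact: invr_exp2_le.
  have rs : (rad i <= (2 * 2 ^ n).+1)%N.
    have ov a b : (s <= a)%N -> (b <= m)%N -> (i.+1 - rad i <= a)%N ->
        (b <= i + rad i)%N -> (b - a <= (2 * 2 ^ n).+1)%N.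
      move=> sa bm ia bi; apply: (@in_lang_overlap n (lev i) x).
      - by rewrite n0.
      - by apply: in_lang_sub nsm.
      - by apply: in_lang_sub (lev_lang im).
    have r0 := rad_gt0 im.
    have [h1|h1] := ltnP s (i.+1 - rad i).
      have -> : rad i = (i.+1 - (i.+1 - rad i))%N by lia.
      by apply: ov; lia.
    have [h2|h2] := leqP (i + rad i) m.
      have -> : rad i = (i + rad i - i)%N by lia.
      by apply: ov; lia.
    by have := ov s m; lia.
  apply: le_trans (G_ge_radius im rs _); last by rewrite /l in long; lia.
  apply: le_trans (radius_cost_short R n0).
  by rewrite lerDl radius_cost_ge0.
Qed.

Local Notation code := (renewal (@piece_weight R)).

Lemma stretch_split s t : (s <= t <= m)%N ->
  stretch x s (m - s) = stretch x s (t - s) ++ stretch x t (m - t).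
Proof.
move=> /andP[st tm]; have -> : (m - s = (t - s) + (m - t))%N by lia.
rewrite /stretch /mkseq iotaD map_cat; congr (_ ++ _).
rewrite add0n -[in LHS](addn0 (t - s)%N) iotaDl -map_comp.
by apply: eq_map => i /=; congr x; lia.
Qed.

(** Cut the window from left to right: at [s], among the centres [i] whose
    interval of radius [rad i] covers [s], the one of farthest reach gives the
    next piece. *)
Lemma greedy_code s : (s <= m)%N ->
  0 < code (stretch x s (m - s)) /\
  - log2 (code (stretch x s (m - s))) <=
    \sum_(s <= i < m) G i + (9 + 3 * log2 m%:R).
Proof.
have [k] := ubnP (m - s); elim: k s => // k IH s sk sm.
have kge0 := @piece_weight_ge0 R.
have [ms|{}sm] := leqP m s.
  have -> : (m - s = 0)%N by lia.
  rewrite renewal_nil log2_1 oppr0 big_geq//; split => //.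
  by have := @log2_nat_ge0 R m; lra.
pose P T := [exists i : 'I_m, [&& (i.+1 - rad i <= s)%N, (s < i + rad i)%N &
  T == (i + rad i)%N]].
have exP : exists T, P T.
  exists (s + rad s)%N; apply/existsP; exists (Ordinal sm); rewrite /= eqxx andbT.
  by have := rad_gt0 sm; lia.
have ubP T : P T -> (T <= \max_(i < m) (i + rad i))%N.
  by move=> /existsP[i /and3P[_ _ /eqP ->]]; exact: leq_bigmax.
have [T /existsP[i0 /and3P[i0s si0 /eqP TE]] Tmax] := ex_maxnP exP ubP.
have im := ltn_ord i0; have n0 := lev_gt0 im.
have nsT : in_lang (lev i0) x s T.
  by apply: in_lang_sub (lev_lang im); rewrite ?TE.
(* [T] is the farthest reach of an interval that covers [s]. *)
have [Tm|mT] := ltnP T m.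
- have sT : (s < T)%N by rewrite TE.
  have l0 : (0 < T - s)%N by lia.
  have [c0 cle] := IH T ltac:(lia) (ltnW Tm).
  have nsT' : in_lang (lev i0) x s (s + (T - s))%N by rewrite subnKC// ltnW.
  have [w0 wle] := piece_weight_stretch R n0 l0 nsT'.
  have rc := renewal_cat kge0 (u := stretch x s (T - s)) (stretch x T (m - T))
    ltac:(by rewrite size_mkseq).
  rewrite -stretch_split in rc; last by rewrite (ltnW sT) (ltnW Tm).
  have p0 : 0 < piece_weight R (stretch x s (T - s)) * code (stretch x T (m - T)).
    by rewrite mulr_gt0.
  split; first exact: lt_le_trans rc.
  apply: (@le_trans _ _ (- log2 (piece_weight R (stretch x s (T - s)) *
    code (stretch x T (m - T))))).
    by rewrite lerN2 le_log2.
  rewrite log2M// opprD (big_cat_nat (n := T)) ?(ltnW sT) ?(ltnW Tm)//= -addrA.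
  apply: lerD => //; apply: le_trans wle _; apply: piece_budget => //.
    by rewrite sT ltnW.
  move=> i /andP[si iT]; have im' : (i < m)%N by lia.
  have [//|h /=] := ltnP s (i.+1 - rad i).
  apply: Tmax; apply/existsP; exists (Ordinal im') => /=.
  by rewrite h eqxx andbT /=; have := rad_gt0 im'; lia.
- have nsm : in_lang (lev i0) x s (s + (m - s))%N.
    by rewrite subnKC; [apply: in_lang_sub nsT|exact: ltnW].
  have l0 : (0 < m - s)%N by lia.
  have [w0 wle] := piece_weight_stretch R n0 l0 nsm.
  have rc := renewal_cat kge0 (u := stretch x s (m - s)) [::]
    ltac:(by rewrite size_mkseq).
  rewrite renewal_nil mulr1 cats0 in rc.
  split; first exact: lt_le_trans rc.
  apply: le_trans (_ : - log2 (piece_weight R (stretch x s (m - s))) <= _).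
    by rewrite lerN2 le_log2.
  apply: le_trans wle _.
  have nsm' : in_lang (lev i0) x s m by apply: in_lang_sub nsT.
  have := last_piece_budget n0 sm nsm'.
  have : log2 (m - s)%:R <= log2 m%:R :> R.
    by rewrite le_log2 ?ltr0n ?ler_nat//; lia.
  by lra.
Qed.

End greedy.

(** * Cylinders of the full shift *)
Lemma measurable_preimage_count d (Y : measurableType d) (T : countType)
    (g : Y -> T) : (forall t, measurable (g @^-1` [set t])) ->
  forall S : set T, measurable (g @^-1` S).
Proof.
move=> mg S.
have -> : g @^-1` S = \bigcup_n
    (if unpickle n is Some t then
       if `[< S t >] then g @^-1` [set t] else set0 else set0).
  apply/seteqP; split => [y Sy|y [n _]].
    by exists (pickle (g y)) => //=; rewrite pickleK asboolT.
  by case: (unpickle n) => // t; case: asboolP => // St /= ->.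
apply: bigcupT_measurable => n; case: (unpickle n) => [t|]; last exact: measurable0.
by case: ifP => _; [exact: mg|exact: measurable0].
Qed.

Section cylinders.
Variable R : realType.
Local Notation X := (full_shift R).
Implicit Types x y : X.

Definition window (a : int) (m : nat) (x : X) : seq bool :=
  mkseq (fun i => x (a + i%:Z)) m.

Definition central (K : nat) : X -> seq bool := window (- K%:Z) (2 * K).+1.

Lemma central_eqP K x y :
  central K x = central K y <-> (forall i : int, (`|i| <= K)%N -> x i = y i).
Proof.
split => [xy i iK|xy]; last first.
  apply/eq_in_map => i; rewrite mem_iota => /andP[_ iK]; apply: xy; lia.
pose j := absz (i + K%:Z); have -> : i = - K%:Z + j%:Z by rewrite /j; lia.
have := congr1 (fun w => nth false w j) xy.
by rewrite !nth_mkseq// /j; lia.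
Qed.

Lemma ball_central K x y : ball x (2 ^- K) y <-> central K x = central K y.
Proof.
rewrite ballEmdist /= central_eqP; split => [xy i iK|xy].
  apply/eqP; apply/negPn/negP => xyi; move: xy; apply/negP; rewrite -leNgt.
  apply: le_trans (le_shift_dist xyi).
  by rewrite lef_pV2 ?posrE ?exprn_gt0// ler_weXn2l// ler1n.
have [->|/eqP nxy] := eqVneq x y.
  by rewrite [mdist _ _]shift_distxx invr_gt0 exprn_gt0.
have [i xyi] := shift_dist_attained nxy; rewrite /mdist /= => ->.
rewrite ltf_pV2 ?posrE ?exprn_gt0// ltr_eXn2l ?ltr1n// ltnNge.
by apply/negP => iK; move: xyi; rewrite xy// eqxx.
Qed.

Lemma open_centralP (A : set X) : open A <->
  forall x, A x -> exists K, forall y, central K x = central K y -> A y.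
Proof.
rewrite openE; split => [oA x /oA|h x Ax].
  rewrite /interior -nbhs_ballE => -[e /= e0 xA].
  have [K Ke] : exists K : nat, 2 ^- K < e.
    exists (Num.bound e^-1); rewrite invf_plt ?posrE ?exprn_gt0//.
    exact: upper_nthrootP.
  exists K => y /ball_central xy; apply: xA; exact: le_ball (ltW Ke) _ xy.
have [K xK] := h x Ax; rewrite /interior -nbhs_ballE.
exists (2 ^- K) => /=; first by rewrite invr_gt0 exprn_gt0.
by move=> y /ball_central; exact: xK.
Qed.

Definition cylinder_sets : set (set X) :=
  [set A | exists K (S : set (seq bool)), A = central K @^-1` S].

Lemma open_cylinder K (S : set (seq bool)) : open (central K @^-1` S).
Proof. by apply/open_centralP => x /= Sx; exists K => y <-. Qed.

Lemma central_widen K K' (S : set (seq bool)) : (K <= K')%N ->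
  exists S', central K @^-1` S = central K' @^-1` S'.
Proof.
move=> KK'; exists [set w | exists2 x, central K' x = w & S (central K x)].
apply/seteqP; split => x /=; first by exists x.
move=> [y xy]; suff -> : central K y = central K x by [].
apply/central_eqP => i iK; move/central_eqP: xy; apply; lia.
Qed.

Lemma measurable_cylinder K (S : set (seq bool)) : measurable (central K @^-1` S).
Proof. by apply: sub_sigma_algebra; exact: open_cylinder. Qed.

Lemma measurable_shiftE : @measurable _ X = <<s cylinder_sets >>.
Proof.
apply/seteqP; split; last first.
  by apply: smallest_sub; [exact: sigma_algebra_measurable|] => _ [K [S ->]];
    exact: measurable_cylinder.
apply: smallest_sub; first exact: smallest_sigma_algebra.
move=> A /open_centralP oA.
have -> : A = \bigcup_K
    (central K @^-1` [set w | forall y, central K y = w -> A y]).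
  apply/seteqP; split => x.
    by move=> /oA[K h]; exists K => // y /esym; exact: h.
  by move=> [K _]; exact.
apply: sigma_algebra_bigcup => K; apply: sub_sigma_algebra.
by exists K; eexists.
Qed.

Lemma cylinder_sets_setI : setI_closed cylinder_sets.
Proof.
move=> _ _ [K [S ->]] [K' [S' ->]].
have [S1 ->] := central_widen S (leq_maxl K K').
have [S2 ->] := central_widen S' (leq_maxr K K').
by exists (maxn K K'), (S1 `&` S2).
Qed.

Lemma measurable_coord (i : int) : measurable [set x : X | x i].
Proof.
apply: sub_sigma_algebra; apply/open_centralP => x /= xi; exists `|i|%N => y.
by move=> /central_eqP <-.
Qed.

Lemma measurable_window d (Y : measurableType d) (f : Y -> X) a m (w : seq bool) :
  (forall i, measurable [set y | f y i]) ->
  measurable [set y | window a m (f y) = w].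
Proof.
move=> mf; have [sw|sw] := eqVneq (size w) m; last first.
  rewrite (_ : [set _ | _] = set0)// -subset0 => y /= h.
  by move: sw; rewrite -h size_mkseq eqxx.
have -> : [set y | window a m (f y) = w] =
    \bigcap_(i in `I_m) [set y | f y (a + i%:Z) = nth false w i].
  apply/seteqP; split => y /=.
    by move=> <- i im; rewrite /= nth_mkseq.
  move=> h; apply: (@eq_from_nth _ false); rewrite size_mkseq// => i im.
  by rewrite nth_mkseq// h.
apply: fin_bigcap_measurable; first exact: finite_II.
move=> i _; case: (nth false w i); first exact: mf.
rewrite (_ : [set _ | _] = ~` [set y | f y (a + i%:Z)]); first exact: measurableC.
by apply/seteqP; split => y /=; case: (f y _).
Qed.

(** The cylinder sets generate the Borel sets, and each of them depends on
    finitely many coordinates. *)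
Lemma measurable_fun_shift d (Y : measurableType d) (f : Y -> X) :
  (forall i, measurable [set y | f y i]) -> measurable_fun setT f.
Proof.
move=> mf; apply: (measurability cylinder_sets); first exact: measurable_shiftE.
move=> _ [_ [K [S ->]] <-]; rewrite setTI.
have mw w : measurable ((fun z => central K (f z)) @^-1` [set w]).
  exact: measurable_window.
exact: (measurable_preimage_count mw S).
Qed.

Lemma measurable_window_fiber a m (S : set (seq bool)) :
  measurable [set x | S (window a m x)].
Proof.
apply: (measurable_preimage_count (g := window a m)) => w.
by apply: (@measurable_window _ X id) => i; exact: measurable_coord.
Qed.

Lemma iter_shiftE i x n : iter i shift_map x n = x (n + i%:Z).
Proof.
elim: i n => [|i IH] n; first by rewrite addr0.
by rewrite iterS /shift_map IH -addrA; congr x; lia.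
Qed.

Lemma measurable_iter_shift i : measurable_fun setT (iter i (@shift_map R)).
Proof.
apply: measurable_fun_shift => j.
under eq_set => y do rewrite iter_shiftE.
exact: measurable_coord.
Qed.

Lemma window_iter a m i x : window a m (iter i shift_map x) = window (a + i%:Z) m x.
Proof.
by apply/eq_in_map => j _; rewrite iter_shiftE; congr x; lia.
Qed.

Lemma window_cat a m n x : window a (m + n) x = window a m x ++ window (a + m%:Z) n x.
Proof.
rewrite /window /mkseq iotaD map_cat; congr (_ ++ _).
rewrite add0n -[in LHS](addn0 m) iotaDl -map_comp.
by apply: eq_map => i /=; congr x; lia.
Qed.

Lemma take_drop_window a m i k x : (i + k <= m)%N ->
  take k (drop i (window a m x)) = window (a + i%:Z) k x.
Proof.
move=> h; have -> : m = (i + (k + (m - i - k)))%N by lia.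
rewrite window_cat drop_size_cat ?size_mkseq//.
by rewrite window_cat take_size_cat ?size_mkseq.
Qed.

Lemma window_surj a m (w : seq bool) : size w = m -> exists x, window a m x = w.
Proof.
move=> sw; exists (fun i => nth false w `|i - a|%N).
apply: (@eq_from_nth _ false); rewrite size_mkseq// => i im.
by rewrite nth_mkseq//; congr nth; lia.
Qed.

End cylinders.

(** * Probabilities of events *)
Section probability_helpers.
Context d (T : measurableType d) (R : realType) (P : probability T R).

Definition pr (A : set T) : R := fine (P A).

Lemma prE A : measurable A -> P A = (pr A)%:E.
Proof.
move=> mA; rewrite /pr fineK// ge0_fin_numE//.
by apply: le_lt_trans (probability_le1 P mA) _; rewrite ltry.
Qed.

Lemma pr_ge0 A : 0 <= pr A. Proof. by rewrite fine_ge0. Qed.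

Lemma pr_le A B : measurable A -> measurable B -> A `<=` B -> pr A <= pr B.
Proof.
by move=> mA mB AB; rewrite -lee_fin -!prE// le_measure ?inE.
Qed.

Lemma pr_setT : pr setT = 1. Proof. by rewrite /pr probability_setT. Qed.

Lemma pr_setU A B : measurable A -> measurable B ->
  pr (A `|` B) <= pr A + pr B.
Proof.
by move=> mA mB; rewrite -lee_fin EFinD -!prE ?measureU2//; exact: measurableU.
Qed.

Lemma pr_bigU (I : Type) (s : seq I) (F : I -> set T) :
  (forall i, measurable (F i)) ->
  pr (\big[setU/set0]_(i <- s) F i) <= \sum_(i <- s) pr (F i).
Proof.
move=> mF; elim: s => [|i s IH]; first by rewrite !big_nil /pr measure0.
rewrite !big_cons; apply: le_trans (pr_setU _ _) _ => //.
  by apply: bigsetU_measurable.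
by rewrite lerD2l.
Qed.

Lemma integral_fibers (V : choiceType) (g : T -> V) (s : seq V) (f : V -> R) :
  uniq s -> (forall x, g x \in s) -> (forall v, measurable (g @^-1` [set v])) ->
  (forall v, 0 <= f v) ->
  (\int[P]_x (f (g x))%:E = (\sum_(v <- s) f v * pr (g @^-1` [set v]))%:E)%E.
Proof.
move=> us gs mg f0.
transitivity (\int[P]_x (\sum_(v <- s)
    ((f v)%:E * (\1_(g @^-1` [set v]) x)%:E)))%E.
  apply: eq_integral => x _; rewrite (bigD1_seq (g x))//= big1 ?adde0.
    by rewrite indicE mem_set// mule1.
  by move=> v /eqP vg; rewrite indicE memNset ?mule0//= => /esym.
rewrite ge0_integral_sum//.
- rewrite -sumEFin; apply: eq_bigr => v _.
  rewrite ge0_integralZl_EFin//.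
  - by rewrite integral_indic// setIT EFinM -prE.
  - by apply/measurable_EFinP; exact: measurable_indic.
- by move=> v; apply/measurable_EFinP; apply: measurable_funM => //;
    exact: measurable_indic.
- by move=> v x _; rewrite -EFinM lee_fin mulr_ge0// indicE.
Qed.

Lemma sum_pr_fibers (V : choiceType) (g : T -> V) (s : seq V) (S : pred V) :
  uniq s -> (forall x, g x \in s) -> (forall v, measurable (g @^-1` [set v])) ->
  \sum_(v <- s | S v) pr (g @^-1` [set v]) = pr [set x | S (g x)].
Proof.
move=> us gs mg; have := integral_fibers us gs mg (f := fun v => (S v)%:R).
move=> /(_ ltac:(by [])).
have mS : measurable [set x | S (g x)].
  have -> : [set x | S (g x)] =
      \big[setU/set0]_(v <- s) (if S v then g @^-1` [set v] else set0).
    apply/seteqP; split => x; rewrite -bigcup_seq /=.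
      by move=> Sx; exists (g x) => //=; rewrite Sx.
    by move=> [v _]; case: ifP => // Sv /= ->.
  by apply: bigsetU_measurable => v _; case: ifP.
under eq_integral => x _.
  rewrite (_ : (S (g x))%:R = \1_[set x | S (g x)] x); last first.
    rewrite indicE; case: (boolP (S (g x))) => h; first by rewrite mem_set.
    by rewrite memNset//=; exact/negP.
  over.
rewrite integral_indic// setIT => /(congr1 fine) /=; rewrite /pr => ->.
by rewrite big_mkcond; apply: eq_bigr => v _; case: ifP; rewrite ?mul1r ?mul0r.
Qed.

Lemma integral_constant (r : R) : (\int[P]_x r%:E = r%:E)%E.
Proof.
rewrite (integral_cst _ measurableT) -[RHS]mule1; congr (_ * _)%E.
exact: probability_setT.
Qed.

End probability_helpers.

(** * Approximation by cylinder sets *)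
Section approximation.
Variables (R : realType) (nu : probability (full_shift R) R).
Local Notation X := (full_shift R).

Definition symdiff (A C : set X) := (A `\` C) `|` (C `\` A).

Lemma measurable_symdiff A C : measurable A -> measurable C -> measurable (symdiff A C).
Proof. by move=> mA mC; apply: measurableU; exact: measurableD. Qed.

Lemma measurable_cylinder_set C : @cylinder_sets R C -> measurable C.
Proof. by move=> [K [S ->]]; exact: measurable_cylinder. Qed.

Definition approximable := [set A : set X | measurable A /\
  forall e : R, 0 < e -> exists2 C, cylinder_sets C & pr nu (symdiff A C) < e].

Lemma approximable_setU : setU_closed approximable.
Proof.
move=> A B [mA hA] [mB hB]; split => [|e e0]; first exact: measurableU.
have [C cC AC] := hA _ (divr_gt0 e0 (ltr0n R 2)).
have [D cD BD] := hB _ (divr_gt0 e0 (ltr0n R 2)).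
have mC := measurable_cylinder_set cC; have mD := measurable_cylinder_set cD.
have cCD : cylinder_sets (C `|` D).
  move: cC cD => [K [S ->]] [K' [S' ->]].
  have [S1 ->] := central_widen R S (leq_maxl K K').
  have [S2 ->] := central_widen R S' (leq_maxr K K').
  by exists (maxn K K'), (S1 `|` S2).
exists (C `|` D) => //.
apply: (@le_lt_trans _ _ (pr nu (symdiff A C `|` symdiff B D))).
  apply: pr_le.
  - by apply: measurable_symdiff; exact: measurableU.
  - by apply: measurableU; exact: measurable_symdiff.
  - by move=> x; rewrite /symdiff /=; tauto.
apply: le_lt_trans (pr_setU _ _ _) _; try exact: measurable_symdiff.
by lra.
Qed.

(** A countable union is exhausted by a finite one up to a small probability. *)
Lemma approximable_sigma_algebra : sigma_algebra setT approximable.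
Proof.
have a0 : approximable set0.
  split => // e e0; exists set0; first by exists 0%N, set0; rewrite preimage_set0.
  by rewrite /symdiff setDv setU0 /pr measure0.
split => // [A [mA hA]|A hA].
  split; first by rewrite setTD; exact: measurableC.
  move=> e e0; have [C cC AC] := hA _ e0; exists (~` C).
    by move: cC => [K [S ->]]; exists K, (~` S); rewrite preimage_setC.
  suff -> : symdiff (setT `\` A) (~` C) = symdiff A C by [].
  apply/seteqP; split => x; rewrite /symdiff /=;
    have [?|?] := pselect (A x); have [?|?] := pselect (C x); tauto.
have mA n : measurable (A n) by have [] := hA n.
have mUA : measurable (\bigcup_k A k) by exact: bigcupT_measurable.
split => // e e0.
pose B n := (\bigcup_k A k) `\` \big[setU/set0]_(i < n) A i.
have mbig n : measurable (\big[setU/set0]_(i < n) A i) by exact: bigsetU_measurable.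
have mB n : measurable (B n) by exact: measurableD.
have B0 : nu (B n) @[n --> \oo] --> nu (\bigcap_n B n).
  apply: nonincreasing_cvg_mu => //.
  - by apply: le_lt_trans (probability_le1 nu (mB 0%N)) _; rewrite ltry.
  - exact: bigcapT_measurable.
  - move=> m n mn; apply/subsetPset; apply: setDS.
    rewrite -!bigcup_mkord => x [i /= im Ai]; exists i => //=.
    exact: leq_trans mn.
have [N hN] : exists N, pr nu (B N) < e / 2.
  have : nu (B n) @[n --> \oo] --> 0%:E.
    suff <- : nu (\bigcap_n B n) = 0%:E by [].
    rewrite (_ : \bigcap_n B n = set0) ?measure0// -subset0 => x h.
    have [[k _ Ak] _] := h 0%N I; have [_] := h k.+1 I; apply.
    by rewrite -bigcup_mkord; exists k => //=.
  move=> /fine_cvgP[_ /cvgr_lt] /(_ _ (divr_gt0 e0 (ltr0n R 2))) [N _ hN].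
  by exists N; exact: (hN N (leqnn N)).
have aN : approximable (\big[setU/set0]_(i < N) A i).
  elim: N {hN} => [|N IH]; first by rewrite big_ord0.
  by rewrite big_ord_recr; exact: approximable_setU.
have [C cC hC] := aN.2 _ (divr_gt0 e0 (ltr0n R 2)).
have mC := measurable_cylinder_set cC.
exists C => //.
apply: (@le_lt_trans _ _ (pr nu (B N `|` symdiff (\big[setU/set0]_(i < N) A i) C))).
  apply: pr_le.
  - exact: measurable_symdiff.
  - by apply: measurableU => //; exact: measurable_symdiff.
  - move=> x; rewrite /symdiff /B /=.
    have sub : \big[setU/set0]_(i < N) A i `<=` \bigcup_k A k.
      by rewrite -bigcup_mkord => y [i _ Ai]; exists i.
    have := sub x; have [?|?] := pselect ((\big[setU/set0]_(i < N) A i) x); tauto.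
apply: le_lt_trans (pr_setU _ _ _) _ => //; first exact: measurable_symdiff.
by lra.
Qed.

Lemma measurable_approximable A : measurable A -> approximable A.
Proof.
rewrite measurable_shiftE; apply: smallest_sub.
  exact: approximable_sigma_algebra.
move=> C cC; split; first exact: measurable_cylinder_set.
by move=> e e0; exists C => //; rewrite /symdiff setDv setU0 /pr measure0.
Qed.

End approximation.

(** * From codes to entropy *)
Section gibbs.
Variable R : realType.

Lemma log2_prod (I : Type) (s : seq I) (F : I -> R) :
  (forall i, 0 < F i) -> log2 (\prod_(i <- s) F i) = \sum_(i <- s) log2 (F i).
Proof.
move=> F0; elim: s => [|i s IH]; first by rewrite !big_nil log2_1.
by rewrite !big_cons log2M ?IH// prodr_gt0.
Qed.

(** This is [ln t <= t - 1] for [t = q / a]. *)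
Lemma gibbs_term (a q : R) : 0 <= a -> 0 < q ->
  a * log2 q - a * log2 a <= (q - a) / ln 2.
Proof.
rewrite le_eqVlt => /predU1P[<- q0|a0 q0].
  by rewrite !mul0r subr0 subr0 divr_ge0 ?ltW// ln2_gt0.
have -> : a * log2 q - a * log2 a = a * ln (q / a) / ln 2.
  by rewrite ln_div ?posrE// /log2; lra.
rewrite ler_pM2r ?invr_gt0 ?ln2_gt0//.
have -> : q / a = 1 + (q / a - 1) by lra.
apply: (@le_trans _ _ (a * (q / a - 1))); last by rewrite mulrBr mulrC divfK ?mulr1// gt_eqF.
rewrite ler_pM2l// le_ln1Dx//.
by have := divr_gt0 q0 a0; lra.
Qed.

Lemma gibbs (I : Type) (s : seq I) (a q : I -> R) :
  (forall i, 0 <= a i) -> (forall i, 0 < q i) ->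
  \sum_(i <- s) q i <= \sum_(i <- s) a i ->
  - \sum_(i <- s) a i * log2 (a i) <= \sum_(i <- s) a i * - log2 (q i).
Proof.
move=> a0 q0 qa; rewrite -subr_ge0 opprK -big_split /=.
have h : \sum_(i <- s) (a i * log2 (q i) - a i * log2 (a i)) <= 0.
  apply: le_trans (ler_sum _ (fun i _ => gibbs_term (a0 i) (q0 i))) _.
  by rewrite -mulr_suml sumrB pmulr_lle0 ?invr_gt0 ?ln2_gt0// subr_le0.
rewrite -oppr_le0 -sumrN; apply: le_trans h; rewrite le_eqVlt; apply/orP; left.
by apply/eqP/eq_bigr => i _; lra.
Qed.

Lemma sum_tuple_prod (V : finType) m (G : 'I_m -> V -> R) :
  \sum_(v : m.-tuple V) \prod_(i < m) G i (tnth v i) =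
  \prod_(i < m) \sum_(b : V) G i b.
Proof.
rewrite bigA_distr_bigA /= (reindex (fun v : m.-tuple V => [ffun i => tnth v i])) /=.
  by apply: eq_bigr => v _; apply: eq_bigr => i _; rewrite ffunE.
exists (fun f : {ffun 'I_m -> V} => [tuple f i | i < m]) => [v _|f _].
  by apply: eq_from_tnth => i; rewrite tnth_mktuple ffunE.
by apply/ffunP => i; rewrite ffunE tnth_mktuple.
Qed.

End gibbs.

Section invariant.
Variables (R : realType) (nu : probability (full_shift R) R).
Hypothesis nu_inv : invariant_measure shift_map nu.
Local Notation X := (full_shift R).
Local Notation T := (@shift_map R).

Lemma measurable_preimage_iter i (A : set X) : measurable A ->
  measurable (iter i T @^-1` A).
Proof.
by move=> mA; rewrite -[_ @^-1` _]setTI; exact: (@measurable_iter_shift R i).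
Qed.

Lemma measure_iter i (A : set X) : measurable A -> nu (iter i T @^-1` A) = nu A.
Proof.
elim: i A => [//|i IH] A mA.
rewrite -(nu_inv mA) -[in RHS]IH//; exact: (measurable_preimage_iter 1).
Qed.

Lemma pr_iter i (A : set X) : measurable A -> pr nu (iter i T @^-1` A) = pr nu A.
Proof. by move=> mA; rewrite /pr measure_iter. Qed.

Lemma integral_iter i (f : X -> \bar R) : measurable_fun setT f ->
  (forall x, 0 <= f x)%E -> (\int[nu]_x f (iter i T x) = \int[nu]_x f x)%E.
Proof.
move=> mf f0; have mT := @measurable_iter_shift R i.
transitivity (\int[pushforward nu (iter i T)]_x f x)%E.
  by rewrite (ge0_integral_pushforward mT)// preimage_setT.
apply: eq_measure_integral => A mA _; exact: measure_iter.
Qed.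

Lemma measurable_mislabel k (p : X -> 'I_k) K (f : seq bool -> 'I_k) :
  (forall i, measurable (p @^-1` [set i])) ->
  measurable [set x | p x != f (central K x)].
Proof.
move=> mp; have m2 (v : 'I_k * seq bool) :
    measurable ((fun x : X => (p x, central K x)) @^-1` [set v]).
  rewrite (_ : _ @^-1` _ = p @^-1` [set v.1] `&` [set x | central K x = v.2]).
    apply: measurableI => //.
    exact: (@measurable_window_fiber R (- K%:Z) (2 * K).+1 [set v.2]).
  by apply/seteqP; split => x /=; case: v => ? ? /=; [case=> -> ->|case=> -> ->].
exact: (measurable_preimage_count m2 [set v | v.1 != f v.2]).
Qed.

(** Each central word is labelled by a cell whose approximating cylinder contains
    it. The label is wrong only in the symmetric differences of the cells and
    their approximations. *)
Lemma approx_partition k (p : X -> 'I_k) (e : R) : 0 < e ->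
  (forall i, measurable (p @^-1` [set i])) ->
  exists K f, pr nu [set x | p x != f (central K x)] < e.
Proof.
move=> e0 mp; pose i0 := p (fun=> false).
have ex i : exists KS : nat * set (seq bool),
    pr nu (symdiff (p @^-1` [set i]) (central KS.1 @^-1` KS.2)) < e / 2 / k%:R.
  have [_ h] := measurable_approximable nu (mp i).
  have k0 : 0 < k%:R :> R by rewrite ltr0n (leq_ltn_trans _ (ltn_ord i0)).
  by have [_ [K [S ->]] ?] := h _ (divr_gt0 (divr_gt0 e0 (ltr0n R 2)) k0); exists (K, S).
have /boolp.choice[KS hKS] := ex.
pose K := \max_(i < k) (KS i).1.
have leK i : ((KS i).1 <= K)%N by exact: (leq_bigmax (F := fun i => (KS i).1) i).
have exS i := central_widen R (KS i).2 (leK i).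
have [S hS] := boolp.choice exS.
pose f w := odflt i0 [pick i | `[< S i w >]].
have mS i : measurable (central K @^-1` S i : set X) by exact: measurable_cylinder.
have mbad := measurable_mislabel K f mp.
exists K, f.
apply: (@le_lt_trans _ _ (pr nu (\big[setU/set0]_(i < k)
    symdiff (p @^-1` [set i]) (central K @^-1` S i)))).
  apply: pr_le => //.
    by apply: bigsetU_measurable => i _; exact: measurable_symdiff.
  move=> x /=; rewrite -bigcup_seq => bad.
  have [xS|xS] := pselect (S (p x) (central K x)); last first.
    by exists (p x); [rewrite /= mem_index_enum|left].
  move: bad; rewrite /f; case: pickP => [j /asboolP Sj|/(_ (p x))]; last by rewrite asboolT.
  by move=> /= pj; exists j; [rewrite /= mem_index_enum|right]; split => //= pxj; rewrite pxj eqxx in pj.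
apply: le_lt_trans (pr_bigU _ _ _) _.
  by move=> i; exact: measurable_symdiff.
have k0 : 0 < k%:R :> R by rewrite ltr0n (leq_ltn_trans _ (ltn_ord i0)).
apply: (@le_lt_trans _ _ (\sum_(i < k) e / 2 / k%:R)).
  by apply: ler_sum => i _; rewrite -hS ltW.
rewrite sumr_const card_ord -[_ *+ _]mulr_natr divfK ?gt_eqF//; lra.
Qed.

Section code.
Variables (q : seq bool -> R) (F : nat -> X -> R) (c : R).
Hypothesis c_ge0 : 0 <= c.
Hypothesis q_gt0 : forall w, 0 < q w.
Hypothesis q_mass : forall m, \sum_(w <- words m) q w <= 1.
Hypothesis mF : forall m, measurable_fun setT (F m).
Hypothesis qF : forall m x, - log2 (q (window 0 m x)) <= F m x.
Hypothesis intF : forall e : R, 0 < e -> exists N, forall m, (N <= m)%N ->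
  (\int[nu]_x (F m x)%:E <= (m%:R * (c + e))%:E)%E.

Lemma code_le1 w : q w <= 1.
Proof.
apply: le_trans (q_mass (size w)).
rewrite (bigD1_seq w) ?words_uniq ?mem_words//= lerDl.
by apply: sumr_ge0 => ? _; exact: ltW.
Qed.

Lemma code_length_ge0 m x : 0 <= F m x.
Proof. by apply: le_trans (qF m x); rewrite log2N_ge0// code_le1. Qed.

Definition itinerary k (p : X -> 'I_k) m (x : X) : m.-tuple 'I_k :=
  [tuple p (iter i T x) | i < m].

Lemma join_cellE k (p : X -> 'I_k) m (v : m.-tuple 'I_k) :
  join_cell T p v = itinerary p m @^-1` [set v].
Proof.
apply/seteqP; split => x /=; rewrite /join_cell /=.
  by move=> h; apply: eq_from_tnth => i; rewrite tnth_mktuple h.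
by move=> <- i; rewrite tnth_mktuple.
Qed.

Lemma measurable_itinerary k (p : X -> 'I_k) m (v : m.-tuple 'I_k) :
  (forall i, measurable (p @^-1` [set i])) ->
  measurable (itinerary p m @^-1` [set v]).
Proof.
move=> mp; rewrite -join_cellE.
rewrite (_ : join_cell _ _ _ = \big[setI/setT]_(i < m)
    (iter i T @^-1` (p @^-1` [set tnth v i]))).
  by apply: bigsetI_measurable => i _; exact: measurable_preimage_iter.
apply/seteqP; split => x; rewrite -bigcap_seq /=.
  by move=> h i _ /=; exact: h.
by move=> h i; apply: (h i); rewrite /= mem_index_enum.
Qed.

(** Any finite partition is, up to a small error, read off a window of the
    sequence. Passing the code through a noisy channel that makes this error
    gives a code for the itineraries of the partition. *)
Lemma join_entropy_le k (p : X -> 'I_k) (e : R) :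
  (forall i, measurable (p @^-1` [set i])) -> 0 < e ->
  exists N, forall m, (N <= m)%N -> join_entropy T nu p m <= m%:R * (c + e).
Proof.
move=> mp e0; have e4 : 0 < e / 4 by lra.
have k0 : (0 < k)%N by rewrite (leq_ltn_trans _ (ltn_ord (p (fun=> false)))).
have kR : 1 <= k%:R :> R by rewrite ler1n.
(* Sending a symbol unchanged costs [e / 4] bits, changing it [B] bits. *)
pose d : R := 1 - 2 `^ (- (e / 4)).
have E1 : 1 - d = 2 `^ (- (e / 4)) by rewrite /d; lra.
have p0 : 0 < 2 `^ (- (e / 4)) :> R by rewrite powR_gt0.
have p1 : 2 `^ (- (e / 4)) < 1 :> R.
  rewrite ltNge; apply/negP => /log2_ge0; rewrite log2_powR; lra.
have d0 : 0 < d by rewrite /d; lra.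
have d1 : d < 1 by rewrite /d; lra.
have dk0 : 0 < d / k%:R by rewrite divr_gt0//; lra.
have dk1 : d / k%:R <= 1 by rewrite ler_pdivrMr ?mul1r; lra.
pose B := - log2 (d / k%:R); have B0 : 0 <= B by rewrite /B log2N_ge0.
have e1 : 0 < e / 4 / (B + 1) by rewrite divr_gt0//; lra.
have [K [f hf]] := approx_partition e1 mp.
pose bad x := p x != f (central K x).
pose Nz (a b : 'I_k) : R := if a == b then 1 - d else d / k%:R.
have Nz0 a b : 0 < Nz a b by rewrite /Nz; case: ifP => _ //; lra.
have Nz1 a : \sum_b Nz a b <= 1.
  rewrite (bigD1 a)//= {1}/Nz eqxx (eq_bigr (fun=> d / k%:R)); last first.
    by move=> b; rewrite /Nz eq_sym => /negbTE ->.
  apply: (@le_trans _ _ (1 - d + \sum_(b < k) d / k%:R)).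
    rewrite lerD2l big_mkcond /=; apply: ler_sum => b _; case: ifP => // _.
    exact: ltW.
  by rewrite sumr_const card_ord -[_ *+ _]mulr_natr divfK ?gt_eqF//; lra.
pose guess w i := f (take (2 * K).+1 (drop i w)).
pose q' m (v : m.-tuple 'I_k) :=
  \sum_(w <- words (m + 2 * K)) q w * \prod_(i < m) Nz (guess w i) (tnth v i).
have prod0 m (v : m.-tuple 'I_k) w : 0 < \prod_(i < m) Nz (guess w i) (tnth v i).
  by rewrite prodr_gt0.
have q'_ge m (v : m.-tuple 'I_k) w : size w = (m + 2 * K)%N ->
    q w * \prod_(i < m) Nz (guess w i) (tnth v i) <= q' m v.
  move=> sw; rewrite /q' (bigD1_seq w) ?words_uniq ?mem_words ?sw ?eqxx//= lerDl.
  by apply: sumr_ge0 => u _; exact: mulr_ge0 (ltW (q_gt0 u)) (ltW (prod0 m v u)).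
have q'0 m (v : m.-tuple 'I_k) : 0 < q' m v.
  apply: lt_le_trans (q'_ge m v (nseq (m + 2 * K) false) _); last by rewrite size_nseq.
  by rewrite mulr_gt0.
have q'_mass m : \sum_v q' m v <= 1.
  rewrite exchange_big /=; apply: le_trans (q_mass (m + 2 * K)); apply: ler_sum => w _.
  rewrite -mulr_sumr ler_piMr ?(ltW (q_gt0 w))// (sum_tuple_prod (fun i b => Nz (guess w i) b)).
  apply: (@le_trans _ _ (\prod_(i < m) (1 : R))); last by rewrite big1.
  apply: ler_prod => i _; apply/andP; split; last exact: Nz1.
  by apply: sumr_ge0 => b _; exact: ltW.
have [N hN] := intF e4.
pose D := (2 * K)%N.
exists (N + Num.bound (D%:R * (c + e / 4) / (e / 4)))%N => m Nm.
pose it x := itinerary p m (iter K T x).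
have mit v : measurable (it @^-1` [set v]).
  exact: (measurable_preimage_iter K (measurable_itinerary v mp)).
have prit v : pr nu (join_cell T p v) = pr nu (it @^-1` [set v]).
  by rewrite join_cellE -(@pr_iter K)//; exact: measurable_itinerary.
have bnd x : - log2 (q' m (it x)) <=
    F (m + D)%N x + \sum_(i < m) (e / 4 + B * (bad (iter (i + K) T x))%:R).
  pose w := window 0 (m + D) x.
  have sw : size w = (m + 2 * K)%N by rewrite size_mkseq.
  apply: (@le_trans _ _ (- log2 (q w * \prod_(i < m) Nz (guess w i) (tnth (it x) i)))).
    by rewrite lerN2 le_log2 ?mulr_gt0// q'_ge.
  rewrite log2M// opprD lerD ?qF// log2_prod// -sumrN; apply: ler_sum => i _.
  rewrite tnth_mktuple -iterD.
  have -> : guess w i = f (central K (iter (i + K) T x)).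
    have hi : (i + (2 * K).+1 <= m + D)%N by rewrite addnS -addSn leq_add2r.
    rewrite /guess /w (take_drop_window 0 x hi) /central window_iter.
    by rewrite PoszD [- K%:Z + _]addrC addrK add0r.
  rewrite /Nz /bad eq_sym; case: eqP => _ /=.
    by rewrite mulr0 addr0 E1 log2_powR opprK.
  by rewrite mulr1 -/B lerDr ltW.
have H1 : join_entropy T nu p m <= \sum_v pr nu (it @^-1` [set v]) * - log2 (q' m v).
  rewrite /join_entropy; under eq_bigr => v _ do rewrite -/(pr _ _) prit.
  apply: gibbs => // [v|]; first exact: pr_ge0.
  rewrite (sum_pr_fibers (g := it) _ predT) ?index_enum_uniq//.
    by rewrite [X in pr _ X](_ : _ = setT) ?pr_setT//; apply/seteqP.
  by move=> x; rewrite mem_index_enum.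
apply: le_trans H1 _.
have mbad i : measurable [set x | bad (iter i T x)].
  exact: (@measurable_preimage_iter i [set x | bad x] (measurable_mislabel K f mp)).
have g0 (b : bool) : 0 <= e / 4 + B * b%:R.
  by case: b; rewrite ?mulr1 ?mulr0; lra.
have intbad i : (\int[nu]_x (e / 4 + B * (bad (iter i T x))%:R)%:E =
    (e / 4 + B * pr nu [set x | bad x])%:E)%E.
  have mb b : measurable ((fun x => bad (iter i T x)) @^-1` [set b]).
    case: b; first exact: mbad.
    rewrite (_ : _ @^-1` _ = ~` [set x | bad (iter i T x)]); first exact: measurableC.
    by apply/seteqP; split => x /=; case: (bad _).
  have mem b : b \in [:: true; false] by case: b.
  rewrite (integral_fibers nu (g := fun x => bad (iter i T x))
     (s := [:: true; false]) (f := fun b => e / 4 + B * b%:R))//.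
  congr EFin.
  have := @sum_pr_fibers _ _ _ nu _ (fun x => bad (iter i T x)) [:: true; false] predT
    isT (fun x => mem _) mb.
  rewrite [X in _ = pr _ X -> _](_ : _ = setT); last by apply/seteqP.
  rewrite pr_setT !big_cons !big_nil !addr0 mulr1 mulr0 addr0.
  have -> : pr nu ((fun x => bad (iter i T x)) @^-1` [set true]) = pr nu [set x | bad x].
    by rewrite -[RHS](pr_iter i (mbad 0%N)).
  by move=> /= h; rewrite -[in RHS](mulr1 (e / 4)) -h; lra.
have lq0 v : 0 <= - log2 (q' m v).
  rewrite log2N_ge0//; apply: le_trans (q'_mass m).
  by rewrite (bigD1 v)//= lerDl sumr_ge0// => ? _; exact: ltW.
have E : (\int[nu]_x (- log2 (q' m (it x)))%:E =
    (\sum_v pr nu (it @^-1` [set v]) * - log2 (q' m v))%:E)%E.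
  rewrite (integral_fibers nu (f := fun v => - log2 (q' m v))
    (index_enum_uniq _) (fun x => mem_index_enum (it x)) mit lq0).
  by congr EFin; apply: eq_bigr => v _; rewrite mulrC.
rewrite -lee_fin -E.
have mF' : measurable_fun setT (fun x => (F (m + D)%N x)%:E).
  by apply/measurable_EFinP.
have mbadf i : measurable_fun setT
    (fun x => (e / 4 + B * (bad (iter i T x))%:R)%:E : \bar R).
  apply/measurable_EFinP; apply: measurable_funD => //; apply: measurable_funM => //.
  rewrite (_ : (fun _ => _) = \1_[set x | bad (iter i T x)]); first exact: measurable_indic.
  apply/funext => x; rewrite indicE; case: (boolP (bad _)) => h; first by rewrite mem_set.
  by rewrite memNset//=; exact/negP.
apply: (@le_trans _ _ (\int[nu]_x ((F (m + D)%N x)%:E +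
   \sum_(i < m) (e / 4 + B * (bad (iter (i + K) T x))%:R)%:E))%E).
  apply: ge0_le_integral => //.
  - by move=> x _; rewrite lee_fin lq0.
  - apply/measurable_EFinP => _ A _; rewrite setTI.
    exact: (measurable_preimage_count mit [set v | A (- log2 (q' m v))]).
  - by apply: emeasurable_funD => //; exact: emeasurable_sum.
  - by move=> x _; rewrite sumEFin -EFinD lee_fin bnd.
rewrite ge0_integralD//; first last.
- exact: emeasurable_sum.
- by move=> x _; apply: sume_ge0 => i _; rewrite lee_fin g0.
- by move=> x _; rewrite lee_fin code_length_ge0.
rewrite ge0_integral_sum//; last first.
  by move=> i x _; rewrite lee_fin g0.
under eq_bigr => i _ do rewrite intbad.
rewrite sumEFin sumr_const card_ord.
have hNm := hN (m + D)%N (leq_trans (leq_trans (leq_addr _ _) Nm) (leq_addr _ _)).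
apply: le_trans (leeD hNm (lexx _)) _.
rewrite -EFinD lee_fin -[_ *+ m]mulr_natl natrD.
have Bbad : B * pr nu [set x | bad x] <= e / 4.
  apply: (@le_trans _ _ ((B + 1) * (e / 4 / (B + 1)))).
    by rewrite ler_pM ?pr_ge0//; [lra|exact: ltW].
  by rewrite mulrC divfK//; lra.
have Dm : D%:R * (c + e / 4) <= m%:R * (e / 4).
  rewrite -ler_pdivrMr//; apply: (@le_trans _ _ (Num.bound (D%:R * (c + e / 4) / (e / 4)))%:R).
    apply/ltW/archi_boundP; apply: divr_ge0; last exact: ltW.
    exact: mulr_ge0 (ler0n _ _) (addr_ge0 c_ge0 (ltW e4)).
  by rewrite ler_nat (leq_trans (leq_addl _ _) Nm).
have mR : 0 <= m%:R :> R by [].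
nra.
Qed.

End code.
End invariant.

(** * Limits of join entropies *)
Section entropy_limits.
Variables (R : realType) (nu : probability (full_shift R) R).
Local Notation X := (full_shift R).
Local Notation T := (@shift_map R).

(** If the sequence of the entropy rates does not converge, [lim] is the default
    value [0]. *)
Lemma partition_entropy_le k (p : X -> 'I_k) (c : R) : 0 <= c ->
  (forall e, 0 < e -> exists N, forall m, (N <= m)%N ->
     join_entropy T nu p m <= m%:R * (c + e)) ->
  partition_entropy T nu p <= c.
Proof.
move=> c0 h; rewrite /partition_entropy; set u := fun n => _.
have [cu|du] := pselect (cvgn u); last by rewrite dvgP.
apply/ler_addgt0Pr => e e0; have [N hN] := h _ e0.
apply: limr_le => //; exists N.+1 => // m /= Nm.
by rewrite /u ler_pdivrMr ?ltr0n ?(leq_trans _ Nm)// mulrC hN// ltnW.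
Qed.

Lemma partition_entropyE k (p : X -> 'I_k) (c : R) :
  (forall e, 0 < e -> exists N, forall m, (N <= m)%N ->
     m%:R * (c - e) <= join_entropy T nu p m <= m%:R * (c + e)) ->
  partition_entropy T nu p = c.
Proof.
move=> h; apply/cvg_lim => //; apply/cvgrPdist_le => e e0.
have [N hN] := h _ e0; exists N.+1 => // m /= Nm.
have m0 : 0 < m%:R :> R by rewrite ltr0n (leq_trans _ Nm).
have /andP[h1 h2] := hN _ (ltnW Nm).
rewrite ler_norml; apply/andP; split.
  rewrite lerBrDr addrC -lerBrDr opprK ler_pdivrMr// mulrC; exact: h2.
by rewrite lerBlDr addrC -lerBlDr ler_pdivlMr// mulrC; exact: h1.
Qed.

Lemma entropy_le_joins (c : R) : 0 <= c ->
  (forall k (p : X -> 'I_k) e, (forall i, measurable (p @^-1` [set i])) -> 0 < e ->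
    exists N, forall m, (N <= m)%N -> join_entropy T nu p m <= m%:R * (c + e)) ->
  (entropy T nu <= c%:E)%E.
Proof.
move=> c0 h; apply: ge_ereal_sup => _ [k [p [mp ->]]].
by rewrite lee_fin; apply: partition_entropy_le => // e e0; exact: h.
Qed.

End entropy_limits.

(** * The subshifts generated by the blocks *)
Section language.
Variable R : realType.
Local Notation X := (full_shift R).
Implicit Types x z : X.
Local Notation FC n := (@free_concatenation R (W_ n)).

Lemma free_concatenation_blocks n z : FC n z ->
  exists (a : int) (y : int -> bool), forall (k : int) (r : nat), (r < 2 ^ n)%N ->
    z (a + k * (2 ^ n)%N%:Z + r%:Z) = y k (+) (r == (2 ^ n).-1).
Proof.
set L := (2 ^ n)%N; have L0 : (0 < L)%N by rewrite expn_gt0.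
move=> [w [c hw]].
have sw k : size (w k) = L.
  by have [+ _ _] := hw k; rewrite !inE => /orP[]/eqP->;
    rewrite size_rcons size_nseq; rewrite -/L; lia.
have cE (k : int) : c k = c 0 + k * L%:Z.
  have step j : c (j + 1) = c j + L%:Z by have [_ -> _] := hw j; rewrite sw.
  have pos (m : nat) : c m%:Z = c 0 + m%:Z * L%:Z.
    elim: m => [|m IH]; first by rewrite mul0r addr0.
    by rewrite -addn1 PoszD step IH mulrDl mul1r addrA.
  have neg (m : nat) : c (- m%:Z) = c 0 - m%:Z * L%:Z.
    elim: m => [|m IH]; first by rewrite mul0r oppr0 addr0.
    have := step (- m.+1%:Z); rewrite (_ : - m.+1%:Z + 1 = - m%:Z); last by lia.
    by rewrite IH -addn1 PoszD mulrDl mul1r; lia.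
  by case: k => m; [exact: pos|rewrite NegzE neg mulNr].
exists (c 0), (fun k => w k == rcons (nseq (L - 1) true) false) => k r rL.
have [wk _ /(_ r)] := hw k; rewrite sw cE => /(_ rL) ->.
have nthE b : nth false (rcons (nseq (L - 1) b) (~~ b)) r = b (+) (r == L.-1).
  rewrite nth_rcons size_nseq nth_nseq; case: ltnP => rl.
    by rewrite (_ : (r == L.-1) = false) ?addbF//; apply/eqP; lia.
  have -> : r = L.-1 by apply/eqP; rewrite eqn_leq -subn1 rl subn1 -ltnS prednK// rL.
  by rewrite subn1 !eqxx addbT.
have [->|nw] := eqVneq; first exact: (nthE true).
by move: wk; rewrite !inE (negbTE nw) orbF => /eqP ->; exact: (nthE false).
Qed.

Lemma free_concatenation_lang n z (s t : nat) : FC n z ->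
  in_lang n (fun i => z i%:Z) s t.
Proof.
move=> /free_concatenation_blocks[a [y zy]].
set L := (2 ^ n)%N in zy; have L0 : (0 < L)%N by rewrite expn_gt0.
have [d [q [dL dE]]] : exists (d : nat) (q : int), (d < L)%N /\ d%:Z = - a + q * L%:Z.
  have L0' : L%:Z != 0 by rewrite eqz_nat -lt0n.
  have m0 := modz_ge0 (- a) L0'.
  exists (absz (modz (- a) L%:Z)), (- divz (- a) L%:Z); split.
    by rewrite -ltz_nat gez0_abs// ltz_pmod// ltz_nat.
  have E := divz_eq (- a) L%:Z; rewrite gez0_abs// mulNr; apply/eqP.
  by rewrite eq_sym subr_eq addrC; apply/eqP.
exists d => //; exists (fun i => y (i%:Z - q)) => i _.
rewrite /block_symbol -/L -(zy (((i + d) %/ L)%N%:Z - q) ((i + d) %% L)%N) ?ltn_mod//.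
congr z; have := congr1 Posz (divn_eq (i + d) L); rewrite !PoszD PoszM dE => E.
by rewrite mulrBl; move: E; set u := _%N%:Z * _; lia.
Qed.

Lemma free_concatenation_shift n z (i : int) : FC n z -> FC n (fun t => z (t - i)).
Proof.
move=> [w [c h]]; exists w, (fun k => c k + i) => k; have [h1 h2 h3] := h k.
split => // [|r rw]; first by rewrite h2 addrAC.
by rewrite -h3//; congr z; lia.
Qed.

Definition shadow n K x := exists2 z, FC n z & central K z = central K x.

Lemma shadow_le n K K' x : (K <= K')%N -> shadow n K' x -> shadow n K x.
Proof.
move=> KK' [z zn zx]; exists z => //; apply/central_eqP => i iK.
by move/central_eqP : zx; apply; exact: leq_trans KK'.
Qed.

Lemma X_shadowP n x : X_ n x <-> forall K, shadow n K x.
Proof.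
split => [xX K|h].
  have [] := xX (ball x (2 ^- K)).
    by apply: nbhsx_ballx; rewrite invr_gt0 exprn_gt0.
  by move=> z [zn /ball_central xz]; exists z.
move=> B; rewrite -nbhs_ballE => -[e /= e0 eB].
have [K Ke] : exists K : nat, 2 ^- K < e.
  exists (Num.bound e^-1); rewrite invf_plt ?posrE ?exprn_gt0//.
  exact: upper_nthrootP.
have [z zn zx] := h K; exists z; split => //; apply: eB.
by apply: le_ball (ltW Ke) _ _; apply/ball_central.
Qed.

Lemma FC_X n z : FC n z -> X_ n z.
Proof. by move=> zn; apply/X_shadowP => K; exists z. Qed.

Lemma shadow_lang n K x i : shadow n K (iter i shift_map x) ->
  in_lang n (fun t => x t%:Z) (i.+1 - K.+1) (i + K.+1).
Proof.
move=> [z zn /central_eqP zx].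
have [a aL [y xy]] := free_concatenation_lang (i.+1 - K.+1) (i + K.+1)
  (free_concatenation_shift i zn).
exists a => //; exists y => t tI; rewrite -xy//.
by rewrite zx ?iter_shiftE; [congr x; lia|lia].
Qed.

Lemma measurable_shadow n K : measurable [set x | shadow n K x].
Proof.
exact: (@measurable_cylinder R K [set w | exists2 z, FC n z & central K z = w]).
Qed.

Lemma X_measurable n : measurable (@X_ R n).
Proof.
rewrite (_ : X_ n = \bigcap_K [set x | shadow n K x]).
  by apply: bigcapT_measurable => K; exact: measurable_shadow.
apply/seteqP; split => x; first by move=> /X_shadowP h K _; exact: h.
by move=> h; apply/X_shadowP => K; exact: (h K I).
Qed.

(** Repeat the block that starts with [b]. Hence one symbol never tells a point
    from [X_ n], and the radius [0] does not occur. *)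
Lemma free_concatenation_const n b : (0 < n)%N -> exists2 z, FC n z & z 0 = b.
Proof.
move=> n0; set L := (2 ^ n)%N; have L2 : (2 <= L)%N by rewrite /L -[leqLHS]expn1 leq_exp2l.
pose u := rcons (nseq (L - 1) b) (~~ b).
have su : size u = L by rewrite size_rcons size_nseq; lia.
exists (fun t => nth false u (absz (modz t L%:Z))); last first.
  by rewrite mod0z /= nth_rcons size_nseq nth_nseq; case: ltnP; lia.
exists (fun=> u), (fun k => k * L%:Z) => k; split.
- by rewrite !inE /u -/L; case: (b); rewrite ?eqxx ?orbT.
- by rewrite su mulrDl mul1r.
- by move=> r; rewrite su => rL; rewrite modzMDl modz_small//; lia.
Qed.

(** The exponent in the definition of [phi_]. *)
Definition shadow_radius n x : nat := get [set j : nat | dist_set x (X_ n) = 2 ^- j].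

(** A point of the closure agrees with a concatenation on every window. Hence the
    distance is attained at a concatenation, and its exponent is the least [j]
    such that the window [[-j, j]] of [x] does not occur in a concatenation. *)
Lemma shadow_radiusP n x : (0 < n)%N -> ~ X_ n x ->
  (0 < shadow_radius n x)%N /\ shadow n (shadow_radius n x).-1 x /\ ~ shadow n (shadow_radius n x) x.
Proof.
move=> n0 xX.
have [K0 hK0] : exists K, ~ shadow n K x.
  by apply/existsNP => h; apply: xX; apply/X_shadowP.
have exK : exists K, ~~ `[< shadow n K x >] by exists K0; apply/asboolPn.
have [j /asboolPn jx jmin] := ex_minnP exK.
have j0 : (0 < j)%N.
  rewrite lt0n; apply/negP => /eqP j0; rewrite j0 in jx; apply: jx.
  have [z zn z0] := free_concatenation_const (x 0) n0; exists z => //.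
  by apply/central_eqP => i i0; rewrite (_ : i = 0) ?z0//; lia.
have sj : shadow n j.-1 x.
  apply: contrapT => h; have := jmin j.-1; rewrite asboolF// => /(_ isT); lia.
suff -> : shadow_radius n x = j by [].
have d : dist_set x (X_ n) = 2 ^- j.
  have [z zn zx] := sj.
  have low y : X_ n y -> 2 ^- j <= mdist x y.
    move=> /X_shadowP /(_ j) [z' z'n z'y]; rewrite leNgt; apply/negP => xy.
    apply: jx; exists z' => //; rewrite z'y; apply/esym/ball_central.
    by rewrite ballEmdist.
  apply/eqP; rewrite eq_le; apply/andP; split; last first.
    apply: lb_le_inf; first by exists (mdist x z); exists z => //; exact: FC_X.
    by move=> _ [y yX <-]; exact: low.
  apply: (@le_trans _ _ (mdist x z)).
    apply: ge_inf; last by exists z => //; exact: FC_X.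
    by exists 0 => _ [y _ <-]; exact: mdist_ge0.
  have xz : x <> z.
    by move=> xz; apply: xX; rewrite xz; exact: FC_X.
  have [i xzi] := shift_dist_attained xz; rewrite /mdist /= => ->.
  rewrite lef_pV2 ?posrE ?exprn_gt0// ler_weXn2l ?ler1n//.
  rewrite leqNgt; apply/negP => ij; move: xzi; move/central_eqP: zx => ->.
    by rewrite eqxx.
  by lia.
have : dist_set x (X_ n) = 2 ^- shadow_radius n x.
  exact: (getPex (ex_intro (fun j : nat => dist_set x (X_ n) = 2 ^- j) j d)).
rewrite d => /invr_inj /ieexprIn -> //.
by rewrite gt_eqF// ltr1n.
Qed.

End language.

(** * The variational bound *)
Section variational.
Variable R : realType.
Local Notation X := (full_shift R).
Local Notation T := (@shift_map R).

Lemma log2_sublinear (e : R) : 0 < e ->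
  exists N, forall m, (N <= m)%N -> 9 + 3 * log2 m%:R <= m%:R * e.
Proof.
move=> e0; exists (Num.bound ((21 / e) ^+ 2)).+1 => m Nm.
have m1 : 1 <= m%:R :> R by rewrite ler1n; apply: leq_trans Nm.
have m0 : 0 <= m%:R :> R by [].
set s := Num.sqrt (m%:R : R).
have sE : s ^+ 2 = m%:R by rewrite sqr_sqrtr.
have s1 : 1 <= s by rewrite -[leLHS]sqrtr1 ler_wsqrtr.
have s21 : 21 / e <= s.
  rewrite -(@ler_pXn2r _ 2) ?nnegrE ?sqrtr_ge0 ?divr_ge0 ?(ltW e0)// sE.
  apply: le_trans (_ : (Num.bound ((21 / e) ^+ 2))%:R <= _).
    by apply/ltW/archi_boundP; rewrite exprn_ge0// divr_ge0// ltW.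
  by rewrite ler_nat ltnW.
have lns : ln s <= s by apply/ltW/ln_sublinear; lra.
have : log2 m%:R <= 4 * s.
  rewrite -sE log2X; last by lra.
  rewrite /log2 mulrA ler_pdivrMr ?ln2_gt0//.
  have := @ln2_ge R; have : 0 <= s by lra.
  by set l := ln 2; nra.
have : 21 <= s * e by rewrite -ler_pdivrMr.
by rewrite -sE expr2; nra.
Qed.

Lemma integral_bounded (nu : probability X R) (g : X -> R) (M : R) :
  measurable_fun setT g -> (forall x, 0 <= g x <= M) ->
  exists2 r, 0 <= r & (\int[nu]_x (g x)%:E = r%:E)%E.
Proof.
move=> mg gM; have g0 x : 0 <= g x by have /andP[] := gM x.
have I0 : (0 <= \int[nu]_x (g x)%:E)%E by apply: integral_ge0 => x _; rewrite lee_fin.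
have IM : (\int[nu]_x (g x)%:E <= M%:E)%E.
  apply: (@le_trans _ _ (\int[nu]_x M%:E)%E).
    apply: ge0_le_integral => //.
    - by move=> x _; rewrite lee_fin.
    - exact/measurable_EFinP.
    - by move=> x _; rewrite lee_fin; have /andP[] := gM x.
  by rewrite integral_constant.
move: I0 IM; case: (\int[nu]_x _)%E => [r| |] //= r0 _.
by exists r => //; rewrite -lee_fin.
Qed.

Variables (G : X -> R) (M : R).
Hypothesis mG : measurable_fun setT G.
Hypothesis GM : forall x, 0 <= G x <= M.
Hypothesis G_level : forall x, exists2 n, (0 < n)%N &
  (X_ n x /\ (2 ^+ n)^-1 <= G x) \/
  (~ X_ n x /\ (2 ^+ n)^-1 + radius_cost R (shadow_radius n x) <= G x).

Lemma window_stretch m (x : X) : window 0 m x = stretch (fun t => x t%:Z) 0 m.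
Proof. by apply: eq_map => i; rewrite !add0n add0r. Qed.

(** The greedy cover along the orbit of [x], with the radii of its points. *)
Lemma variational_code m x :
  0 < renewal (@piece_weight R) (window 0 m x) /\
  - log2 (renewal (@piece_weight R) (window 0 m x)) <=
    \sum_(i < m) G (iter i T x) + (9 + 3 * log2 m%:R).
Proof.
have ex (y : X) : exists n, (0 < n)%N /\
  ((X_ n y /\ (2 ^+ n)^-1 <= G y) \/
  (~ X_ n y /\ (2 ^+ n)^-1 + radius_cost R (shadow_radius n y) <= G y)).
  by have [n n0 hn] := G_level y; exists n.
have [lev hlev] := boolp.choice ex.
(* On [X_ n] every radius is allowed; one that exceeds [m] has no cost. *)
pose rad i := if `[< X_ (lev (iter i T x)) (iter i T x) >] then m.+1
              else shadow_radius (lev (iter i T x)) (iter i T x).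
have := @greedy_code R (fun t => x t%:Z) m (fun i => G (iter i T x))
  (fun i => lev (iter i T x)) rad.
have lev0 i : (0 < lev (iter i T x))%N by have [] := hlev (iter i T x).
have rad0 i : (0 < rad i)%N.
  by rewrite /rad; case: asboolP => // h; have [] := shadow_radiusP (lev0 i) h.
move=> /(_ (fun i _ => lev0 i) (fun i _ => rad0 i)) h.
have {h} := h _ _ 0%N (leq0n m); rewrite subn0 -window_stretch big_mkord; apply => i im.
- rewrite -(prednK (rad0 i)); apply: shadow_lang.
  rewrite /rad; case: asboolP => hX; first by move/X_shadowP: hX; apply.
  by have [_ []] := shadow_radiusP (lev0 i) hX.
- rewrite /rad; have [_ [[hX hG]|[hX hG]]] := hlev (iter i T x).
    by rewrite asboolT// ltnn addr0.
  rewrite asboolF//; case: ifP => // _; apply: le_trans hG.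
  by rewrite addr0 lerDl radius_cost_ge0.
Qed.

(** By invariance the Birkhoff sums of [G] have integral [m * g], and the
    logarithmic term is negligible. *)
Lemma variational_joins (nu : probability X R) (g : R) :
  invariant_measure T nu -> (\int[nu]_x (G x)%:E = g%:E)%E ->
  forall k (p : X -> 'I_k) e, (forall i, measurable (p @^-1` [set i])) -> 0 < e ->
    exists N, forall m, (N <= m)%N -> join_entropy T nu p m <= m%:R * (g + e).
Proof.
move=> inv Ig k p e mp e0.
have G0 x : 0 <= G x by have /andP[] := GM x.
have g0 : 0 <= g by rewrite -lee_fin -Ig integral_ge0// => x _; rewrite lee_fin.
have mGi i : measurable_fun setT (fun x => G (iter i T x)).
  exact: measurableT_comp mG (@measurable_iter_shift R i).
have c0 m : 0 <= 9 + 3 * log2 m%:R :> R by have := @log2_nat_ge0 R m; lra.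
apply: (join_entropy_le inv g0 (q := renewal (@piece_weight R))
  (F := fun m x => \sum_(i < m) G (iter i T x) + (9 + 3 * log2 m%:R))) => //.
- move=> w; have [x <-] := @window_surj R 0 (size w) w erefl.
  by have [] := variational_code (size w) x.
- move=> m; apply: renewal_mass; first exact: piece_weight_ge0.
  exact: piece_weight_mass.
- by move=> m; apply: measurable_funD => //; exact: measurable_sum.
- by move=> m x; have [] := variational_code m x.
- move=> d d0; have [N hN] := log2_sublinear d0; exists N => m Nm.
  under eq_integral => x _ do rewrite EFinD -sumEFin.
  rewrite ge0_integralD//; first last.
  + by move=> x _; rewrite lee_fin.
  + by apply: emeasurable_sum => i; exact/measurable_EFinP.
  + by move=> x _; apply: sume_ge0 => i _; rewrite lee_fin.
  rewrite ge0_integral_sum//; first last.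
  + by move=> i x _; rewrite lee_fin.
  + by move=> i; exact/measurable_EFinP.
  under eq_bigr => i _.
    rewrite (integral_iter inv i (f := fun x => (G x)%:E))//; last first.
      exact/measurable_EFinP.
    rewrite Ig; over.
  rewrite integral_constant sumEFin sumr_const card_ord.
  by rewrite -EFinD lee_fin -[_ *+ m]mulr_natl mulrDr lerD2l hN.
Qed.

End variational.

(** * The potential *)
Section bigmax.
Variables (R : realType) (I : eqType) (F : I -> R) (i0 : I).

Lemma bigmax_attained (s : seq I) :
  exists2 i, i \in i0 :: s & \big[Num.max/F i0]_(i <- s) F i = F i.
Proof.
elim: s => [|j s [i is_ IH]]; first by exists i0; rewrite ?inE ?big_nil.
rewrite big_cons IH; case: (leP (F j) (F i)) => _.
  by exists i => //; move: is_; rewrite !inE => /orP[]->; rewrite ?orbT.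
by exists j => //; rewrite !inE eqxx orbT.
Qed.

End bigmax.

Section depth_cost.
Variable R : realType.
Local Notation X := (full_shift R).

Definition depth_cost (n : nat) (x : X) : R :=
  if x \in X_ n then 0 else radius_cost R (shadow_radius n x).

Lemma depth_cost_ge0 n x : 0 <= depth_cost n x.
Proof. by rewrite /depth_cost; case: ifP => // _; exact: radius_cost_ge0. Qed.

Lemma depth_cost_le10 n x : (0 < n)%N -> depth_cost n x <= 10.
Proof.
move=> n0; rewrite /depth_cost; case: ifPn => [//|/negP xX].
have [j0 _] := shadow_radiusP n0 (fun h => xX (mem_set h)).
apply: le_trans (radius_cost_le R (isT : (0 < 1)%N) j0) _.
by rewrite /radius_cost log2_1; lra.
Qed.

Lemma depth_cost_eq0 n x : (0 < n)%N -> depth_cost n x = 0 -> X_ n x.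
Proof.
move=> n0; rewrite /depth_cost; case: ifPn => [/set_mem//|/negP xX].
have [j0 _] := shadow_radiusP n0 (fun h => xX (mem_set h)).
by have := radius_cost_gt0 R j0; lra.
Qed.

Lemma measurable_depth_cost n : (0 < n)%N -> measurable_fun setT (depth_cost n).
Proof.
move=> n0.
pose g (x : X) := if x \in X_ n then None else Some (shadow_radius n x).
have mg t : measurable (g @^-1` [set t]).
  case: t => [[|j]|].
  - rewrite (_ : _ @^-1` _ = set0)// -subset0 => x /=.
    rewrite /g; case: ifPn => // /negP xX [r0].
    by have [] := shadow_radiusP n0 (fun h => xX (mem_set h)); rewrite r0.
  - rewrite (_ : _ @^-1` _ = [set x | shadow n j x] `\` [set x | shadow n j.+1 x]).
      by apply: measurableD; exact: measurable_shadow.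
    apply/seteqP; split => x /=; rewrite /g.
      case: ifPn => // /negP xX [rE].
      by have [_ []] := shadow_radiusP n0 (fun h => xX (mem_set h)); rewrite rE.
    move=> [sj nsj]; have xX : ~ X_ n x by move=> /X_shadowP /(_ j.+1).
    rewrite memNset//; congr Some.
    have [r0 [s1 s2]] := shadow_radiusP n0 xX.
    apply/eqP; rewrite eqn_leq; apply/andP; split; rewrite leqNgt; apply/negP => h.
      by apply: nsj; apply: shadow_le s1; rewrite -ltnS prednK.
    by apply: s2; apply: shadow_le sj; rewrite -ltnS.
  - rewrite (_ : _ @^-1` _ = X_ n); first exact: X_measurable.
    by apply/seteqP; split => x /=; rewrite /g; [case: ifPn => // /set_mem|move=> /mem_set ->].
move=> _ A _; rewrite setTI.
pose h t := if t is Some j then radius_cost R j else 0.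
rewrite (_ : _ @^-1` A = g @^-1` [set t | A (h t)]).
  exact: measurable_preimage_count.
by apply/seteqP; split => x /=; rewrite /g /depth_cost /h; case: ifP.
Qed.

End depth_cost.

Section potential.
Variables (R : realType) (N : nat) (alpha : R) (beta : nat -> R) (c1 : R).
Local Notation X := (full_shift R).
Hypothesis N_gt0 : (0 < N)%N.
Hypothesis alpha_gt0 : 0 < alpha.
Hypothesis alpha_beta : alpha < beta 1%N.
Hypothesis beta_incr : forall i : nat, (1 <= i < N)%N -> beta i < beta i.+1.
Local Notation c := (@c_ R beta c1).
Local Notation phi := (@phi R N alpha beta c1).

Lemma beta_bounds i : (1 <= i <= N)%N -> alpha < beta i <= beta N.
Proof.
move=> /andP[i1 iN]; apply/andP; split.
  elim: i i1 iN => [//|[|i] IH] _ iN //.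
  by apply: lt_trans (IH _ _) (beta_incr _) => //; lia.
have : forall d, (d + i <= N)%N -> beta i <= beta (d + i)%N.
  elim=> [//|d IH] dN; apply: le_trans (IH _) _; first by lia.
  by apply/ltW/beta_incr; lia.
by move=> /(_ (N - i)%N); rewrite subnK//; apply.
Qed.

Lemma phi_E n (x : X) : phi_ alpha beta c1 n x = c n - depth_cost n x / alpha.
Proof.
rewrite /phi_ /depth_cost; congr (_ - _); case: ifP => _; first by rewrite mul0r.
by rewrite /delta_ /radius_cost invfM mulrA mulrAC.
Qed.

(** An increment of [c] is [2^-(n+1) / beta n >= 2^-(n+1) / beta N], and
    [2^-(n+1) = 2^-n - 2^-(n+1)] telescopes. *)
Lemma c_diff m n : (1 <= m <= n)%N -> (n <= N.+1)%N ->
  (2 ^+ m)^-1 - (2 ^+ n)^-1 <= beta N * (c n - c m).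
Proof.
move=> /andP[m1 mn] nN.
have /andP[bN _] : alpha < beta N <= beta N by apply: beta_bounds; rewrite N_gt0 leqnn.
have a0 := alpha_gt0.
elim: n mn nN => [|n IH]; first by lia.
rewrite leq_eqVlt => /predU1P[->|mn] nN; first by rewrite !subrr mulr0.
have cS : c n.+1 = c n + (2 ^+ n.+1 * beta n)^-1.
  by rewrite /c_ big_nat_recr/= ?addrA//; lia.
have /andP[b1 b2] : alpha < beta n <= beta N by apply: beta_bounds; lia.
have b0 : 0 < beta n := lt_trans alpha_gt0 b1.
have : (2 ^+ n.+1)^-1 <= beta N * (2 ^+ n.+1 * beta n)^-1.
  rewrite invfM mulrCA -[leLHS]mulr1 ler_wpM2l// ?invr_ge0 ?exprn_ge0//.
  by rewrite ler_pdivlMr// mul1r.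
have : (2 ^+ n)^-1 = 2 * (2 ^+ n.+1)^-1 :> R.
  by rewrite exprS invfM mulrA divff ?mul1r// pnatr_eq0.
have {}IH := IH mn (ltnW nN).
rewrite cS; move: IH; set u := (2 ^+ n)^-1; set v := (2 ^+ n.+1)^-1.
by set w := (_ * beta n)^-1; nra.
Qed.

Lemma c_mono m n : (1 <= m < n)%N -> (n <= N.+1)%N -> c m < c n.
Proof.
move=> /andP[m1 mn] nN; have := @c_diff m n; rewrite m1 (ltnW mn) => /(_ isT nN).
have : (2 ^+ n)^-1 < (2 ^+ m)^-1 :> R.
  by rewrite ltf_pV2 ?posrE ?exprn_gt0// ltr_eXn2l// ltr1n.
have /andP[bN _] : alpha < beta N <= beta N by apply: beta_bounds; rewrite N_gt0 leqnn.
have a0 := alpha_gt0.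
by set u := (2 ^+ n)^-1; set v := (2 ^+ m)^-1; nra.
Qed.

Lemma phi_attained x : exists2 n, (1 <= n <= N.+1)%N &
  phi x = c n - depth_cost n x / alpha.
Proof.
have [n + nE] := bigmax_attained (fun n => phi_ alpha beta c1 n x) 1%N (index_iota 1 N.+2).
rewrite inE mem_index_iota => nN; exists n; last by rewrite -phi_E -nE.
by move: nN => /predU1P[->|//].
Qed.

Lemma phi_ge n x : (1 <= n <= N.+1)%N -> c n - depth_cost n x / alpha <= phi x.
Proof.
move=> nN; rewrite -phi_E.
apply: (@le_bigmax_seq _ _ _ _ _ n predT (fun n => phi_ alpha beta c1 n x)) => //.
by rewrite mem_index_iota.
Qed.

Lemma measurable_phi : measurable_fun setT phi.
Proof.
have mp n : (0 < n)%N -> measurable_fun setT (@phi_ R alpha beta c1 n).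
  move=> n0; rewrite (_ : phi_ _ _ _ _ = fun x => c n - depth_cost n x / alpha).
    apply: measurable_funB => //; apply: measurable_funM => //.
    exact: measurable_depth_cost.
  by apply/funext => x; rewrite phi_E.
have : forall s : seq nat, (forall n, n \in s -> (0 < n)%N) -> measurable_fun setT
   (fun x => \big[Num.max/phi_ alpha beta c1 1 x]_(n <- s) phi_ alpha beta c1 n x).
  elim=> [|n s IH] hs.
    by under eq_fun => x do rewrite big_nil; exact: mp.
  under eq_fun => x do rewrite big_cons.
  apply: measurable_maxr; first by apply: mp; apply: hs; rewrite inE eqxx.
  by apply: IH => m ms; apply: hs; rewrite inE ms orbT.
by apply => n; rewrite mem_index_iota => /andP[].
Qed.

Definition gap (x : X) : R := c N.+1 - phi x.

Lemma measurable_gap : measurable_fun setT gap.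
Proof. by apply: measurable_funB => //; exact: measurable_phi. Qed.

Lemma gap_bounds x : 0 <= gap x <= c N.+1 - c 1%N + 10 / alpha.
Proof.
apply/andP; split; rewrite /gap.
  have [n nN ->] := phi_attained x.
  have : 0 <= depth_cost n x / alpha by rewrite divr_ge0 ?depth_cost_ge0// ltW.
  have : c n <= c N.+1.
    have [->//|nN'] := eqVneq n N.+1.
    by apply/ltW/c_mono => //; move/eqP: nN'; lia.
  by set u := _ / alpha; lra.
have := @phi_ge 1%N x isT.
have : depth_cost 1 x / alpha <= 10 / alpha.
  by rewrite ler_pM2r ?invr_gt0// depth_cost_le10.
by set u := depth_cost 1 x / _; set v := 10 / _; lra.
Qed.

Lemma gap_eq0 x : gap x = 0 <-> X_ N.+1 x.
Proof.
split => [|xX]; last first.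
  have /andP[g0 _] := gap_bounds x; apply/eqP; rewrite eq_le g0 andbT /gap.
  have := @phi_ge N.+1 x; rewrite ltnSn ltnS leq0n /= => /(_ isT).
  by rewrite /depth_cost mem_set// mul0r; lra.
rewrite /gap; have [n nN ->] := phi_attained x => h.
have d0 := depth_cost_ge0 n x.
have d1 : 0 <= depth_cost n x / alpha by rewrite divr_ge0// ltW.
have nE : n = N.+1.
  apply/eqP; apply/negPn/negP => /eqP nN'.
  have : c n < c N.+1 by apply: c_mono; lia.
  by lra.
move: h d1; rewrite nE opprB addrCA subrr addr0 => /eqP.
rewrite mulf_eq0 invr_eq0 (gt_eqF alpha_gt0) orbF => /eqP h _.
by apply: depth_cost_eq0.
Qed.

(** At a level [n] where the maximum is attained, [c_diff] compares the constants,
    and [beta N > alpha] turns [delta_] into the radius cost. *)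
Lemma gap_level x : exists2 n, (0 < n)%N &
  (X_ n x /\ (2 ^+ n)^-1 <= beta N * gap x + (2 ^+ N.+1)^-1) \/
  (~ X_ n x /\ (2 ^+ n)^-1 + radius_cost R (shadow_radius n x)
     <= beta N * gap x + (2 ^+ N.+1)^-1).
Proof.
have [n nN phiE] := phi_attained x; exists n; first by lia.
have /andP[bN _] : alpha < beta N <= beta N by apply: beta_bounds; rewrite N_gt0 leqnn.
have a0 := alpha_gt0.
have h : (2 ^+ n)^-1 + depth_cost n x <= beta N * gap x + (2 ^+ N.+1)^-1.
  have := @c_diff n N.+1 nN (leqnn _).
  rewrite /gap phiE.
  have : depth_cost n x <= beta N * (depth_cost n x / alpha).
    rewrite mulrCA ler_peMr ?depth_cost_ge0// ler_pdivlMr// mul1r; exact: ltW.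
  by set u := (2 ^+ n)^-1; set v := (2 ^+ N.+1)^-1; set w := _ / alpha; lra.
move: h; rewrite /depth_cost; case: ifPn => [/set_mem xX|/negP xX] h.
  by left; split => //; rewrite addr0 in h.
by right; split => // /mem_set.
Qed.

End potential.

(** * Unique parsing into blocks *)
Section parsing.
Variables (R : realType) (L : nat).
Hypothesis L_ge4 : (4 <= L)%N.
Local Notation X := (full_shift R).
Implicit Types x : X.

Let L_gt0 : (0 < L)%N. Proof. exact: leq_trans L_ge4. Qed.

Definition parsable : set X := [set x | forall m, exists2 a, (a < L)%N &
  exists y : nat -> bool, forall i, (i < m)%N -> x i%:Z = block_symbol L y (i + a)].

Definition blocks (y : seq bool) : seq bool := block_word L 0 y (size y * L).

Lemma size_blocks y : size (blocks y) = (size y * L)%N.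
Proof. by rewrite size_mkseq. Qed.

Lemma nth_blocks y k r : (k < size y)%N -> (r < L)%N ->
  nth false (blocks y) (k * L + r) = nth false y k (+) (r == L.-1).
Proof.
move=> ky rL; rewrite nth_mkseq; last first.
  by apply: (@leq_trans (k.+1 * L)); rewrite ?leq_pmul2r ?L_gt0// mulSnr ltn_add2l.
by rewrite addn0 /block_symbol; have [-> ->] := divn_modn_shift k rL.
Qed.

Definition starts_block (w : seq bool) (o : nat) : bool :=
  take L (drop o w) == blocks [:: nth false w o].

Lemma starts_blockP w o : (o + L <= size w)%N ->
  reflect (forall r, (r < L)%N -> nth false w (o + r) = nth false w o (+) (r == L.-1))
    (starts_block w o).
Proof.
move=> oL; have st : size (take L (drop o w)) = L.
  by rewrite size_takel// size_drop leq_subRL//; lia.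
apply: (iffP eqP) => [E r rL|h].
  have := @nth_blocks [:: nth false w o] 0 r isT rL.
  by rewrite -E mul0n add0n nth_take// nth_drop.
apply: (@eq_from_nth _ false); first by rewrite st size_blocks mul1n.
move=> r; rewrite st => rL; rewrite nth_take// nth_drop h//.
by have := @nth_blocks [:: nth false w o] 0 r isT rL; rewrite mul0n add0n => ->.
Qed.

(** A block occurs in a concatenation of blocks only where the concatenation
    has a block. At any other phase [r0], the occurrence meets the last symbol
    of one block, which differs from its neighbours unless [r0 = L - 1]; and
    then the next block starts with both values. *)
Lemma starts_block_sync w (a : nat) (y : nat -> bool) o : (o + L <= size w)%N ->
  (forall i, (i < size w)%N -> nth false w i = block_symbol L y (i + a)) ->
  starts_block w o = ((o + a) %% L == 0)%N.
Proof.
move=> oL wy; have L4 := L_ge4.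
have E := divn_eq (o + a) L; have rL : ((o + a) %% L < L)%N by rewrite ltn_mod; lia.
have val q u r : (r < L)%N -> (u < size w)%N -> (u + a = q * L + r)%N ->
    nth false w u = y q (+) (r == L.-1).
  move=> rL' uw uE; rewrite wy// uE /block_symbol.
  by have [-> ->] := divn_modn_shift q rL'.
move: E rL; set q := (_ %/ _)%N; set r0 := (_ %% _)%N => E rL.
apply/starts_blockP/eqP => // [h|r00 r rL'].
  apply/eqP; apply/negPn/negP => r0n.
  have [rE|rE] := eqVneq r0 L.-1.
  - have h1 : nth false w (o + 1) = y q.+1.
      rewrite (val q.+1 (o + 1)%N 0%N); [|lia|lia|by rewrite mulSn; lia].
      by rewrite (_ : (_ == _) = false) ?addbF//; apply/eqP; lia.
    have h2 : nth false w (o + L.-1) = y q.+1.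
      rewrite (val q.+1 (o + L.-1)%N L.-2); [|lia|lia|by rewrite mulSn; lia].
      by rewrite (_ : (_ == _) = false) ?addbF//; apply/eqP; lia.
    move: h1 h2; rewrite !h; [|lia|lia]; rewrite eqxx.
    rewrite (_ : (1 == L.-1)%N = false); last by apply/eqP; lia.
    by rewrite addbF => ->; case: (y _).
  - have r0L : (r0 < L.-1)%N by move/eqP: rE; lia.
    have h1 : nth false w (o + (L.-1 - r0)) = ~~ y q.
      rewrite (val q (o + (L.-1 - r0))%N L.-1); [|lia|lia|lia].
      by rewrite eqxx addbT.
    have h2 : nth false w (o + (L.-2 - r0)) = y q.
      rewrite (val q (o + (L.-2 - r0))%N L.-2); [|lia|lia|lia].
      by rewrite (_ : (_ == _) = false) ?addbF//; apply/eqP; lia.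
    move: h1 h2; rewrite !h; [|lia|lia].
    have -> : (L.-1 - r0 == L.-1)%N = false by apply/eqP; lia.
    have -> : (L.-2 - r0 == L.-1)%N = false by apply/eqP; lia.
    by move=> ->; case: (y q).
rewrite (val q (o + r)%N r)//; [|lia|lia].
rewrite (val q o 0%N)//; [|lia|lia].
by rewrite (_ : (0 == L.-1)%N = false) ?addbF//; apply/eqP; lia.
Qed.

(** The value is [L] if no block starts at a position less than [L]. *)
Definition offset (w : seq bool) : nat := find (starts_block w) (iota 0 L).

Definition bits (l : nat) (w : seq bool) : seq bool :=
  mkseq (fun k => nth false w (offset w + k * L)) l.

Lemma window_blocks x m : parsable x -> exists2 a, (a < L)%N &
  exists y : nat -> bool, forall i, (i < size (window 0 m x))%N ->
    nth false (window 0 m x) i = block_symbol L y (i + a).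
Proof.
move=> /(_ m)[a aL [y xy]]; exists a => //; exists y => i; rewrite size_mkseq => im.
by rewrite nth_mkseq// add0r xy.
Qed.

(** By [starts_block_sync] all the blocks of a point have the same phase. *)
Lemma offsetP x m : parsable x -> (2 * L <= m)%N ->
  let w := window 0 m x in
  (offset w < L)%N /\
  (forall o k, (o < L)%N -> (o + k * L + L <= m)%N ->
    starts_block w (o + k * L) = (o == offset w)).
Proof.
move=> xX Lm w; have L4 := L_ge4.
have [a aL [y wy]] := window_blocks m xX.
have sw : size w = m by rewrite size_mkseq.
have sync o : (o + L <= m)%N -> starts_block w o = ((o + a) %% L == 0)%N.
  by move=> om; apply: (starts_block_sync (y := y)) wy; rewrite sw.
have sync' o k : (o < L)%N -> (o + k * L + L <= m)%N ->
    starts_block w (o + k * L) = (o == (L - a) %% L)%N.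
  move=> oL om; rewrite sync// addnAC addnC modnMDl.
  have [a0|a0] := posnP a; first by rewrite a0 addn0 subn0 modnn modn_small.
  rewrite (@modn_small (L - a)); last by lia.
  have [oa|oa] := ltnP (o + a) L.
    by rewrite modn_small//; apply/eqP/eqP; lia.
  have -> : (o + a = 1 * L + (o + a - L))%N by lia.
  by rewrite modnMDl modn_small; [apply/eqP/eqP; lia|lia].
have oE : offset w = ((L - a) %% L)%N.
  have aL' : ((L - a) %% L < L)%N by rewrite ltn_mod; lia.
  have hasb : has (starts_block w) (iota 0 L).
    apply/hasP; exists ((L - a) %% L)%N; first by rewrite mem_iota add0n.
    by have := @sync' ((L - a) %% L)%N 0%N aL'; rewrite mul0n addn0 eqxx => ->//; lia.
  have fL := hasb; rewrite has_find size_iota in fL.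
  have := nth_find 0%N hasb; rewrite nth_iota// add0n.
  have := @sync' (offset w) 0%N fL; rewrite mul0n addn0 => ->; last by rewrite /offset; lia.
  by move=> /eqP.
split; first by rewrite oE ltn_mod; lia.
by move=> o k oL om; rewrite sync'// oE.
Qed.

Definition block_cylinder (s : nat) (y : seq bool) : set X :=
  [set x | window s%:Z (size y * L) x = blocks y].

Lemma measurable_block_cylinder s y : measurable (block_cylinder s y).
Proof. exact: (@measurable_window_fiber R s%:Z _ [set blocks y]). Qed.

Lemma block_cylinderP x m l o y : parsable x -> (2 * L <= m)%N -> size y = l ->
  (o < L)%N -> (0 < l)%N -> (o + l * L <= m)%N ->
  block_cylinder o y x <->
  offset (window 0 m x) = o /\ bits l (window 0 m x) = y.
Proof.
move=> xX Lm sy oL l0 om; have L4 := L_ge4.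
set w := window 0 m x.
have [ofL ofP] := offsetP xX Lm; rewrite -/w in ofL ofP.
have sw : size w = m by rewrite size_mkseq.
have nthw i : (i < l * L)%N -> nth false (window o%:Z (l * L) x) i = nth false w (o + i).
  by move=> il; rewrite !nth_mkseq; [congr x; lia|lia|lia].
have stP k : (k < l)%N -> (o + k * L + L <= size w)%N.
  move=> kl; rewrite sw; apply: leq_trans om; rewrite -addnA leq_add2l -mulSnr.
  by rewrite leq_pmul2r// L_gt0.
split => [h|[oE bE]].
- have hn k r : (k < l)%N -> (r < L)%N ->
      nth false w (o + (k * L + r)) = nth false y k (+) (r == L.-1).
    move=> kl rL; rewrite -nthw; last first.
      by apply: (@leq_trans (k.+1 * L)); rewrite ?leq_pmul2r ?L_gt0// mulSnr ltn_add2l.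
    by move: h; rewrite /block_cylinder /= sy => ->; rewrite nth_blocks ?sy.
  have h0 k : (k < l)%N -> nth false w (o + k * L) = nth false y k.
    move=> kl; have := hn k 0%N kl; rewrite addn0 => ->; last by lia.
    by rewrite (_ : (0 == L.-1)%N = false) ?addbF//; apply/eqP; lia.
  have oE : offset w = o.
    apply/esym/eqP; rewrite -(ofP o 0%N)//; last by have := stP 0%N l0; rewrite sw.
    apply/starts_blockP => [|r rL]; first exact: stP.
    by rewrite (h0 0%N)// -(hn 0%N r)// mul0n addn0 add0n.
  split => //; apply: (@eq_from_nth _ false); rewrite size_mkseq ?sy// => k kl.
  by rewrite nth_mkseq// oE h0.
- rewrite /block_cylinder /= sy; apply: (@eq_from_nth _ false).
    by rewrite size_mkseq size_blocks sy.
  rewrite size_mkseq => i il; rewrite nthw//.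
  have E := divn_eq i L; have rL : (i %% L < L)%N by rewrite ltn_mod; lia.
  have kl : (i %/ L < l)%N by rewrite ltn_divLR//; lia.
  have -> : nth false (blocks y) i = nth false y (i %/ L) (+) (i %% L == L.-1)%N.
    by rewrite {1}E nth_blocks// sy.
  have -> : nth false y (i %/ L) = nth false w (o + i %/ L * L).
    by rewrite -bE /bits nth_mkseq// oE.
  rewrite {1}E addnA.
  have /starts_blockP h : starts_block w (o + i %/ L * L).
    by rewrite ofP// ?oE//; have := stP _ kl; rewrite sw.
  by rewrite h//; exact: stP.
Qed.

End parsing.

(** * Integrals of nonnegative functions *)
Section has_integral.
Context d (T : measurableType d) (R : realType) (P : probability T R).

Definition has_integral (h : T -> R) (c : R) : Prop :=
  [/\ measurable_fun setT h, forall x, 0 <= h x & (\int[P]_x (h x)%:E = c%:E)%E].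

Lemma has_integral_cst r : 0 <= r -> has_integral (fun=> r) r.
Proof. by split => //; exact: integral_constant. Qed.

Lemma has_integralZ r f a : 0 <= r -> has_integral f a ->
  has_integral (fun x => r * f x) (r * a).
Proof.
move=> r0 [mf f0 If]; split; first exact: measurable_funM.
  by move=> x; rewrite mulr_ge0.
under eq_integral => x _ do rewrite EFinM.
rewrite ge0_integralZl_EFin//; first by rewrite If.
  by move=> x _; rewrite lee_fin.
exact/measurable_EFinP.
Qed.

Lemma has_integral_indic r A : 0 <= r -> measurable A ->
  has_integral (fun x => \1_A x * r) (pr P A * r).
Proof.
move=> r0 mA; split.
- by apply: measurable_funM => //; exact: measurable_indic.
- by move=> x; rewrite mulr_ge0// indicE.
under eq_integral => x _ do rewrite mulrC EFinM.
rewrite ge0_integralZl_EFin//; first by rewrite integral_indic// setIT EFinM muleC -prE.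
by apply/measurable_EFinP; exact: measurable_indic.
Qed.

Lemma has_integralD f g a b : has_integral f a -> has_integral g b ->
  has_integral (fun x => f x + g x) (a + b).
Proof.
move=> [mf f0 If] [mg g0 Ig]; split.
- exact: measurable_funD.
- by move=> x; rewrite addr_ge0.
under eq_integral => x _ do rewrite EFinD.
rewrite ge0_integralD ?If ?Ig//; try by move=> x _; rewrite lee_fin.
all: exact/measurable_EFinP.
Qed.

Lemma has_integral_sum (I : Type) (s : seq I) (h : I -> T -> R) (c : I -> R) :
  (forall i, has_integral (h i) (c i)) ->
  has_integral (fun x => \sum_(i <- s) h i x) (\sum_(i <- s) c i).
Proof.
move=> hc; elim: s => [|i s IH].
  rewrite big_nil (_ : (fun _ => _) = fun=> 0); first exact: has_integral_cst.
  by apply/funext => x; rewrite big_nil.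
rewrite big_cons (_ : (fun _ => _) = fun x => h i x + \sum_(j <- s) h j x).
  exact: has_integralD.
by apply/funext => x; rewrite big_cons.
Qed.

End has_integral.

(** * A code for words of blocks *)
Lemma sum_delta_le1 (R : realType) (I : eqType) (s : seq I) c : uniq s ->
  \sum_(k <- s) (k == c)%:R <= 1 :> R.
Proof.
move=> us; have [cs|cs] := boolP (c \in s).
  by rewrite (bigD1_seq c)//= eqxx big1 ?addr0// => k /negbTE ->.
rewrite big_seq big1// => k ks; rewrite (_ : (k == c) = false)//.
by apply/negbTE; apply: contra cs => /eqP <-.
Qed.

Section block_code.
Variables (R : realType) (L l : nat) (pi : seq bool -> R) (d : R).
Hypothesis L_ge4 : (4 <= L)%N.
Hypothesis l_gt0 : (0 < l)%N.
Hypothesis pi_ge0 : forall y, 0 <= pi y.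
Hypothesis pi_mass : \sum_(y <- words l) pi y <= 1.
Hypothesis d_gt0 : 0 < d.
Hypothesis d_lt1 : d < 1.
Local Notation D := (l * L)%N.

(** The law [pi] of the words of [l] blocks, mixed with the uniform law so that
    no word has probability zero. *)
Definition mixed (y : seq bool) : R := (1 - d) * pi y + d / 2 ^+ l.

(** A piece is either a single symbol, dear but seldom used, or a group of [l]
    blocks. *)
Definition block_kappa (u : seq bool) : R :=
  if size u == 1%N then d / 2 else
  if size u == D then
    (1 - d) * \sum_(y <- words l) (u == blocks L y)%:R * mixed y
  else 0.

Definition block_length (y : seq bool) : R := - log2 ((1 - d) * mixed y).

Definition single_length : R := - log2 (d / 2).

Let d0 := d_gt0. Let d1 := d_lt1.

Lemma D_gt1 : (1 < D)%N.
Proof. by apply: leq_trans (leq_pmull _ l_gt0); exact: leq_trans L_ge4. Qed.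

Lemma mixed_gt0 y : 0 < mixed y.
Proof.
have h1 : 0 < d / 2 ^+ l by rewrite divr_gt0// exprn_gt0.
have h2 : 0 <= (1 - d) * pi y by rewrite mulr_ge0// subr_ge0 ltW.
by rewrite /mixed; lra.
Qed.

Lemma mixed_mass : \sum_(y <- words l) mixed y <= 1.
Proof.
rewrite big_split /= -mulr_sumr big_const_seq count_predT size_words iter_addr_0.
have -> : (d / 2 ^+ l) *+ 2 ^ l = d.
  by rewrite -[LHS]mulr_natr natrX divfK// expf_neq0// pnatr_eq0.
move: pi_mass d0 d1; set p := \sum_(y <- _) _ => p1 h0 h1.
have h2 : (1 - d) * p <= 1 - d by rewrite ler_piMr// subr_ge0 ltW.
by lra.
Qed.

Lemma mixed_le1 y : y \in words l -> mixed y <= 1.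
Proof.
move=> yl; apply: le_trans mixed_mass; rewrite (bigD1_seq y) ?words_uniq//= lerDl.
by apply: sumr_ge0 => z _; exact: ltW (mixed_gt0 z).
Qed.

Lemma block_kappa_ge0 u : 0 <= block_kappa u.
Proof.
rewrite /block_kappa; case: ifP => _; first by rewrite divr_ge0// ltW.
case: ifP => // _; rewrite mulr_ge0 ?subr_ge0 ?(ltW d1)//.
by apply: sumr_ge0 => y _; rewrite mulr_ge0// ltW// mixed_gt0.
Qed.

Lemma block_kappa_mass M :
  \sum_(1 <= k < M.+1) \sum_(u <- words k) block_kappa u <= 1.
Proof.
have step k : \sum_(u <- words k) block_kappa u <=
    d * (k == 1%N)%:R + (1 - d) * (k == D)%:R.
  rewrite big_seq (eq_bigr (fun u => if k == 1%N then d / 2 else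
    if k == D then (1 - d) * \sum_(y <- words l) (u == blocks L y)%:R * mixed y
    else 0)); last by move=> u; rewrite mem_words /block_kappa => /eqP ->.
  rewrite -big_seq; have D1 := D_gt1.
  have [->|k1] := eqVneq k 1%N.
    rewrite (_ : (1%N == D) = false); last by apply/eqP; move: D1; case: D => // -[].
    by rewrite mulr1 mulr0 addr0 /= !big_cons big_nil addr0; lra.
  have [kD|kD] := eqVneq k D; last by rewrite big1// !mulr0 addr0.
  rewrite mulr0 add0r mulr1 -mulr_sumr ler_piMr ?subr_ge0 ?(ltW d1)//.
  apply: le_trans mixed_mass; rewrite exchange_big /= big_seq [leRHS]big_seq.
  apply: ler_sum => y; rewrite mem_words => /eqP sy.
  by rewrite -mulr_suml sum_words_delta ?mul1r// size_mkseq sy kD.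
apply: le_trans (ler_sum _ (fun k _ => step k)) _.
rewrite big_split /= -!mulr_sumr.
have h1 := @sum_delta_le1 R _ (index_iota 1 M.+1) 1%N (iota_uniq _ _).
have h2 := @sum_delta_le1 R _ (index_iota 1 M.+1) D (iota_uniq _ _).
move: h1 h2 d0 d1; set a := \sum_(_ <- _) _; set b := \sum_(_ <- _) _ => *.
have h3 : d * a <= d by rewrite ler_piMr// ltW.
have h4 : (1 - d) * b <= 1 - d by rewrite ler_piMr// subr_ge0 ltW.
by lra.
Qed.

Local Notation q := (renewal block_kappa).

Lemma block_code_single u v : (d / 2) ^+ size u * q v <= q (u ++ v).
Proof.
elim: u => [|b u IH]; first by rewrite expr0 mul1r.
rewrite cat_cons -cat1s; apply: le_trans _ (renewal_cat block_kappa_ge0 (u := [:: b]) (u ++ v) isT).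
by rewrite /= exprS -mulrA /block_kappa /= ler_wpM2l// divr_ge0// ltW.
Qed.

Lemma block_code_gt0 w : 0 < q w.
Proof.
have := block_code_single w [::]; rewrite cats0 renewal_nil mulr1.
by apply: lt_le_trans; rewrite exprn_gt0// divr_gt0.
Qed.

Lemma single_length_ge0 : 0 <= single_length.
Proof. by apply: log2N_ge0; move: d0 d1 => *; lra. Qed.

Lemma block_length_ge0 y : y \in words l -> 0 <= block_length y.
Proof.
move=> yl; apply: log2N_ge0; have := mixed_le1 yl; have := mixed_gt0 y.
by move: d0 d1; nra.
Qed.

Lemma block_code_length_single u v :
  - log2 (q (u ++ v)) <= (size u)%:R * single_length - log2 (q v).
Proof.
have dp : 0 < d / 2 by rewrite divr_gt0.
have : log2 ((d / 2) ^+ size u * q v) <= log2 (q (u ++ v)).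
  by rewrite le_log2 ?block_code_single// mulr_gt0 ?exprn_gt0// block_code_gt0.
rewrite log2M ?exprn_gt0 ?block_code_gt0// log2X// /single_length.
by set a := log2 (d / 2); lra.
Qed.

Lemma block_code_length_blocks y v : y \in words l ->
  - log2 (q (blocks L y ++ v)) <= block_length y - log2 (q v).
Proof.
move=> yl; have sy : size (blocks L y) = D.
  by rewrite size_mkseq; move: yl; rewrite mem_words => /eqP ->.
have D1 := D_gt1.
have ky : (1 - d) * mixed y <= block_kappa (blocks L y).
  rewrite /block_kappa sy (_ : (D == 1%N) = false); last first.
    by apply/eqP; move: D1; case: D => // -[].
  rewrite eqxx ler_wpM2l ?subr_ge0 ?(ltW d1)//.
  rewrite (bigD1_seq y) ?words_uniq//= eqxx mul1r lerDl.
  by apply: sumr_ge0 => z _; rewrite mulr_ge0// ltW// mixed_gt0.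
have m0 : 0 < (1 - d) * mixed y by rewrite mulr_gt0 ?mixed_gt0// subr_gt0.
have : log2 ((1 - d) * mixed y * q v) <= log2 (q (blocks L y ++ v)).
  have qv := block_code_gt0 v; rewrite le_log2 ?(mulr_gt0 m0 qv)//.
  have sb : (0 < size (blocks L y))%N by rewrite sy ltnW.
  apply: le_trans _ (renewal_cat block_kappa_ge0 v sb).
  by rewrite ler_wpM2r// ltW// block_code_gt0.
rewrite log2M// ?block_code_gt0// /block_length.
by set a := log2 (_ * _); lra.
Qed.

End block_code.

(** * The law of the blocks *)
Section strict_gibbs.
Variable R : realType.

(** The equality case of [ln t <= t - 1]. *)
Lemma gibbs_term_eq (a q : R) : 0 <= a -> 0 < q ->
  (q - a) / ln 2 <= a * log2 q - a * log2 a -> a = q.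
Proof.
rewrite le_eqVlt => /predU1P[<- q0|a0 q0].
  rewrite !mul0r !subr0 pmulr_lle0 ?invr_gt0 ?ln2_gt0// => h.
  by move: q0; rewrite ltNge h.
have -> : a * log2 q - a * log2 a = a * ln (q / a) / ln 2.
  by rewrite ln_div ?posrE// /log2; lra.
rewrite ler_pM2r ?invr_gt0 ?ln2_gt0// => h.
apply/eqP; apply/negPn/negP => aq.
have qa0 : 0 < q / a by rewrite divr_gt0.
have lnqa : q / a - 1 <= ln (q / a).
  by rewrite -(ler_pM2l a0) mulrBr mulr1 mulrC divfK ?gt_eqF.
have l0 : ln (q / a) != 0.
  rewrite ln_eq0//; apply: contra aq => /eqP E.
  by rewrite -[q](divfK (lt0r_neq0 a0)) E mul1r.
by have := expR_gt1Dx l0; rewrite lnK ?posrE//; lra.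
Qed.

(** The terms of the Gibbs inequality against the uniform law are nonnegative. If
    their sum is at most zero, each of them is an equality case. *)
Lemma max_entropy_uniform (I : choiceType) (s : seq I) (a : I -> R) (l : nat) :
  size s = (2 ^ l)%N -> (forall i, 0 <= a i) -> \sum_(i <- s) a i = 1 ->
  l%:R <= - \sum_(i <- s) a i * log2 (a i) ->
  forall i, i \in s -> a i = 2 ^- l.
Proof.
move=> ss a0 a1 la i is_; have q0 : 0 < 2 ^- l :> R by rewrite invr_gt0 exprn_gt0.
pose f i := (2 ^- l - a i) / ln 2 - (a i * log2 (2 ^- l) - a i * log2 (a i)).
have f0 j : 0 <= f j by rewrite subr_ge0 gibbs_term.
have sf : \sum_(j <- s) f j <= 0.
  rewrite sumrB -mulr_suml sumrB a1 big_const_seq count_predT ss iter_addr_0.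
  rewrite (_ : 2 ^- l *+ 2 ^ l = 1); last first.
    by rewrite -[LHS]mulr_natr natrX mulVf// expf_neq0// pnatr_eq0.
  rewrite subrr mul0r sub0r oppr_le0 sumrB -mulr_suml a1 mul1r.
  rewrite log2V ?exprn_gt0// log2_2X.
  by move: la; set S := \sum_(_ <- _) _; lra.
have fi : f i = 0.
  apply/eqP; rewrite eq_le f0 andbT; apply: le_trans sf.
  rewrite (perm_big _ (perm_to_rem is_)) big_cons lerDl.
  by apply: sumr_ge0 => j _.
by apply: gibbs_term_eq => //; move: fi; rewrite /f; lra.
Qed.

End strict_gibbs.

Section uniqueness.
Variables (R : realType) (L : nat) (nu : probability (full_shift R) R).
Variable Y : set (full_shift R).
Local Notation X := (full_shift R).
Local Notation T := (@shift_map R).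
Hypothesis L_ge4 : (4 <= L)%N.
Hypothesis mY : measurable Y.
Hypothesis Y_parsable : Y `<=` @parsable R L.
Hypothesis nu_inv : invariant_measure T nu.
Hypothesis nuY : nu Y = 1%E.

Lemma prC_Y : pr nu (~` Y) = 0.
Proof. by rewrite /pr probability_setC// nuY subee. Qed.

Lemma pr_ae (A B : set X) : measurable A -> measurable B ->
  (forall x, Y x -> A x <-> B x) -> pr nu A = pr nu B.
Proof.
suff h (A' B' : set X) : measurable A' -> measurable B' ->
    (forall x, Y x -> A' x -> B' x) -> pr nu A' <= pr nu B'.
  move=> mA mB AB; apply/eqP; rewrite eq_le; apply/andP; split; apply: h => // x Yx;
  by have [] := AB x Yx.
move=> mA mB AB; apply: (@le_trans _ _ (pr nu (B' `|` ~` Y))).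
  apply: pr_le => //; first by apply: measurableU => //; exact: measurableC.
  by move=> x Ax; have [Yx|Yx] := pselect (Y x); [left; exact: AB|right].
apply: le_trans (pr_setU _ _ _) _ => //; first exact: measurableC.
by rewrite prC_Y addr0.
Qed.

Lemma pr_block_cylinder s y :
  pr nu (block_cylinder L s y) = pr nu (block_cylinder L 0 y).
Proof.
rewrite -(pr_iter nu_inv s (measurable_block_cylinder L 0 y)); congr (pr nu _).
apply/seteqP; split => x; rewrite /block_cylinder /=.
  by rewrite window_iter add0r.
by rewrite window_iter add0r.
Qed.

(** The phase [L] is the default value of [offset], which is not taken on [Y]. *)
Definition phase_words l := [seq (o, y) | o <- iota 0 L.+1, y <- words l].

(** On [Y] there is exactly one phase, so that [A] is, up to a null set, a
    disjoint union of block cylinders; by invariance their probabilities do not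
    depend on the phase. *)
Lemma block_sum m l (S : pred (nat * seq bool)) (A : set X) : measurable A ->
  (0 < l)%N -> (2 * L <= m)%N -> (L + l * L <= m)%N ->
  (forall x, Y x -> A x <->
     S (offset L (window 0 m x), bits L l (window 0 m x))) ->
  pr nu A = \sum_(v <- phase_words l | S v && (v.1 < L)%N)
    pr nu (block_cylinder L 0 v.2).
Proof.
move=> mA l0 Lm lm AS.
pose g (x : X) := (offset L (window 0 m x), bits L l (window 0 m x)).
have mg v : measurable (g @^-1` [set v]).
  exact: (@measurable_window_fiber R 0 m
    [set w | (offset L w, bits L l w) = v]).
have us : uniq (phase_words l).
  apply: allpairs_uniq; rewrite ?iota_uniq ?words_uniq//.
  by move=> [? ?] [? ?] _ _ /= [-> ->].
have gs x : g x \in phase_words l.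
  apply/allpairsP; exists (g x); rewrite mem_words size_mkseq eqxx.
  split => //; rewrite mem_iota /= add0n ltnS /offset.
  by apply: leq_trans (find_size _ _) _; rewrite size_iota.
rewrite (@pr_ae A [set x | S (g x) && ((g x).1 < L)%N])//.
- rewrite -(sum_pr_fibers nu (fun v => S v && (v.1 < L)%N) us gs mg).
  rewrite big_seq_cond [RHS]big_seq_cond; apply: eq_bigr => -[t y].
  case/andP => /allpairsP[[u v] /= [u_s v_s E]] /andP[_].
  case: E => -> -> uL.
  rewrite -(pr_block_cylinder u); apply: pr_ae => //.
    exact: measurable_block_cylinder.
  move=> x Yx; rewrite mem_words in v_s.
  have := @block_cylinderP R L L_ge4 x m l u v (Y_parsable Yx) Lm (eqP v_s) uL l0.
  move=> /(_ ltac:(lia)) [h1 h2]; split.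
    by rewrite /g /= => -[hx hy]; apply: h2; rewrite hx hy.
  by move=> /h1[hx hy]; rewrite /g /= hx hy.
- exact: (@measurable_window_fiber R 0 m
    [set w | S (offset L w, bits L l w) && (offset L w < L)%N]).
- move=> x Yx; have [oL _] := offsetP L_ge4 (Y_parsable Yx) Lm.
  by rewrite /= /g /= oL andbT; exact: AS.
Qed.

(** The factor [L] conditions on the event that a block starts at the origin,
    whose probability is [1 / L]. *)
Definition block_law (y : seq bool) : R := L%:R * pr nu (block_cylinder L 0 y).

Lemma sum_phase_words l (f : seq bool -> R) :
  \sum_(v <- phase_words l | (v.1 < L)%N) f v.2 = L%:R * \sum_(y <- words l) f y.
Proof.
rewrite /phase_words -addn1 iotaD big_mkcond big_allpairs_dep big_cat /=.
rewrite big_seq1 add0n ltnn.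
rewrite [X in _ + X]big1 ?addr0//.
rewrite (eq_big_seq (fun=> \sum_(y <- words l) f y)); last first.
  by move=> o; rewrite mem_iota add0n => /andP[_ ->].
by rewrite big_const_seq count_predT size_iota iter_addr_0 mulr_natl.
Qed.

Lemma block_law_ge0 y : 0 <= block_law y.
Proof. by rewrite mulr_ge0// pr_ge0. Qed.

Lemma block_law_mass l : (0 < l)%N -> \sum_(y <- words l) block_law y = 1.
Proof.
move=> l0; have := @block_sum (2 * L + l * L) l predT setT measurableT l0
  ltac:(lia) ltac:(lia) (fun x _ => conj (fun _ => isT) (fun _ => I)).
by rewrite pr_setT (sum_phase_words l (fun y => pr nu (block_cylinder L 0 y)))
  -mulr_sumr.
Qed.

Lemma block_cylinder_ex x m l j : Y x -> (2 * L <= m)%N ->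
  let s := (offset L (window 0 m x) + j * L)%N in (s + l * L <= m)%N ->
  exists2 y, y \in words l & block_cylinder L s y x.
Proof.
move=> Yx Lm s sm; set w := window 0 m x in s sm *.
have [oL oP] := offsetP L_ge4 (Y_parsable Yx) Lm; rewrite -/w in oL oP.
pose y := mkseq (fun k => nth false w (s + k * L)) l.
have sy : size y = l by rewrite size_mkseq.
have L0 : (0 < L)%N by exact: leq_trans L_ge4.
exists y; first by rewrite mem_words sy.
rewrite /block_cylinder /= sy; apply: (@eq_from_nth _ false).
  by rewrite size_mkseq size_blocks sy.
rewrite size_mkseq => i il.
have E := divn_eq i L; have rL : (i %% L < L)%N by rewrite ltn_mod.
have kl : (i %/ L < l)%N by rewrite ltn_divLR.
have -> : nth false (blocks L y) i = nth false y (i %/ L) (+) (i %% L == L.-1)%N.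
  by rewrite {1}E (nth_blocks L_ge4)// sy.
have -> : nth false y (i %/ L) = nth false w (s + i %/ L * L) by rewrite nth_mkseq.
have -> : nth false (window s%:Z (l * L) x) i = nth false w (s + i).
  rewrite [LHS]nth_mkseq// [RHS]nth_mkseq; first by rewrite add0r PoszD.
  by apply: leq_trans sm; rewrite ltn_add2l.
rewrite {1}E addnA.
have sk : (s + i %/ L * L + L <= size w)%N.
  rewrite size_mkseq; apply: leq_trans sm; rewrite -addnA leq_add2l -mulSnr.
  by rewrite leq_pmul2r.
have /starts_blockP h : starts_block L w (s + i %/ L * L).
  have -> : (s + i %/ L * L = offset L w + (j + i %/ L) * L)%N.
    by rewrite /s mulnDl addnA.
  by rewrite oP// mulnDl addnA; move: sk; rewrite size_mkseq.
by rewrite h.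
Qed.

End uniqueness.

(** * Entropy of measures on parsable points *)
Section block_entropy.
Variables (R : realType) (L : nat) (nu : probability (full_shift R) R).
Variable Y : set (full_shift R).
Local Notation X := (full_shift R).
Local Notation T := (@shift_map R).
Hypothesis L_ge4 : (4 <= L)%N.
Hypothesis mY : measurable Y.
Hypothesis Y_parsable : Y `<=` @parsable R L.
Hypothesis nu_inv : invariant_measure T nu.
Hypothesis nuY : nu Y = 1%E.

Section code_length.
Variables (l : nat) (d : R).
Hypothesis l_gt0 : (0 < l)%N.
Hypothesis d_gt0 : 0 < d.
Hypothesis d_lt1 : d < 1.
Local Notation D := (l * L)%N.
Local Notation law := (block_law L nu).
Local Notation cost := (block_length l law d).
Local Notation A1 := (single_length d).
Local Notation q := (renewal (block_kappa L l law d)).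

Let law_ge0 : forall y, 0 <= law y := block_law_ge0 L nu.

Let law_mass : \sum_(y <- words l) law y <= 1.
Proof. by rewrite (block_law_mass L_ge4 mY Y_parsable nu_inv nuY l_gt0). Qed.

Let A1_ge0 : 0 <= A1. Proof. exact: single_length_ge0. Qed.

Let D_gt0 : (0 < D)%N. Proof. by rewrite ltnW// (D_gt1 L_ge4). Qed.

Definition blocks_cost (s : nat) (x : X) : R :=
  \sum_(y <- words l) \1_(block_cylinder L s y) x *
    (if y \in words l then cost y else 0).

Let cost_ge0 y : 0 <= (if y \in words l then cost y else 0).
Proof. by case: ifP => // yl; exact: (block_length_ge0 law_ge0 law_mass d_gt0 d_lt1 yl). Qed.

Lemma blocks_cost_ge0 s x : 0 <= blocks_cost s x.
Proof. by apply: sumr_ge0 => y _; rewrite mulr_ge0// indicE. Qed.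

Lemma singles_length s p (x : X) : - log2 (q (window s p x)) <= p%:R * A1.
Proof.
have := block_code_length_single L l law_ge0 d_gt0 d_lt1 (window s p x) [::].
by rewrite cats0 renewal_nil log2_1 subr0 size_mkseq.
Qed.

(** Starting at a block boundary [s], groups of [l] blocks are cut off as long as
    possible, and the remaining symbols are coded one by one. *)
Lemma blocks_length m (x : X) j p : Y x -> (2 * L <= m)%N ->
  forall s : nat, s = (offset L (window 0 m x) + j * L)%N -> (s + p <= m)%N ->
  - log2 (q (window s p x)) <=
    D%:R * A1 + \sum_(k < p %/ D) blocks_cost (s + k * D) x.
Proof.
move=> Yx Lm; have [K] := ubnP p; elim: K j p => // K IH j p pK s sE pm.
have [pD|Dp] := ltnP p D.
  apply: le_trans (singles_length _ _ _) _; rewrite divn_small// big_ord0 addr0.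
  by rewrite ler_wpM2r// ler_nat ltnW.
have [p' pE] : exists p', p = (D + p')%N by exists (p - D)%N; rewrite subnKC.
have sD : (s + D <= m)%N by apply: leq_trans pm; rewrite leq_add2l.
have [y yl xy] : exists2 y, y \in words l & block_cylinder L s y x.
  by move: sD; rewrite sE; exact: (block_cylinder_ex L_ge4 Y_parsable Yx Lm).
have sy : size y = l by move: yl; rewrite mem_words => /eqP.
have wE : window s D x = blocks L y by move: xy; rewrite /block_cylinder /= sy.
rewrite pE window_cat wE.
have h1 := block_code_length_blocks L_ge4 l_gt0 law_ge0 d_gt0 d_lt1
  (window (s%:Z + D%:Z) p' x) yl.
have pK' : (p' < K)%N by move: pK D_gt0; rewrite pE; lia.
have h2 := IH (j + l)%N p' pK' (s + D)%N _ _.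
have {}h2 := h2 ltac:(by rewrite sE mulnDl addnA) ltac:(by rewrite -addnA -pE).
rewrite divnDl// divnn D_gt0 add1n big_ord_recl mul0n addn0.
have h3 : cost y <= blocks_cost s x.
  rewrite /blocks_cost (bigD1_seq y) ?words_uniq//= yl indicE mem_set// mul1r lerDl.
  by apply: sumr_ge0 => z _; rewrite mulr_ge0// indicE.
have -> : \sum_(i < p' %/ D) blocks_cost (s + lift ord0 i * D) x =
  \sum_(i < p' %/ D) blocks_cost (s + D + i * D) x.
  by apply: eq_bigr => i _; rewrite -addnA -mulSn.
move: h1 h2 h3; rewrite PoszD; set a := log2 _; set b := log2 (q _); set c := \sum_(_ < _) _.
by lra.
Qed.

(** The first term pays for the incomplete groups at both ends. Summing over all
    the phases [s], instead of selecting the phase of [x], produces [block_law]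
    upon integration. Outside [Y] all the symbols are coded one by one. *)
Definition total_cost (m : nat) (x : X) : R :=
  (2 * D)%:R * A1 + \sum_(s <- iota 0 L) \sum_(k <- iota 0 (m %/ D)) blocks_cost (s + k * D) x
  + \1_(~` Y) x * (m%:R * A1).

Lemma total_costP m x : - log2 (q (window 0 m x)) <= total_cost m x.
Proof.
have LD : (L <= D)%N by rewrite leq_pmull.
have c0 : 0 <= \sum_(s <- iota 0 L) \sum_(k <- iota 0 (m %/ D)) blocks_cost (s + k * D) x.
  by apply: sumr_ge0 => s _; apply: sumr_ge0 => k _; exact: blocks_cost_ge0.
have DA : 0 <= (2 * D)%:R * A1 by rewrite mulr_ge0.
have [Yx|nYx] := pselect (Y x); last first.
  apply: le_trans (singles_length _ _ _) _; rewrite /total_cost indicE mem_set//= mul1r.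
  by rewrite lerDr addr_ge0.
rewrite /total_cost indicE memNset//= mul0r addr0.
(* The window is enlarged to contain two blocks, which determine the phase. *)
pose M := (m + 2 * L)%N.
have LM : (2 * L <= M)%N by rewrite leq_addl.
have [oL _] := offsetP L_ge4 (Y_parsable Yx) LM.
set s := offset L (window 0 M x) in oL.
have [ms|sm] := leqP m s.
  apply: le_trans (singles_length _ _ _) _; apply: le_trans (_ : (2 * D)%:R * A1 <= _).
    by rewrite ler_wpM2r// ler_nat; move: LD oL ms; lia.
  by rewrite lerDl.
have -> : m = (s + (m - s))%N by rewrite subnKC// ltnW.
rewrite window_cat add0r.
have h1 := block_code_length_single L l law_ge0 d_gt0 d_lt1
  (window 0 s x) (window s%:Z (m - s) x).
have sM : (s + (m - s) <= M)%N by rewrite subnKC ?leq_addr// ltnW.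
have h2 := @blocks_length M x 0 (m - s) Yx LM s ltac:(by rewrite mul0n addn0) sM.
rewrite subnKC//; last exact: ltnW.
have h3 : \sum_(k < (m - s) %/ D) blocks_cost (s + k * D) x <=
    \sum_(s <- iota 0 L) \sum_(k <- iota 0 (m %/ D)) blocks_cost (s + k * D) x.
  rewrite [leRHS](bigD1_seq s) ?iota_uniq ?mem_iota//=.
  apply: (@le_trans _ _ (\sum_(k <- iota 0 (m %/ D)) blocks_cost (s + k * D) x)).
    have -> : \sum_(k < (m - s) %/ D) blocks_cost (s + k * D) x =
        \sum_(k <- iota 0 ((m - s) %/ D)) blocks_cost (s + k * D) x.
      by rewrite -[(X in iota 0 X)]subn0 -/(index_iota 0 _) big_mkord.
    have le : ((m - s) %/ D <= m %/ D)%N by rewrite leq_div2r// leq_subr.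
    rewrite -(subnKC le) iotaD big_cat /= lerDl.
    by apply: sumr_ge0 => k _; exact: blocks_cost_ge0.
  rewrite lerDl; apply: sumr_ge0 => t _; apply: sumr_ge0 => k _.
  exact: blocks_cost_ge0.
have h4 : s%:R * A1 <= D%:R * A1.
  by rewrite ler_wpM2r// ler_nat; apply: leq_trans LD; exact: ltnW.
move: h1 h2 h3 h4; rewrite size_mkseq natrM.
set a := log2 _; set b := log2 _; set u := \sum_(_ <- _) _; set v := \sum_(_ < _) _.
by lra.
Qed.

Definition block_rate : R := (\sum_(y <- words l) law y * cost y) / D%:R.

Lemma block_rate_ge0 : 0 <= block_rate.
Proof.
rewrite divr_ge0// big_seq sumr_ge0// => y yl; rewrite mulr_ge0//.
by have := cost_ge0 y; rewrite yl.
Qed.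

Lemma total_cost_integral m : exists2 c, has_integral nu (total_cost m) c &
  c <= (2 * D)%:R * A1 + m%:R * block_rate.
Proof.
pose e y := if y \in words l then cost y else 0.
have hb s : has_integral nu (blocks_cost s)
    (\sum_(y <- words l) pr nu (block_cylinder L 0 y) * e y).
  apply: has_integral_sum => y; rewrite -(pr_block_cylinder L nu_inv s).
  by apply: has_integral_indic; [exact: cost_ge0|exact: measurable_block_cylinder].
have hY : has_integral nu (fun x => \1_(~` Y) x * (m%:R * A1)) (pr nu (~` Y) * (m%:R * A1)).
  by apply: has_integral_indic; [rewrite mulr_ge0|exact: measurableC].
have hs := has_integral_sum (iota 0 L) (fun s =>
  has_integral_sum (iota 0 (m %/ D)) (fun k => hb (s + k * D)%N)).
have DA : 0 <= (2 * D)%:R * A1 by rewrite mulr_ge0.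
have h := has_integralD (has_integralD (has_integral_cst nu DA) hs) hY.
eexists; first exact: h.
rewrite (prC_Y mY nuY) mul0r addr0 lerD2l.
rewrite !big_const_seq !count_predT !size_iota !iter_addr_0.
set S := \sum_(y <- words l) _.
have SE : L%:R * S = \sum_(y <- words l) law y * cost y.
  rewrite /S mulr_sumr big_seq [RHS]big_seq; apply: eq_bigr => y yl.
  by rewrite mulrA -/(law y) /e yl.
have S0 : 0 <= S.
  by apply: sumr_ge0 => y _; rewrite mulr_ge0 ?pr_ge0//; exact: cost_ge0.
have -> : S *+ (m %/ D) *+ L = (m %/ D)%:R * (L%:R * S).
  by rewrite -[LHS]mulr_natl -[S *+ _]mulr_natl mulrCA.
rewrite SE /block_rate.
set V := \sum_(y <- words l) _; have V0 : 0 <= V by rewrite /V -SE mulr_ge0.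
rewrite mulrA mulrAC ler_wpM2r// ler_pdivlMr ?ltr0n// -natrM ler_nat.
exact: leq_trunc_div.
Qed.

Lemma block_entropy_le : (entropy T nu <= block_rate%:E)%E.
Proof.
apply: entropy_le_joins; first exact: block_rate_ge0.
move=> k p e mp e0.
have int m : measurable_fun setT (total_cost m).
  by have [c [mc _ _] _] := total_cost_integral m.
apply: (join_entropy_le nu_inv block_rate_ge0 (q := q) (F := total_cost)) => //.
- exact: (block_code_gt0 L l law_ge0 d_gt0 d_lt1).
- apply: renewal_mass; first exact: (block_kappa_ge0 L l law_ge0 d_gt0 d_lt1).
  exact: (block_kappa_mass L_ge4 l_gt0 law_mass d_gt0 d_lt1).
- exact: total_costP.
- move=> t t0; exists (Num.bound ((2 * D)%:R * A1 / t)).+1 => m hm.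
  have [c [_ _ ->] cle] := total_cost_integral m.
  rewrite lee_fin; apply: le_trans cle _; rewrite mulrDr addrC lerD2l.
  rewrite -ler_pdivrMr//; apply: (@le_trans _ _ (Num.bound ((2 * D)%:R * A1 / t))%:R).
    by apply/ltW/archi_boundP; rewrite divr_ge0 ?mulr_ge0// ltW.
  by rewrite ler_nat ltnW.
Qed.

End code_length.

End block_entropy.

(** * Uniqueness of the measure of maximal entropy *)
Section maximal_entropy.
Variables (R : realType) (L : nat).
Local Notation X := (full_shift R).
Local Notation T := (@shift_map R).
Variable Y : set X.
Hypothesis L_ge4 : (4 <= L)%N.
Hypothesis mY : measurable Y.
Hypothesis Y_parsable : Y `<=` @parsable R L.

(** As [d] tends to [0], the rate of the code tends to the entropy of the law of
    [l] blocks divided by [l * L], which is thus at least [1 / L]. *)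
Lemma max_entropy_block_law (nu : probability X R) l y :
  invariant_measure T nu -> nu Y = 1%E ->
  ((L%:R^-1)%:E <= entropy T nu)%E -> (0 < l)%N -> y \in words l ->
  block_law L nu y = 2 ^- l.
Proof.
move=> nu_inv nuY hL l0; have LR : 0 < L%:R :> R by rewrite ltr0n (leq_trans _ L_ge4).
have lR : 0 < l%:R :> R by rewrite ltr0n.
have law0 := block_law_ge0 L nu.
have law1 := block_law_mass L_ge4 mY Y_parsable nu_inv nuY l0.
apply: max_entropy_uniform => //; first exact: size_words.
apply/ler_addgt0Pr => e e0.
pose d : R := 1 - 2 `^ (- (e / 2)).
have p0 : 0 < 2 `^ (- (e / 2)) :> R by rewrite powR_gt0.
have p1 : 2 `^ (- (e / 2)) < 1 :> R.
  by rewrite ltNge; apply/negP => /log2_ge0; rewrite log2_powR; lra.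
have d0 : 0 < d by rewrite /d; lra.
have d1 : d < 1 by rewrite /d; lra.
have E1 : log2 (1 - d) = - (e / 2).
  by rewrite /d opprB addrCA subrr addr0 log2_powR.
have := le_trans hL (block_entropy_le L_ge4 mY Y_parsable nu_inv nuY l0 d0 d1).
rewrite lee_fin /block_rate ler_pdivlMr ?ltr0n ?muln_gt0 ?l0 ?(leq_trans _ L_ge4)//.
rewrite natrM mulrCA mulVf ?gt_eqF// mulr1 => h; apply: le_trans h _.
have term z : block_law L nu z * block_length l (block_law L nu) d z <=
    e * block_law L nu z - block_law L nu z * log2 (block_law L nu z).
  have := law0 z; rewrite le_eqVlt => /predU1P[<-|a0]; first by rewrite !mul0r mulr0 subr0.
  have D0 : 0 < 1 - d by lra.
  have q0 := mulr_gt0 D0 a0; have q1 := mulr_gt0 D0 q0.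
  have : log2 ((1 - d) * ((1 - d) * block_law L nu z)) <=
      log2 ((1 - d) * mixed l (block_law L nu) d z).
    rewrite le_log2// ler_pM2l// /mixed lerDl.
    by rewrite divr_ge0 ?(ltW d0)// exprn_ge0.
  rewrite log2M// log2M// E1 /block_length.
  set u := log2 (_ * mixed _ _ _ _); set v := log2 (block_law _ _ _).
  by move=> h; nra.
apply: le_trans (ler_sum _ (fun z _ => term z)) _.
by rewrite sumrB -mulr_sumr law1 mulr1 addrC.
Qed.

(** Shifted to the right by a block length, a central word is read off the blocks
    that follow the first block boundary. Hence the laws of the blocks determine
    the probabilities of the cylinders, which form a pi-system. *)
Lemma eq_measure_block_law (nu nu' : probability X R) :
  invariant_measure T nu -> nu Y = 1%E ->
  invariant_measure T nu' -> nu' Y = 1%E ->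
  (forall l y, (0 < l)%N -> y \in words l -> block_law L nu y = block_law L nu' y) ->
  forall A, measurable A -> nu A = nu' A.
Proof.
move=> inv nuY inv' nu'Y lawE.
have LR : L%:R != 0 :> R by rewrite pnatr_eq0 -lt0n (leq_trans _ L_ge4).
have prE' K (S : set (seq bool)) :
    pr nu (central K @^-1` S) = pr nu' (central K @^-1` S).
  pose l := (2 * K).+2; pose m := (2 * L + l * L)%N.
  pose A := iter (K + L) T @^-1` (central K @^-1` S).
  have mA : measurable A by apply: measurable_preimage_iter; exact: measurable_cylinder.
  rewrite -(pr_iter inv (K + L) (measurable_cylinder K S)).
  rewrite -(pr_iter inv' (K + L) (measurable_cylinder K S)) -/A.
  pose S' (v : nat * seq bool) :=
    `[< S (take (2 * K).+1 (drop (L - v.1) (blocks L v.2))) >].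
  have l0 : (0 < l)%N by [].
  have Lm : (2 * L <= m)%N by rewrite leq_addr.
  have lm : (L + l * L <= m)%N by rewrite leq_add2r leq_pmull.
  have AS x : Y x -> A x <->
      S' (offset L (window 0 m x), bits L l (window 0 m x)).
    move=> Yx; have [oL _] := offsetP L_ge4 (Y_parsable Yx) Lm.
    set w := window 0 m x in oL *; set y := bits L l w.
    have sy : size y = l by rewrite size_mkseq.
    have om : (offset L w + l * L <= m)%N.
      by apply: leq_trans lm; rewrite leq_add2r ltnW.
    have bc : block_cylinder L (offset L w) y x.
      by apply/(block_cylinderP L_ge4 (Y_parsable Yx) Lm sy oL l0 om).
    have h : ((L - offset L w) + (2 * K).+1 <= l * L)%N.
      have -> : (l * L = L + (2 * K).+1 * L)%N by rewrite /l mulSn.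
      by rewrite leq_add ?leq_subr// leq_pmulr// (leq_trans _ L_ge4).
    have -> : A x = S (window L%:Z (2 * K).+1 x).
      rewrite /A /= /central window_iter.
      by rewrite PoszD addrA addNr add0r.
    rewrite /S' /=; have -> : blocks L y = window (offset L w)%:Z (l * L) x.
      by rewrite -bc sy.
    rewrite take_drop_window// -PoszD subnKC; last exact: ltnW.
    by split => [?|/asboolP//]; apply/asboolP.
  rewrite (block_sum L_ge4 mY Y_parsable inv nuY mA l0 Lm lm AS).
  rewrite (block_sum L_ge4 mY Y_parsable inv' nu'Y mA l0 Lm lm AS).
  rewrite big_seq_cond [RHS]big_seq_cond; apply: eq_bigr => v.
  move=> /andP[/allpairsP[[t y] /= [_ yl ->]] _] /=.
  by apply: (mulfI LR); exact: (lawE _ _ l0 yl).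
apply: (measure_unique (@cylinder_sets R) (fun=> setT)) => //.
- exact: measurable_shiftE.
- exact: cylinder_sets_setI.
- by move=> _; exists 0%N, setT; rewrite preimage_setT.
- by rewrite bigcup_const.
- move=> _ [K [S ->]]; transitivity (pr nu (central K @^-1` S))%:E.
    by apply: prE; exact: measurable_cylinder.
  by rewrite prE'; apply/esym/prE; exact: measurable_cylinder.
- by move=> _; rewrite [X in (X < _)%E](_ : _ = 1%E) ?ltry//; exact: probability_setT.
Qed.

Lemma max_entropy_unique (nu nu' : probability X R) :
  invariant_measure T nu -> nu Y = 1%E -> ((L%:R^-1)%:E <= entropy T nu)%E ->
  invariant_measure T nu' -> nu' Y = 1%E -> ((L%:R^-1)%:E <= entropy T nu')%E ->
  forall A, measurable A -> nu A = nu' A.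
Proof.
move=> inv nuY h inv' nu'Y h'; apply: eq_measure_block_law => // l y l0 yl.
by rewrite !(@max_entropy_block_law _ l).
Qed.

End maximal_entropy.

Lemma X_parsable (R : realType) n : X_ n `<=` @parsable R (2 ^ n).
Proof.
move=> x /X_shadowP xX m; have [a aL [y xy]] := @shadow_lang R n m x 0 (xX m).
by exists a => //; exists y => i im; apply: xy; lia.
Qed.

(** * Fair bits *)
Lemma pushforward_probability d d' (T1 : measurableType d) (T2 : measurableType d')
    (R : realType) (P : probability T1 R) (f : T1 -> T2) :
  measurable_fun setT f ->
  exists Q : probability T2 R, forall A, Q A = P (f @^-1` A).
Proof.
move=> mf; pose mixin := isMeasurableFun.Build _ _ _ _ _ mf.
pose F : {mfun T1 >-> T2} := HB.pack f mixin.
by exists (distribution P F).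
Qed.

Section mixture.
Context d (T : measurableType d) (R : realType).
Variables (Q : nat -> probability T R) (n : nat).

Definition mixture : set T -> \bar R :=
  mscale ((n.+1%:R^-1)%:nng : {nonneg R}) (msum (fun k => Q k) n.+1).

HB.instance Definition _ := Measure.on mixture.

Lemma mixtureE A : measurable A ->
  mixture A = (n.+1%:R^-1 * \sum_(k < n.+1) pr (Q k) A)%:E.
Proof.
move=> mA; rewrite /mixture /mscale /msum /= EFinM -sumEFin; congr (_ * _)%E.
by apply: eq_bigr => k _; exact: prE.
Qed.

Let mixture_setT : mixture setT = 1%E.
Proof.
rewrite mixtureE// (eq_bigr (fun=> 1)); last by move=> k _; rewrite pr_setT.
by rewrite sumr_const card_ord mulVf// pnatr_eq0.
Qed.

HB.instance Definition _ := @Measure_isProbability.Build _ _ _ mixture mixture_setT.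

End mixture.

Section binary_digits.
Variable R : realType.

Definition uniform01 : probability _ R := uniform_prob (@ltr01 R).

Lemma uniform01_itv (a b : R) : 0 <= a -> a <= b -> b <= 1 ->
  uniform01 [set x | a <= x < b] = (b - a)%:E.
Proof.
move=> a0 ab b1; rewrite /uniform01 /= /uniform_prob.
have -> : [set x | a <= x < b] = [set` `[a, b[%R].
  by apply/seteqP; split => x /=; rewrite in_itv.
rewrite (eq_integral (cst 1%E)); last first.
  move=> x; rewrite inE /= in_itv /= => /andP[ax xb].
  rewrite /uniform_pdf (le_trans a0 ax) (le_trans (ltW xb) b1) /=.
  by rewrite subr0 invr1.
rewrite integral_cst//= mul1e lebesgue_measure_itv /= lte_fin.
case: ltP => [_|ba]; first by rewrite EFinB.
have -> : a = b by apply: le_anti; rewrite ab.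
by rewrite subrr.
Qed.

Definition binary_digit (i : nat) (u : R) : bool := odd (Num.truncn (2 ^+ i.+1 * u)).

Lemma measurable_truncn_scale (c : R) (n : nat) : 0 < c ->
  measurable [set u : R | Num.truncn (c * u) = n].
Proof.
move=> c0; rewrite (_ : [set _ | _] = if n is 0%N then [set` `]-oo, c^-1[%R]
    else [set` `[n%:R / c, n.+1%:R / c[%R]); first by case: n.
case: n => [|n]; apply/seteqP; split => u /=; rewrite in_itv/=.
- move=> h; have [cu|cu] := leP 0 (c * u).
    have := truncn_itv cu; rewrite h => /andP[_ h1].
    by rewrite -(ltr_pM2l c0) divff ?gt_eqF.
  by apply: lt_trans (_ : 0 < _); rewrite ?invr_gt0// -(pmulr_rlt0 _ c0).
- rewrite -(ltr_pM2l c0) divff ?gt_eqF// => h; apply/eqP.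
  by rewrite -leqn0 leqNgt truncn_gt_nat -ltNge.
- move=> h; have cu : 0 <= c * u.
    by apply: (@le_trans _ _ n.+1%:R) => //; rewrite -truncn_gt_nat h.
  have := truncn_itv cu; rewrite h => /andP[h1 h2].
  by rewrite ler_pdivrMr// mulrC h1 ltr_pdivlMr// mulrC h2.
- rewrite ler_pdivrMr// ltr_pdivlMr// mulrC => /andP[h1 h2].
  by apply: truncn_def; rewrite h1 h2.
Qed.

Lemma measurable_binary_digits (i : nat) : measurable [set u : R | binary_digit i u].
Proof.
have mg n : measurable ((fun u : R => Num.truncn (2 ^+ i.+1 * u)) @^-1` [set n]).
  by apply: measurable_truncn_scale; rewrite exprn_gt0.
exact: (measurable_preimage_count mg [set n | odd n]).
Qed.

(** All the first digits are digits of one integer part. *)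
Lemma binary_digit_truncn (i j : nat) (u : R) : 0 <= u ->
  binary_digit i u = odd (Num.truncn (2 ^+ (i.+1 + j) * u) %/ 2 ^ j).
Proof.
move=> u0; rewrite /binary_digit; congr odd.
have p0 k : 0 < 2 ^+ k :> R by rewrite exprn_gt0.
have v0 : 0 <= 2 ^+ (i.+1 + j) * u by rewrite mulr_ge0// ltW.
have /andP[h1 h2] := truncn_itv v0.
set t := Num.truncn (2 ^+ (i.+1 + j) * u) in h1 h2 *.
have jN : (0 < 2 ^ j)%N by rewrite expn_gt0.
apply: truncn_def; apply/andP; split.
  rewrite -(ler_pM2l (p0 j)) mulrA -exprD addnC; apply: le_trans h1.
  by rewrite -natrX -natrM ler_nat mulnC leq_trunc_div.
rewrite -(ltr_pM2l (p0 j)) mulrA -exprD addnC; apply: lt_le_trans h2 _.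
by rewrite -natrX -natrM ler_nat mulnC ltn_ceil.
Qed.

Lemma eq_nat_digits K (a b : nat) : (a < 2 ^ K)%N -> (b < 2 ^ K)%N ->
  (forall j, (j < K)%N -> odd (a %/ 2 ^ j) = odd (b %/ 2 ^ j)) -> a = b.
Proof.
elim: K a b => [|K IH] a b; first by rewrite expn0 !ltnS !leqn0 => /eqP -> /eqP ->.
move=> aK bK h; rewrite -(odd_double_half a) -(odd_double_half b).
have -> : odd a = odd b by have := h 0%N isT; rewrite expn0 !divn1.
congr (_ + _.*2)%N; apply: IH.
- by rewrite -divn2 ltn_divLR// -expnSr.
- by rewrite -divn2 ltn_divLR// -expnSr.
- by move=> j jK; have := h j.+1 jK; rewrite expnS !divnMA !divn2.
Qed.

Lemma measurable_digits_set (s : seq nat) (v : nat -> bool) :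
  measurable [set u : R | forall i, i \in s -> binary_digit i u = v i].
Proof.
rewrite (_ : [set _ | _] = \big[setI/setT]_(i <- s) [set u | binary_digit i u = v i]).
  apply: bigsetI_measurable => i _; case: (v i); first exact: measurable_binary_digits.
  rewrite (_ : [set _ | _] = ~` [set u | binary_digit i u]).
    by apply: measurableC; exact: measurable_binary_digits.
  by apply/seteqP; split => u /=; case: (binary_digit i u).
by apply/seteqP; split => u; rewrite -bigcap_seq /=.
Qed.

Definition digit_word K (u : R) : seq bool := mkseq (fun i => binary_digit i u) K.

Lemma digit_wordE K (w : seq bool) : size w = K ->
  digit_word K @^-1` [set w] =
  [set u | forall i, i \in iota 0 K -> binary_digit i u = nth false w i].
Proof.
move=> sw; apply/seteqP; split => u /=.
  by move=> <- i; rewrite mem_iota => /andP[_ iK]; rewrite nth_mkseq.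
move=> h; apply: (@eq_from_nth _ false); rewrite size_mkseq ?sw// => i iK.
by rewrite nth_mkseq// h// mem_iota.
Qed.

Lemma measurable_digit_word K w : measurable (digit_word K @^-1` [set w]).
Proof.
have [sw|sw] := eqVneq (size w) K.
  by rewrite digit_wordE//; exact: measurable_digits_set.
rewrite (_ : _ @^-1` _ = set0)// -subset0 => u /= h.
by move: sw; rewrite -h size_mkseq eqxx.
Qed.

(** The first [K] digits confine [u] to an interval of length [2^-K]; as these
    [2^K] probabilities sum to one, all of them equal [2^-K]. *)
Lemma pr_digit_word K (w : seq bool) : w \in words K ->
  pr uniform01 (digit_word K @^-1` [set w]) = 2 ^- K.
Proof.
have p0 : 0 < 2 ^+ K :> R by rewrite exprn_gt0.
have m01 : measurable [set u : R | 0 <= u < 1].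
  rewrite (_ : [set _ | _] = [set` `[0, 1[%R]); first exact: measurable_itv.
  by apply/seteqP; split => x /=; rewrite in_itv.
have le z : pr uniform01 (digit_word K @^-1` [set z]) <= 2 ^- K.
  set A := _ @^-1` _; have mA : measurable A by exact: measurable_digit_word.
  have -> : pr uniform01 A = pr uniform01 (A `&` [set u | 0 <= u < 1]).
    apply/eqP; rewrite eq_le; apply/andP; split; last first.
      by apply: pr_le => //; exact: measurableI.
    have mC : measurable (~` [set u : R | 0 <= u < 1]) by exact: measurableC.
    have mI : measurable (A `&` [set u | 0 <= u < 1]) by exact: measurableI.
    apply: (@le_trans _ _ (pr uniform01 ((A `&` [set u | 0 <= u < 1]) `|` ~` [set u | 0 <= u < 1]))).
      apply: pr_le => //; first exact: measurableU.
      by move=> u Au; have [?|?] := pselect ([set u : R | 0 <= u < 1] u); [left|right].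
    apply: le_trans (pr_setU uniform01 mI mC) _.
    rewrite [X in _ + X](_ : _ = 0) ?addr0//.
    by rewrite /pr probability_setC// uniform01_itv// subr0 subee.
  have [[u0 [Au0 u01]]|none] := pselect (exists u0, (A `&` [set u | 0 <= u < 1]) u0); last first.
    rewrite (_ : A `&` _ = set0) ?/pr ?measure0 ?invr_ge0 ?exprn_ge0//.
    by rewrite -subset0 => u Au; apply: none; exists u.
  have lt2 u : 0 <= u < 1 -> (Num.truncn (2 ^+ K * u) < 2 ^ K)%N.
    move=> /andP[h1 h2]; rewrite truncn_lt_nat ?mulr_ge0 ?(ltW p0)// natrX.
    by rewrite -[ltRHS]mulr1 ltr_pM2l.
  pose D := Num.truncn (2 ^+ K * u0).
  apply: (@le_trans _ _ (pr uniform01 [set u | D%:R / 2 ^+ K <= u < D.+1%:R / 2 ^+ K])).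
    apply: pr_le.
    - exact: measurableI.
    - rewrite (_ : [set _ | _] = [set` `[D%:R / 2 ^+ K, D.+1%:R / 2 ^+ K[%R]).
        exact: measurable_itv.
      by apply/seteqP; split => x /=; rewrite in_itv.
    - move=> u [Au u1]; have /andP[u00 _] := u1; have /andP[u000 _] := u01.
      have E : Num.truncn (2 ^+ K * u) = D.
        apply: (@eq_nat_digits K); [exact: lt2|exact: lt2|] => j jK.
        have iE : (K = (K - j.+1).+1 + j)%N by rewrite addSn -addnS subnK.
        have h x : 0 <= x -> binary_digit (K - j.+1) x = odd (Num.truncn (2 ^+ K * x) %/ 2 ^ j).
          by move=> x0; rewrite (@binary_digit_truncn _ j)// -iE.
        rewrite -!h//.
        have wd : digit_word K u = digit_word K u0 by rewrite [LHS]Au [RHS]Au0.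
        have := congr1 (fun w => nth false w (K - j.+1)) wd.
        by rewrite !nth_mkseq; lia.
      have v0 : 0 <= 2 ^+ K * u by rewrite mulr_ge0// ltW.
      have /andP[h1 h2] := truncn_itv v0; rewrite E in h1 h2.
      by rewrite /= ler_pdivrMr// ltr_pdivlMr// mulrC h1 h2.
  rewrite /pr uniform01_itv /=.
  - by rewrite -mulrBl -natr1 addrAC subrr add0r mul1r.
  - by rewrite divr_ge0// ltW.
  - by rewrite ler_pM2r ?invr_gt0// ler_nat.
  - by rewrite ler_pdivrMr// mul1r -natrX ler_nat lt2.
move=> wK; apply/eqP; rewrite eq_le le /=.
have s1 : \sum_(z <- words K) pr uniform01 (digit_word K @^-1` [set z]) = 1.
  rewrite (sum_pr_fibers _ predT) ?words_uniq//.
  - by rewrite [X in pr _ X](_ : _ = setT) ?pr_setT//; apply/seteqP.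
  - by move=> u; rewrite mem_words size_mkseq.
  - exact: measurable_digit_word.
have s2 : \sum_(z <- words K) (2 ^- K : R) = 1.
  by rewrite big_const_seq count_predT size_words iter_addr_0 -[LHS]mulr_natr natrX mulVf// gt_eqF.
move: s1; rewrite (bigD1_seq w) ?words_uniq//=.
move: s2; rewrite (bigD1_seq w) ?words_uniq//=.
have : \sum_(i <- words K | i != w) pr uniform01 (digit_word K @^-1` [set i]) <=
   \sum_(i <- words K | i != w) 2 ^- K by apply: ler_sum => z _; exact: le.
set a := \sum_(_ <- _ | _) _; set b := \sum_(_ <- _ | _) _; set c := 2 ^- K.
by lra.
Qed.

(** Starting from an initial segment of the digits, each digit that is forgotten
    doubles the probability, as the sum over its two values. *)
Lemma pr_digits (s : seq nat) (v : nat -> bool) : uniq s ->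
  pr uniform01 [set u | forall i, i \in s -> binary_digit i u = v i] = 2 ^- size s.
Proof.
move=> us; have [K [s' perm]] : exists K s', perm_eq (s' ++ s) (iota 0 K).
  pose K := (\max_(i <- s) i).+1.
  have sK i : i \in s -> (i < K)%N by move=> is_; rewrite ltnS; exact: leq_bigmax_seq.
  exists K, [seq i <- iota 0 K | i \notin s].
  apply: uniq_perm; rewrite ?iota_uniq//.
    rewrite cat_uniq filter_uniq ?iota_uniq// us andbT /=.
    apply/hasPn => i is_; apply: (_ : i \notin [seq j <- iota 0 K | j \notin s]).
    by rewrite mem_filter is_.
  move=> i; rewrite mem_cat mem_filter mem_iota add0n /=.
  by case: (boolP (i \in s)) => is_; rewrite /= ?orbF ?(sK _ is_).
elim: s' s v {us} perm => [|i s' IH] s v perm.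
  rewrite (_ : [set _ | _] = digit_word K @^-1` [set mkseq v K]).
    rewrite pr_digit_word ?mem_words ?size_mkseq//.
    by have := perm_size perm; rewrite size_iota /= => ->.
  rewrite digit_wordE ?size_mkseq//; apply/seteqP; split => u h j.
    by move=> /[dup]; rewrite {2}mem_iota -(perm_mem perm) => js jK; rewrite nth_mkseq// h.
  move=> /[dup]; rewrite {2}(perm_mem perm) => js /[dup]; rewrite {2}mem_iota => jK.
  by move=> jK'; rewrite h// nth_mkseq.
have un : uniq (i :: s' ++ s) by rewrite -cat_cons (perm_uniq perm) iota_uniq.
have nis : i \notin s.
  by move: un => /= /andP[+ _]; rewrite mem_cat negb_or => /andP[].
pose vb b j := if j == i then b else v j.
have mD b := measurable_digits_set (i :: s) (vb b).
have half b : pr uniform01 [set u | forall j, j \in i :: s -> binary_digit j u = vb b j]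
    = 2 ^- (size s).+1.
  apply: (IH (i :: s)); apply: perm_trans perm.
  by rewrite -(cat1s i s) -(cat1s i s') -catA perm_catCA.
rewrite (_ : [set _ | _] =
  [set u | forall j, j \in i :: s -> binary_digit j u = vb true j] `|`
  [set u | forall j, j \in i :: s -> binary_digit j u = vb false j]).
  have dis : [set u | forall j, j \in i :: s -> binary_digit j u = vb true j] `&`
      [set u | forall j, j \in i :: s -> binary_digit j u = vb false j] = set0.
    rewrite -subset0 => u [h1 h2]; have is_ : i \in i :: s by rewrite inE eqxx.
    by have := h1 i is_; rewrite (h2 i is_) /vb eqxx.
  have p0 : 0 < 2 ^+ size s :> R by rewrite exprn_gt0.
  have -> : 2 ^- size s = 2 ^- (size s).+1 + 2 ^- (size s).+1 :> R.
    by rewrite exprS; field; rewrite gt_eqF.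
  rewrite -{1}(half true) -(half false); apply: EFin_inj.
  rewrite EFinD -(prE uniform01 (mD true)) -(prE uniform01 (mD false)).
  rewrite -(prE uniform01 (measurableU _ _ (mD true) (mD false))).
  exact: (measureU uniform01 (mD true) (mD false) dis).
have vbE b j : j \in s -> vb b j = v j.
  by rewrite /vb; case: eqP => // -> is_; move: nis; rewrite is_.
apply/seteqP; split => u /=.
  move=> h; have g b : binary_digit i u = b -> forall j, j \in i :: s ->
      binary_digit j u = vb b j.
    move=> E j; rewrite inE => /predU1P[->|js]; first by rewrite E /vb eqxx.
    by rewrite vbE// h.
  by case E : (binary_digit i u); [left|right]; exact: g.
by move=> [] h j js; rewrite h ?vbE// inE js orbT.
Qed.

End binary_digits.

Section bernoulli.
Variable R : realType.
Local Notation X := (full_shift R).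
Local Notation T := (@shift_map R).

(** The coordinate [i] is the digit of a uniform number with index [pickle i].
    The words have the same probabilities at all positions, whence the
    invariance. *)
Lemma bernoulli_exists : exists B : probability X R,
  invariant_measure T B /\
  forall a m (w : seq bool), w \in words m -> pr B [set x | window a m x = w] = 2 ^- m.
Proof.
pose Phi (u : R) : X := fun n : int => binary_digit (pickle n) u.
have mPhi : measurable_fun setT Phi.
  by apply: measurable_fun_shift => i; exact: measurable_binary_digits.
have [B BE] := pushforward_probability (uniform01 R) mPhi.
have win a m (w : seq bool) : w \in words m -> pr B [set x | window a m x = w] = 2 ^- m.
  rewrite mem_words => /eqP sw; pose s := [seq pickle (a + i%:Z) | i <- iota 0 m].
  pose v k := if @unpickle int k is Some t then nth false w (absz (t - a)) else false.
  have us : uniq s.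
    rewrite map_inj_uniq ?iota_uniq// => i j /(pcan_inj pickleK) /addrI.
    by case.
  have := @pr_digits R s v us; rewrite size_map size_iota => <-.
  rewrite /pr BE; congr (fine (_ _)); apply/seteqP; split => u /=.
    move=> xw k /mapP[i]; rewrite mem_iota => /andP[_ im] ->.
    by rewrite /v pickleK (addrC a) addrK /= -xw nth_mkseq// addrC.
  move=> h; apply: (@eq_from_nth _ false); rewrite size_mkseq// => i im.
  have is_ : pickle (a + i%:Z) \in s by apply: map_f; rewrite mem_iota.
  have := h _ is_; rewrite /v pickleK (addrC a) addrK /= => <-.
  by rewrite nth_mkseq// (addrC a).
exists B; split => // A mA.
have mT := @measurable_iter_shift R 1.
have [B' B'E] := pushforward_probability B mT.
rewrite -[LHS](B'E A).
apply: (measure_unique (@cylinder_sets R) (fun=> setT)) => //.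
- exact: measurable_shiftE.
- exact: cylinder_sets_setI.
- by move=> _; exists 0%N, setT; rewrite preimage_setT.
- by rewrite bigcup_const.
- move=> _ [K [S ->]]; rewrite [LHS]B'E.
  have E (a : int) : B [set x | S (window a (2 * K).+1 x)] =
      (\sum_(w <- words (2 * K).+1 | `[< S w >]) 2 ^- (2 * K).+1)%:E.
    rewrite (prE B); last exact: measurable_window_fiber.
    congr EFin; transitivity (pr B [set x | `[< S (window a (2 * K).+1 x) >]]).
      by congr (pr B _); apply/seteqP; split => x /= /asboolP.
    rewrite -(sum_pr_fibers B (g := window a (2 * K).+1) (fun w => `[< S w >])
      (words_uniq (2 * K).+1)).
    + rewrite big_seq_cond [RHS]big_seq_cond; apply: eq_bigr => w /andP[wK _].
      exact: (win a).
    + by move=> x; rewrite mem_words size_mkseq.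
    + by move=> w; exact: (@measurable_window_fiber R a _ [set w]).
  apply: etrans (etrans (E (- K%:Z + 1%:Z)) (esym (E (- K%:Z)))).
  by congr (B _); apply/seteqP; split => x /=; rewrite /central (window_iter _ _ 1).
- move=> _; rewrite [X in (X < _)%E](_ : _ = 1%E) ?ltry//; exact: probability_setT.
Qed.

End bernoulli.

(** * A measure of large entropy on the generated subshift *)
Section block_measure.
Variables (R : realType) (n : nat).
Hypothesis n_gt0 : (0 < n)%N.
Local Notation X := (full_shift R).
Local Notation T := (@shift_map R).
Local Notation L := (2 ^ n)%N.

(** The concatenation of the blocks with bits [x], in phase [o]. *)
Definition blocks_of (o : nat) (x : X) : X := fun i : int =>
  x ((i + o%:Z) %/ L%:Z)%Z (+) (((i + o%:Z) %% L%:Z)%Z == (L.-1)%:Z).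

Let L_gt0 : (0 < L)%N. Proof. by rewrite expn_gt0. Qed.

Lemma blocks_ofE o (x : X) (k : int) (r : nat) : (r < L)%N ->
  blocks_of o x (k * L%:Z - o%:Z + r%:Z) = x k (+) (r == L.-1).
Proof.
move=> rL; rewrite /blocks_of (_ : _ + o%:Z = k * L%:Z + r%:Z); last by rewrite addrAC subrK.
have L0 : L%:Z != 0 by rewrite eqz_nat -lt0n.
rewrite divzMDl// modzMDl divz_small ?modz_small ?addr0 ?eqz_nat//.
Qed.

Lemma blocks_of_FC o x : free_concatenation (W_ n) (blocks_of o x).
Proof.
exists (fun k => rcons (nseq (L - 1) (x k)) (~~ x k)), (fun k => k * L%:Z - o%:Z) => k.
have sw : size (rcons (nseq (L - 1) (x k)) (~~ x k)) = L.
  by rewrite size_rcons size_nseq subn1 prednK.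
split; rewrite ?sw.
- by rewrite !inE; case: (x k); rewrite eqxx ?orbT.
- by rewrite mulrDl mul1r addrAC.
- move=> r rL; rewrite blocks_ofE// nth_rcons size_nseq nth_nseq subn1.
  have [rl|lr] := ltnP r L.-1; first by rewrite ltn_eqF// addbF.
  by rewrite (_ : (r == L.-1) = true) ?addbT//; apply/eqP; lia.
Qed.

Lemma blocks_of_shift o x : T (blocks_of o x) = blocks_of o.+1 x.
Proof.
apply/funext => i; rewrite /shift_map /blocks_of.
by have -> : i + 1 + o%:Z = i + o.+1%:Z by rewrite -addrA -add1n PoszD.
Qed.

Lemma blocks_of_period x : blocks_of L x = blocks_of 0 (T x).
Proof.
have L0 : L%:Z != 0 by rewrite eqz_nat -lt0n.
by apply/funext => i; rewrite /blocks_of /shift_map addr0 divzDr ?dvdzz// modzDr divzz L0.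
Qed.

Lemma measurable_blocks_of o : measurable_fun setT (blocks_of o).
Proof.
apply: measurable_fun_shift => i; rewrite /blocks_of.
case: (_ == _); last by under eq_set do rewrite addbF; exact: measurable_coord.
rewrite (_ : [set y | _] = ~` [set y : X | y ((i + o%:Z) %/ L%:Z)%Z]).
  by apply: measurableC; exact: measurable_coord.
by apply/seteqP; split => y /=; rewrite addbT => /negP.
Qed.

(** Averaging over the phases makes the concatenation of fair blocks stationary.
    A word of length [m] contains the first symbols of at least [m / L - 1]
    consecutive blocks, which are fair bits. *)
Lemma block_measure_exists : exists nu : probability X R,
  [/\ invariant_measure T nu, nu (X_ n) = 1%E &
   forall m w, (L <= m)%N -> pr nu [set x | window 0 m x = w] <= 2 ^- (m %/ L).-1].
Proof.
have [B [Binv Bwin]] := bernoulli_exists R.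
have exQ o : exists Q : probability X R, forall A, Q A = B (blocks_of o @^-1` A).
  exact: pushforward_probability (measurable_blocks_of o).
have [Q QE] := boolp.choice exQ.
pose nu : probability X R := mixture Q L.-1.
have LS : L.-1.+1 = L by rewrite prednK.
have mpre o A : measurable A -> measurable (blocks_of o @^-1` A).
  by move=> mA; rewrite -[_ @^-1` _]setTI; exact: measurable_blocks_of.
have prQ o A : pr (Q o) A = pr B (blocks_of o @^-1` A) by rewrite /pr QE.
exists nu; split.
- move=> A mA; have mTA : measurable (T @^-1` A) := measurable_preimage_iter 1 mA.
  rewrite /nu /= !mixtureE// LS; congr (_ * _)%:E.
  have step o : pr (Q o) (T @^-1` A) = pr B (blocks_of o.+1 @^-1` A).
    rewrite prQ; congr (pr B _); apply/seteqP; split => x /=;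
    by rewrite blocks_of_shift.
  have per : pr B (blocks_of L @^-1` A) = pr B (blocks_of 0 @^-1` A).
    rewrite -(pr_iter Binv 1 (mpre 0%N _ mA)); congr (pr B _).
    by apply/seteqP; split => x /=; rewrite blocks_of_period.
  rewrite -LS in per *; under eq_bigr => o _ do rewrite step.
  under [RHS]eq_bigr => o _ do rewrite prQ.
  by rewrite big_ord_recr [RHS]big_ord_recl /= per addrC.
- rewrite /nu /= mixtureE ?LS; last exact: X_measurable.
  rewrite (eq_bigr (fun=> 1)) ?LS.
    by rewrite sumr_const card_ord mulVf// pnatr_eq0 -lt0n.
  move=> o _; rewrite prQ (_ : _ @^-1` _ = setT) ?pr_setT//.
  by apply/seteqP; split => x // _; apply: FC_X; exact: blocks_of_FC.
- move=> m w Lm; have mw : measurable [set x : X | window 0 m x = w].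
    exact: (@measurable_window_fiber R 0 m [set w]).
  rewrite /pr /nu /= mixtureE// LS /=.
  have L0 : 0 < L%:R :> R by rewrite ltr0n.
  rewrite mulrC ler_pdivrMr//.
  apply: le_trans (_ : \sum_(o < L) 2 ^- (m %/ L).-1 <= _).
    apply: ler_sum => o _; rewrite prQ.
    pose K := (m %/ L).-1; pose v := mkseq (fun k => nth false w (k.+1 * L - o)) K.
    have vK : v \in words K by rewrite mem_words size_mkseq.
    rewrite -/K -(Bwin 1 K v vK); apply: pr_le.
    + exact: mpre.
    + exact: (@measurable_window_fiber R 1 K [set v]).
    + move=> x /= xw; apply/eq_in_map => k; rewrite mem_iota add0n => /andP[_ kK].
      have kL : (k.+1 * L - o < m)%N.
        have h1 : (k.+2 * L <= m)%N.
          apply: leq_trans (leq_trunc_div m L); rewrite leq_pmul2r//.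
          by move: kK; rewrite /K; lia.
        by apply: leq_ltn_trans (leq_subr _ _) _; apply: leq_trans h1; rewrite ltn_pmul2r.
      rewrite -xw nth_mkseq// add0r.
      have oL : (o <= k.+1 * L)%N.
        by apply: leq_trans (ltnW (ltn_ord o)) _; rewrite leq_pmull.
      have -> : (k.+1 * L - o)%N%:Z = (1 + k%:Z) * L%:Z - o%:Z + 0%N%:Z.
        by rewrite addr0 -subzn// PoszM -add1n PoszD.
      rewrite blocks_ofE//.
      have L2 : (2 <= L)%N by rewrite -[leqLHS]expn1 leq_exp2l.
      by rewrite (_ : (0 == L.-1)%N = false) ?addbF//; apply/eqP; lia.
  by rewrite sumr_const card_ord [leRHS]mulr_natr.
Qed.

End block_measure.

Section entropy_lower_bound.
Variables (R : realType) (L : nat) (nu : probability (full_shift R) R).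
Local Notation X := (full_shift R).
Local Notation T := (@shift_map R).
Hypothesis L_gt0 : (0 < L)%N.
Hypothesis nu_inv : invariant_measure T nu.
Hypothesis nu_words : forall m w, (L <= m)%N ->
  pr nu [set x | window 0 m x = w] <= 2 ^- (m %/ L).-1.

Definition first_symbol (x : X) : 'I_2 := if x 0 then lift ord0 ord0 else ord0.

Lemma measurable_first_symbol i : measurable (first_symbol @^-1` [set i]).
Proof.
have m0 := @measurable_coord R 0.
have mf b : measurable ((fun x : X => x 0) @^-1` [set b]).
  case: b; first exact: m0.
  rewrite (_ : _ @^-1` _ = ~` [set x : X | x 0]); first exact: measurableC.
  by apply/seteqP; split => x /=; case: (x 0).
exact: (measurable_preimage_count mf
  [set b : bool | (if b then lift ord0 ord0 else ord0) = i]).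
Qed.

(** The itinerary determines the word of length [m], so that its probability is
    at most [2 ^- (m %/ L).-1]; the entropy is the mean of minus the logarithm of
    such probabilities. *)
Lemma join_entropy_ge m : (L <= m)%N ->
  (m %/ L).-1%:R <= join_entropy T nu first_symbol m.
Proof.
move=> Lm; set a := (m %/ L).-1.
pose it := itinerary first_symbol m.
have mit v : measurable (it @^-1` [set v]).
  by apply: measurable_itinerary; exact: measurable_first_symbol.
have le v : pr nu (it @^-1` [set v]) <= 2 ^- a.
  pose w := mkseq (fun i => nth ord0 v i == lift ord0 ord0) m.
  apply: le_trans (nu_words w Lm); apply: pr_le => //.
    exact: (@measurable_window_fiber R 0 m [set w]).
  move=> x /= xv; apply/eq_in_map => i; rewrite mem_iota add0n => /andP[_ im].
  rewrite -xv (_ : i = Ordinal im)// -tnth_nth tnth_mktuple /first_symbol iter_shiftE.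
  by case: (x _).
have s1 : \sum_v pr nu (it @^-1` [set v]) = 1.
  rewrite (sum_pr_fibers nu (g := it) predT) ?index_enum_uniq//.
    by rewrite [X in pr _ X](_ : _ = setT) ?pr_setT//; apply/seteqP.
  by move=> x; rewrite mem_index_enum.
rewrite /join_entropy -sumrN -[leLHS]mulr1 -[X in _ * X]s1 mulr_sumr.
apply: ler_sum => v _; rewrite join_cellE -/(pr nu _) -/it.
have := pr_ge0 nu (it @^-1` [set v]); rewrite le_eqVlt => /predU1P[<-|p0].
  by rewrite mulr0 mul0r oppr0.
have := le_log2 p0 (le v); rewrite log2V ?exprn_gt0// log2_2X => h.
rewrite -mulrN [leLHS]mulrC.
by rewrite ler_pM2l// lerNr.
Qed.

(** The upper bound on the join entropies ensures that the limit that defines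
    the entropy of the partition exists. *)
Lemma entropy_ge :
  (forall k (p : X -> 'I_k) e, (forall i, measurable (p @^-1` [set i])) -> 0 < e ->
    exists N, forall m, (N <= m)%N -> join_entropy T nu p m <= m%:R * (L%:R^-1 + e)) ->
  ((L%:R^-1)%:E <= entropy T nu)%E.
Proof.
move=> up; have LR : 0 < L%:R :> R by rewrite ltr0n.
apply: ereal_sup_ubound; exists 2, first_symbol.
split; first exact: measurable_first_symbol.
congr EFin; apply/esym; apply: partition_entropyE => e e0.
have [N hN] := up _ first_symbol e measurable_first_symbol e0.
exists (N + L + (Num.bound (2 / e)).+1)%N => m hm.
rewrite hN ?andbT; last by apply: leq_trans hm; rewrite -addnA leq_addr.
have Lm : (L <= m)%N.
  by apply: leq_trans hm; rewrite addnAC addnC leq_addr.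
apply: le_trans (join_entropy_ge Lm).
have h1 : m%:R / L%:R <= (m %/ L).-1%:R + 2 :> R.
  rewrite ler_pdivrMr// -natrD -natrM ler_nat.
  have : (0 < m %/ L)%N by rewrite divn_gt0.
  have := ltnW (ltn_ceil m L_gt0); case: (m %/ L)%N => // q + _.
  by rewrite addn2.
have h2 : 2 <= m%:R * e.
  rewrite -ler_pdivrMr//; apply: (@le_trans _ _ (Num.bound (2 / e))%:R).
    by apply/ltW/archi_boundP; rewrite divr_ge0// ltW.
  by rewrite ler_nat; apply: leq_trans hm; apply: leq_trans (leq_addl _ _); exact: leqnSn.
by rewrite mulrBr; lra.
Qed.

End entropy_lower_bound.

(** * Equilibrium states *)
Section gap_integral.
Variables (R : realType) (N : nat) (alpha : R) (beta : nat -> R) (c1 : R).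
Local Notation X := (full_shift R).
Local Notation T := (@shift_map R).
Hypothesis N_gt0 : (0 < N)%N.
Hypothesis alpha_gt0 : 0 < alpha.
Hypothesis alpha_beta : alpha < beta 1%N.
Hypothesis beta_incr : forall i : nat, (1 <= i < N)%N -> beta i < beta i.+1.
Local Notation c := (@c_ R beta c1).
Local Notation phi := (@phi R N alpha beta c1).
Local Notation gap := (@gap R N alpha beta c1).
Local Notation h := ((2 ^+ N.+1)^-1 : R).

Lemma gap_has_integral (nu : probability X R) :
  exists2 g, 0 <= g & has_integral nu gap g.
Proof.
have mg := measurable_gap N alpha beta c1.
have gb := gap_bounds c1 N_gt0 alpha_gt0 alpha_beta beta_incr.
have [g g0 Ig] := integral_bounded nu mg gb.
by exists g => //; split => // x; have /andP[] := gb x.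
Qed.

Lemma gap_integral_eq0 (nu : probability X R) g :
  has_integral nu gap g -> g = 0 <-> nu (X_ N.+1) = 1%E.
Proof.
move=> [mg g0 Ig]; have mX := @X_measurable R N.+1.
have gap0 := gap_eq0 c1 N_gt0 alpha_gt0 alpha_beta beta_incr.
have mEg : measurable_fun setT (fun x => (gap x)%:E) by exact/measurable_EFinP.
have absE : (\int[nu]_x `|(gap x)%:E| = g%:E)%E.
  by rewrite -Ig; apply: eq_integral => x _; rewrite gee0_abs ?lee_fin.
split => [g_0|nuX].
- have /(ae_eq_integral_abs nu measurableT mEg) [Z [mZ Z0 hZ]] :
      (\int[nu]_x `|(gap x)%:E| = 0)%E by rewrite absE g_0.
  have XZ : ~` X_ N.+1 `<=` Z.
    move=> x nX; apply: hZ => /= /(_ I) [/gap0]; exact: nX.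
  have prC : pr nu (~` X_ N.+1) = 0.
    apply/eqP; rewrite eq_le pr_ge0 andbT.
    apply: le_trans (pr_le nu _ mZ XZ) _; first exact: measurableC.
    by rewrite /pr; have -> : nu Z = 0%E by exact: Z0.
  have -> : nu (X_ N.+1) = (1 - nu (~` X_ N.+1))%E.
    by rewrite -[in LHS](setCK (X_ N.+1)); apply: probability_setC; exact: measurableC.
  by rewrite (prE nu (measurableC mX)) prC sube0.
- apply: EFin_inj; rewrite -absE; apply/(ae_eq_integral_abs nu measurableT mEg).
  exists (~` X_ N.+1); split; first exact: measurableC.
    have := probability_setC nu mX; rewrite nuX subee// => E; exact: E.
  by move=> x; apply: contra_not => /= xX _; congr EFin; exact/gap0.
Qed.

(** For [G = beta N * gap + 2^-(N+1)], the levels that [variational_joins]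
    requires come from [gap_level]. *)
Lemma gap_variational (nu : probability X R) g :
  invariant_measure T nu -> has_integral nu gap g ->
  forall k (p : X -> 'I_k) e, (forall i, measurable (p @^-1` [set i])) -> 0 < e ->
    exists M, forall m, (M <= m)%N ->
      join_entropy T nu p m <= m%:R * (beta N * g + h + e).
Proof.
move=> inv gI.
have /andP[bN _] : alpha < beta N <= beta N.
  by apply: (beta_bounds N_gt0 alpha_gt0 alpha_beta beta_incr); rewrite N_gt0 leqnn.
have b0 : 0 <= beta N := ltW (lt_trans alpha_gt0 bN).
have gb := gap_bounds c1 N_gt0 alpha_gt0 alpha_beta beta_incr.
have h0 : 0 <= h by rewrite invr_ge0 exprn_ge0.
pose G x := beta N * gap x + h.
have [mG _ IG] : has_integral nu G (beta N * g + h).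
  by apply: has_integralD; [exact: has_integralZ | exact: has_integral_cst].
move=> k p e mp e0.
apply: (@variational_joins R G (beta N * (c N.+1 - c 1%N + 10 / alpha) + h)) => //.
- move=> x; have /andP[g1 g2] := gb x; rewrite /G addr_ge0 ?mulr_ge0//=.
  by rewrite lerD2r ler_wpM2l.
- exact: (gap_level c1 N_gt0 alpha_gt0 alpha_beta beta_incr).
Qed.

Lemma integral_phi (nu : probability X R) g b :
  0 <= b -> has_integral nu gap g ->
  (\int[nu]_x (b * phi x)%:E = (b * (c N.+1 - g))%:E)%E.
Proof.
move=> b0 gI.
have E x : b * phi x = b * c N.+1 - b * gap x by rewrite /gap; lra.
under eq_integral => x _ do rewrite E EFinB.
have [mbg bg0 Ibg] := has_integralZ b0 gI.
rewrite integralB_EFin//.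
- by rewrite Ibg integral_constant -EFinB mulrBr.
- exact: finite_measure_integrable_cst.
- apply/integrableP; split.
    exact/measurable_EFinP.
  under eq_integral => x _ do rewrite /= ger0_norm ?bg0//.
  by rewrite Ibg ltry.
Qed.

End gap_integral.

(** The upper bound required by [entropy_ge] is [gap_variational] for a vanishing
    integral of the gap. *)
Lemma block_measure_entropy (R : realType) (N : nat) (alpha : R) (beta : nat -> R) (c1 : R) :
  (0 < N)%N -> 0 < alpha -> alpha < beta 1%N ->
  (forall i : nat, (1 <= i < N)%N -> beta i < beta i.+1) ->
  exists nu : probability (full_shift R) R,
    [/\ invariant_measure shift_map nu, nu (X_ N.+1) = 1%E &
        (((2 ^ N.+1)%:R^-1)%:E <= entropy shift_map nu)%E].
Proof.
move=> N0 a0 ab binc.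
have [nu [inv nuX words_le]] := @block_measure_exists R N.+1 isT.
exists nu; split => //.
apply: entropy_ge words_le _; rewrite ?expn_gt0// => k p e mp e0.
have [g g0 Ig] := gap_has_integral c1 N0 a0 ab binc nu.
have := gap_variational N0 a0 ab binc inv Ig mp e0.
have /(gap_integral_eq0 N0 a0 ab binc Ig) -> := nuX.
by rewrite mulr0 add0r natrX.
Qed.

Theorem corollary3 (R : realType) (N : nat) (alpha : R) (beta : nat -> R)
    (c1 : R) (mu : probability (full_shift R) R) (b : R) :
  (0 < N)%N ->
  0 < alpha ->
  alpha < beta 1%N ->
  (forall i : nat, (1 <= i < N)%N -> beta i < beta i.+1) ->
  measure_of_maximal_entropy shift_map (X_ N.+1) mu ->
  beta N < b ->
  unique_equilibrium_state shift_map (fun x => b * phi N alpha beta c1 x) mu.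
Proof.
move=> N0 a0 ab binc [mu_inv muX mu_max] bNb.
have /andP[bN _] : alpha < beta N <= beta N.
  by apply: (beta_bounds N0 a0 ab binc); rewrite N0 leqnn.
have b0 : 0 <= b by lra.
have bN0 : 0 < beta N by lra.
set h : R := (2 ^ N.+1)%:R^-1.
have hE : (2 ^+ N.+1)^-1 = h by rewrite /h natrX.
have h0 : 0 <= h by rewrite invr_ge0.
have [nu0 [nu0_inv nu0X nu0_h]] := block_measure_entropy c1 N0 a0 ab binc.
have mu_h : (h%:E <= entropy shift_map mu)%E.
  exact: le_trans nu0_h (mu_max _ nu0_inv nu0X).
have upper nu (g : R) : invariant_measure shift_map nu -> 0 <= g ->
    has_integral nu (gap N alpha beta c1) g ->
    (entropy shift_map nu <= (beta N * g + h)%:E)%E.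
  move=> inv g0 Ig; apply: entropy_le_joins; first by rewrite addr_ge0// mulr_ge0// ltW.
  move=> k p e mp e0; rewrite -hE.
  exact: (gap_variational N0 a0 ab binc inv Ig mp e0).
have [gmu gmu0 Igmu] := gap_has_integral c1 N0 a0 ab binc mu.
have gmuE : gmu = 0 by apply/(gap_integral_eq0 N0 a0 ab binc Igmu).
have Imu := integral_phi b0 Igmu; rewrite gmuE subr0 in Imu.
set C := c_ beta c1 N.+1 in Imu.
split.
- split => // nu inv.
  have [g g0 Ig] := gap_has_integral c1 N0 a0 ab binc nu.
  rewrite Imu (integral_phi b0 Ig) -/C.
  apply: le_trans (leeD (upper _ _ inv g0 Ig) (lexx _)) _.
  apply: le_trans (leeD mu_h (lexx _)); rewrite -!EFinD lee_fin; nra.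
- move=> nu [inv nu_eq].
  have [g g0 Ig] := gap_has_integral c1 N0 a0 ab binc nu.
  have := nu_eq _ mu_inv; rewrite Imu (integral_phi b0 Ig) -/C => le1.
  have le2 := le_trans (leeD mu_h (lexx _)) le1.
  have := le_trans le2 (leeD (upper _ _ inv g0 Ig) (lexx _)).
  rewrite -!EFinD lee_fin => le3.
  have gE : g = 0 by apply/eqP; rewrite eq_le g0 andbT; nra.
  have nuX : nu (X_ N.+1) = 1%E by apply/(gap_integral_eq0 N0 a0 ab binc Ig).
  have nu_h : (h%:E <= entropy shift_map nu)%E.
    by move: le2; rewrite gE subr0 leeD2rE.
  have L4 : (4 <= 2 ^ N.+1)%N by rewrite -[4%N]/(2 ^ 2)%N leq_exp2l.
  exact: (max_entropy_unique L4 (@X_measurable R N.+1) (@X_parsable R N.+1)).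
Qed.
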